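(* Let $G$ be a Lie group (in Milnor's sense, modeled over a Hausdorff locally convex vector space), and suppose that $G$ is locally $\mu$-convex. Then: (1) For each $k\in\mathbb N_{\ge1}\sqcup\{\mathrm{lip},\infty\}$, $G$ is $C^k$-semiregular if and only if $G$ is Mackey complete and $k$-confined. (2) $G$ is $C^0$-semiregular if $G$ is sequentially complete and $0$-confined.
   Context: Calculus: for Hausdorff locally convex vector spaces $F,E$ and $U\subseteq F$ open, a map $f:U\to E$ is differentiable at $x$ if $D_vf(x)=\lim_{t\to 0}\frac1t(f(x+tv)-f(x))$ exists in $E$ for every $v\in F$; it is $C^0$ if continuous, $C^k$ ($k\ge 1$) if all iterated directional derivatives $D_{v_p}\cdots D_{v_1}f$ ($p\le k$) exist and $(x,v_1,\dots,v_p)\mapsto D_{v_p}\cdots D_{v_1}f(x)$ is continuous on $U\times F^p$ for $0\le p\le k$; $C^\infty$ (smooth) if $C^k$ for all $k$. $G$ is a Lie group in Milnor's sense: a group that is a smooth Hausdorff manifold (in this calculus) modeled on a Hausdorff locally convex vector space $E$, with smooth multiplication and inversion. $e$ is the unit, $\mathfrak g=T_eG$ the Lie algebra, $\mathrm R_g(h)=hg$, $\mathrm{Ad}_g=d_e(h\mapsto ghg^{-1})$. $\mathfrak P$ is the set of continuous seminorms on $E$. $\Xi:G\supseteq\mathcal U\to\mathcal V\subseteq E$ is a fixed chart with $e\in\mathcal U$, $\Xi(e)=0$, $\mathcal V$ convex. For $\mathfrak p\in\mathfrak P$ put $\dot{\mathfrak p}:=\mathfrak p\circ d_e\Xi$,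 a seminorm on $\mathfrak g$; these define the topology of $\mathfrak g$. An assertion such as $(\mathfrak p\circ\Xi)(g)\le c$ includes that $g\in\mathcal U$. A curve on $[r,r']$ ($r<r'$) is $C^k$, $k\in\mathbb N\sqcup\{\infty\}$, if it is the restriction of a $C^k$-curve on an open interval containing $[r,r']$; $C^{\mathrm{lip}}([r,r'],\mathfrak g)$ is the set of curves $\phi$ such that for each $\mathfrak p\in\mathfrak P$ there is $L_{\mathfrak p}\ge0$ with $\dot{\mathfrak p}(\phi(t)-\phi(t'))\le L_{\mathfrak p}|t-t'|$ for all $t,t'$. The right logarithmic derivative of $\mu\in C^1([r,r'],G)$ is $\delta^r(\mu)(t)=d_{\mu(t)}\mathrm R_{\mu(t)^{-1}}(\dot\mu(t))$. Put $\mathfrak D_{[r,r']}:=\delta^r(C^1([r,r'],G))$ and $\mathfrak D^k_{[r,r']}:=\mathfrak D_{[r,r']}\cap C^k([r,r'],\mathfrak g)$. For $\phi=\delta^r(\mu)\in\mathfrak D_{[r,r']}$ the product integral is $\Pi_r^t\phi:=\mu(t)\mu(r)^{-1}$ (well defined). $G$ is $C^k$-semiregular if $\mathfrak D^k_{[0,1]}=C^k([0,1],\mathfrak g)$. $G$ is locally $\mu$-convex if for each $\mathfrak u\in\mathfrak P$ there exists $\mathfrak o\in\mathfrak P$ with $\mathfrak u\le\mathfrak o$ such that $(\mathfrak u\circ\Xi)(\Xi^{-1}(X_1)\cdots\Xi^{-1}(X_n))\le\mathfrak o(X_1)+\dots+\mathfrak o(X_n)$ for all $n\ge1$ and all $X_1,\dots,X_n\in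 E$ with $\mathfrak o(X_1)+\dots+\mathfrak o(X_n)\le1$. A sequence $\{g_n\}\subseteq G$ is Cauchy if for all $\mathfrak p\in\mathfrak P$, $\varepsilon>0$ there is $p\in\mathbb N$ with $(\mathfrak p\circ\Xi)(g_m^{-1}g_n)\le\varepsilon$ for $m,n\ge p$; it is Mackey-Cauchy if there are $c_{\mathfrak p}\ge0$, $l_{\mathfrak p}\in\mathbb N$ ($\mathfrak p\in\mathfrak P$) and $\lambda_{m,n}\ge0$ with $\lambda_{m,n}\to0$ as $(m,n)\to\infty$ such that $(\mathfrak p\circ\Xi)(g_m^{-1}g_n)\le c_{\mathfrak p}\lambda_{m,n}$ for all $m,n\ge l_{\mathfrak p}$, $\mathfrak p\in\mathfrak P$. $G$ is sequentially (resp. Mackey) complete if every Cauchy (resp. Mackey-Cauchy) sequence in $G$ converges in $G$. Piecewise integrable curves: $\mathfrak DP^0([0,1],\mathfrak g)$ is the set of maps $\phi:[0,1]\to\mathfrak g$ for which there exist $0=t_0<\dots<t_n=1$ and $\phi[p]\in\mathfrak D^0_{[t_p,t_{p+1}]}$ with $\phi|_{(t_p,t_{p+1})}=\phi[p]|_{(t_p,t_{p+1})}$ for $p=0,\dots,n-1$; then $\Pi_0^0\phi:=e$ and $\Pi_0^t\phi:=\Pi_{t_p}^t\phi[p]\cdot\Pi_{t_{p-1}}^{t_p}\phi[p-1]\cdots\Pi_{t_0}^{t_1}\phi[0]$ for $t\in(t_p,t_{p+1}]$ (well defined). Write $\dot{\mathfrak p}_\infty(\phi)=\sup_{t\in[0,1]}\dot{\mathfrak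 p}(\phi(t))$. A sequence $\{\phi_n\}\subseteq\mathfrak DP^0([0,1],\mathfrak g)$ is tame if for each $\mathfrak v\in\mathfrak P$ there is $\mathfrak w\in\mathfrak P$, $\mathfrak v\le\mathfrak w$, with $\dot{\mathfrak v}\circ\mathrm{Ad}_{[\Pi_0^t\phi_n]^{-1}}\le\dot{\mathfrak w}$ for all $n\in\mathbb N$, $t\in[0,1]$. It is Cauchy if for all $\mathfrak p$, $\varepsilon>0$ there is $p$ with $\dot{\mathfrak p}_\infty(\phi_m-\phi_n)\le\varepsilon$ for $m,n\ge p$; it is Mackey-Cauchy if there are $c_{\mathfrak p}\ge0$, $l_{\mathfrak p}\in\mathbb N$ and $0\le\lambda_{m,n}\to0$ with $\dot{\mathfrak p}_\infty(\phi_m-\phi_n)\le c_{\mathfrak p}\lambda_{m,n}$ for all $m,n\ge l_{\mathfrak p}$, $\mathfrak p\in\mathfrak P$. A curve $\phi\in C^0([0,1],\mathfrak g)$ is $\mathfrak s$-integrable (resp. $\mathfrak m$-integrable) if there is a tame Cauchy (resp. tame Mackey-Cauchy) sequence in $\mathfrak DP^0([0,1],\mathfrak g)$ converging to $\phi$ uniformly (i.e. in all $\dot{\mathfrak p}_\infty$). $G$ is $0$-confined if each $\phi\in C^0([0,1],\mathfrak g)$ is $\mathfrak s$-integrable; for $k\in\mathbb N_{\ge1}\sqcup\{\mathrm{lip},\infty\}$, $G$ is $k$-confined if each $\phi\in C^k([0,1],\mathfrak g)$ is $\mathfrak m$-integrable. *)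

(* Defs.v *)
From HB Require Import structures.
From mathcomp Require Import all_boot all_order all_algebra.
From mathcomp Require Import all_classical all_reals all_analysis.

Set Implicit Arguments.
Unset Strict Implicit.
Unset Printing Implicit Defensive.

Import Order.TTheory GRing.Theory Num.Theory.
Import numFieldNormedType.Exports.

Local Open Scope classical_set_scope.
Local Open Scope ring_scope.

(* Vector spaces are real.  Maps are total functions, and only their values on
   the open set [U] under consideration matter.  The library's [derive] requires
   normed modules, hence the definitions below. *)
Section Calculus.
Context {R : realType} {F E : tvsType R}.
Implicit Types (f : F -> E) (U : set F) (x v : F) (vs : seq F).

Definition has_dderiv f x v (d : E) : Prop :=
  h^-1 *: (f (x + h *: v) - f x) @[h --> (0 : R)^'] --> d.

(* D_v f (x); the limit is unique when E is Hausdorff. *)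
Definition dderiv f x v : E := xget 0 (has_dderiv f x v).

(* iter_dderiv f [:: v_1; ...; v_p] is D_{v_p} ... D_{v_1} f. *)
Definition iter_dderiv f vs : F -> E := foldl (fun g v => dderiv g ^~ v) f vs.

Fixpoint iter_derivable U f vs : Prop :=
  if vs is v :: vs' then
    (forall x, U x -> exists d, has_dderiv f x v d) /\
    iter_derivable U (dderiv f ^~ v) vs'
  else True.

(* F^p is the space 'rV[F]_p of rows, with the product topology. *)
Definition Ck (k : nat) U f : Prop :=
  forall p : nat, (p <= k)%N ->
    (forall vs, size vs = p -> iter_derivable U f vs) /\
    (forall z : F * 'rV[F]_p, U z.1 ->
       {for z, continuous (fun y : F * 'rV[F]_p =>
          iter_dderiv f [seq y.2 ord0 i | i <- enum 'I_p] y.1)}).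

Definition smooth U f : Prop := forall k, Ck k U f.

End Calculus.

Section Seminorms.
Context {R : realType}.

Record cseminorm (E : tvsType R) := CSeminorm {
  seminorm :> E -> R;
  seminormD : forall x y, seminorm (x + y) <= seminorm x + seminorm y;
  seminormZ : forall (a : R) x, seminorm (a *: x) = `|a| * seminorm x;
  seminorm_continuous : continuous seminorm
}.

Definition seminorm_le (E : tvsType R) (p q : cseminorm E) : Prop :=
  forall x, p x <= q x.

End Seminorms.

Section Manifolds.
Context {R : realType}.

(* Homeomorphisms from an open subset of M onto an open subset of E. *)
Record chart (M : topologicalType) (E : tvsType R) := Chart {
  chart_dom : set M;
  chart_cod : set E;
  chart_map :> M -> E;
  chart_inv : E -> M;
  chart_dom_open : open chart_dom;
  chart_cod_open : open chart_cod;
  chart_mapP : forall x, chart_dom x -> chart_cod (chart_map x);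
  chart_invP : forall y, chart_cod y -> chart_dom (chart_inv y);
  chart_mapK : forall x, chart_dom x -> chart_inv (chart_map x) = x;
  chart_invK : forall y, chart_cod y -> chart_map (chart_inv y) = y;
  chart_map_continuous :
    forall x, chart_dom x -> {for x, continuous chart_map};
  chart_inv_continuous :
    forall y, chart_cod y -> {for y, continuous chart_inv}
}.

Definition compatible (M : topologicalType) (E : tvsType R)
    (c c' : chart M E) : Prop :=
  smooth (chart_cod c `&` chart_inv c @^-1` chart_dom c') (c' \o chart_inv c).

Record manifold (M : topologicalType) (E : tvsType R) := Manifold {
  atlas : set (chart M E);
  manifold_hausdorff : hausdorff_space M;
  atlas_cover : forall x, exists2 c, atlas c & chart_dom c x;
  atlas_compatible : forall c c', atlas c -> atlas c' -> compatible c c'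
}.

(* Membership in the maximal atlas generated by [atlas A]. *)
Definition smooth_chart (M : topologicalType) (E : tvsType R)
    (A : manifold M E) (c : chart M E) : Prop :=
  forall c', atlas A c' -> compatible c c' /\ compatible c' c.

Definition chart_at (M : topologicalType) (E : tvsType R) (A : manifold M E)
    (x : M) : chart M E := projT1 (cid2 (atlas_cover A x)).

Local Obligation Tactic := idtac.

Program Definition id_chart (E : tvsType R) : chart E E :=
  @Chart E E setT setT id id _ _ _ _ _ _ _ _.
Next Obligation. by move=> E; exact: openT. Qed.
Next Obligation. by move=> E; exact: openT. Qed.
Next Obligation. by []. Qed.
Next Obligation. by []. Qed.
Next Obligation. by []. Qed.
Next Obligation. by []. Qed.
Next Obligation. by move=> E x _; exact: cvg_id. Qed.
Next Obligation. by move=> E x _; exact: cvg_id. Qed.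

Lemma open_setX (M N : topologicalType) (A : set M) (B : set N) :
  open A -> open B -> open (A `*` B).
Proof.
move=> oA oB; rewrite openE => -[x y] [/= Ax By].
by exists (A, B) => //=; split; exact: open_nbhs_nbhs.
Qed.

Program Definition prod_chart (M N : topologicalType) (E F : tvsType R)
    (c : chart M E) (c' : chart N F) : chart (M * N)%type (E * F)%type :=
  @Chart (M * N)%type (E * F)%type
    (chart_dom c `*` chart_dom c') (chart_cod c `*` chart_cod c')
    (fun x => (c x.1, c' x.2)) (fun y => (chart_inv c y.1, chart_inv c' y.2))
    _ _ _ _ _ _ _ _.
Next Obligation. by move=> *; apply: open_setX; exact: chart_dom_open. Qed.
Next Obligation. by move=> *; apply: open_setX; exact: chart_cod_open. Qed.
Next Obligation.
by move=> M N E F c c' [x y] [/= ? ?]; split; exact: chart_mapP.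
Qed.
Next Obligation.
by move=> M N E F c c' [x y] [/= ? ?]; split; exact: chart_invP.
Qed.
Next Obligation.
by move=> M N E F c c' [x y] [/= ? ?]; congr pair; exact: chart_mapK.
Qed.
Next Obligation.
by move=> M N E F c c' [x y] [/= ? ?]; congr pair; exact: chart_invK.
Qed.
Next Obligation.
move=> M N E F c c' [x y] [/= cx cy]; apply: cvg_pair => /=.
- apply: (cvg_comp _ _ (@cvg_fst _ _ _ _ _)); exact: chart_map_continuous.
- apply: (cvg_comp _ _ (@cvg_snd _ _ _ _ _)); exact: chart_map_continuous.
Qed.
Next Obligation.
move=> M N E F c c' [x y] [/= cx cy]; apply: cvg_pair => /=.
- apply: (cvg_comp _ _ (@cvg_fst _ _ _ _ _)); exact: chart_inv_continuous.
- apply: (cvg_comp _ _ (@cvg_snd _ _ _ _ _)); exact: chart_inv_continuous.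
Qed.

Definition prod_atlas (M N : topologicalType) (E F : tvsType R)
    (A : set (chart M E)) (B : set (chart N F)) :
    set (chart (M * N)%type (E * F)%type) :=
  [set d | exists c, exists c', [/\ A c, B c' & d = prod_chart c c']].

(* D is meant to be open; continuity then makes the sets below open. *)
Definition Ck_map (M N : topologicalType) (E F : tvsType R) (k : nat)
    (A : set (chart M E)) (B : set (chart N F)) (D : set M) (f : M -> N) :
    Prop :=
  (forall x, D x -> {for x, continuous f}) /\
  forall c c', A c -> B c' ->
    Ck k (chart_cod c `&` chart_inv c @^-1` (D `&` f @^-1` chart_dom c'))
      (c' \o f \o chart_inv c).

Definition smooth_map (M N : topologicalType) (E F : tvsType R)
    (A : set (chart M E)) (B : set (chart N F)) (f : M -> N) : Prop :=
  forall k, Ck_map k A B setT f.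

(* T_x M.  A tangent vector is a class of pairs (chart around x, vector of E);
   every class has exactly one representative whose chart is [chart_at A x], so
   that T_x M is encoded as E, read in that chart. *)
Definition tangent (M : topologicalType) (E : tvsType R) (A : manifold M E)
    (x : M) : tvsType R := E.

Definition mdiff (M N : topologicalType) (E F : tvsType R) (A : manifold M E)
    (B : manifold N F) (f : M -> N) (x : M) (v : tangent A x) :
    tangent B (f x) :=
  dderiv (chart_at B (f x) \o f \o chart_inv (chart_at A x))
    (chart_at A x x) v.

(* The differential of a map into a vector space F, whose tangent spaces are F
   itself. *)
Definition vdiff (M : topologicalType) (E F : tvsType R) (A : manifold M E)
    (f : M -> F) (x : M) (v : tangent A x) : F :=
  dderiv (f \o chart_inv (chart_at A x)) (chart_at A x x) v.

Definition velocity (M : topologicalType) (E : tvsType R) (A : manifold M E)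
    (mu : R -> M) (t : R) : tangent A (mu t) :=
  @dderiv R R^o E (chart_at A (mu t) \o mu) t 1.

End Manifolds.

Arguments mdiff {R M N E F} A B f x v.
Arguments vdiff {R M E F} A f x v.

(* Joint carrier of a group and a topology; the continuity of the operations
   follows from their smoothness below. *)
#[short(type="preTopologicalGroupType")]
HB.structure Definition PreTopologicalGroup := {G of Group G & Topological G}.

Record lieGroup (R : realType) (E : tvsType R) := LieGroup {
  lie_carrier :> preTopologicalGroupType;
  lie_manifold : manifold lie_carrier E;
  lie_mul_smooth :
    smooth_map (prod_atlas (atlas lie_manifold) (atlas lie_manifold))
      (atlas lie_manifold) (fun gh : lie_carrier * lie_carrier =>
        (gh.1 * gh.2)%g);
  lie_inv_smooth :
    smooth_map (atlas lie_manifold) (atlas lie_manifold)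
      (fun g : lie_carrier => g^-1%g)
}.

Inductive regularity := Cfin of nat | Clip | Cinf.

Section LieGroups.
Context {R : realType} {E : tvsType R} (G : lieGroup E).

Let A := lie_manifold G.

Definition lie_alg : tvsType R := tangent A 1%g.

(* The values of [mdiff] lie in the tangent space at g 1 g^-1 = 1. *)
Definition Ad (g : G) (X : lie_alg) : lie_alg :=
  mdiff A A (fun h : G => (g * h * g^-1)%g) 1%g X.

(* The values of [mdiff] lie in the tangent space at mu(t) mu(t)^-1 = 1. *)
Definition deltar (mu : R -> G) (t : R) : lie_alg :=
  mdiff A A (fun h : G => (h * (mu t)^-1)%g) (mu t) (velocity A mu t).

Definition interval_nbhs (r r' : R) (J : set R) : Prop :=
  [/\ open J, is_interval J & `[r, r'] `<=` J].

(* mu restricts to an element of C^1([r,r'],G), and its values outside [r,r']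
   provide the extension to an open interval. *)
Definition C1_curve (r r' : R) (mu : R -> G) : Prop :=
  exists2 J, interval_nbhs r r' J &
    Ck_map 1 [set id_chart R^o] (atlas A) J (mu : R^o -> G).

(* At the end points, [deltar mu] is computed with the extension provided by mu;
   it does not depend on that extension. *)
Definition Dset (r r' : R) : set (R -> lie_alg) :=
  [set phi | exists2 mu, C1_curve r r' mu &
    forall t, t \in `[r, r'] -> phi t = deltar mu t].

(* Meant for phi in [Dset r r'] and t in [r,r']; the value is then independent
   of mu. *)
Definition prodint (r r' : R) (phi : R -> lie_alg) (t : R) : G :=
  xget 1%g [set g | exists mu, [/\ C1_curve r r' mu,
    forall s, s \in `[r, r'] -> phi s = deltar mu s &
    g = (mu t * (mu r)^-1)%g]].

Variable Xi : chart G E.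

Definition dXi (X : lie_alg) : E := vdiff A Xi 1%g X.

Definition sdot (p : cseminorm E) (X : lie_alg) : R := p (dXi X).

Definition sdot_sup (p : cseminorm E) (phi : R -> lie_alg) : \bar R :=
  ereal_sup [set (sdot p (phi t))%:E | t in `[0, 1]].

(* (p o Xi)(g) <= c, including that g lies in the domain of Xi. *)
Definition Xi_le (p : cseminorm E) (g : G) (c : R) : Prop :=
  chart_dom Xi g /\ p (Xi g) <= c.

Definition C_curve (k : regularity) (r r' : R) : set (R -> lie_alg) :=
  [set phi | match k with
  | Cfin n => exists J psi, [/\ interval_nbhs r r' J,
      @Ck R R^o lie_alg n J psi & forall t, t \in `[r, r'] -> phi t = psi t]
  | Cinf => exists J psi, [/\ interval_nbhs r r' J,
      @smooth R R^o lie_alg J psi & forall t, t \in `[r, r'] -> phi t = psi t]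
  | Clip => forall p : cseminorm E, exists2 L : R, 0 <= L &
      forall t t', t \in `[r, r'] -> t' \in `[r, r'] ->
        sdot p (phi t - phi t') <= L * `|t - t'|
  end].

Definition Dk (k : regularity) (r r' : R) : set (R -> lie_alg) :=
  Dset r r' `&` C_curve k r r'.

Definition semiregular (k : regularity) : Prop := Dk k 0 1 = C_curve k 0 1.

(* The inequality presupposes that every X i lies in the range of Xi. *)
Definition locally_mu_convex : Prop :=
  forall u : cseminorm E, exists2 o : cseminorm E, seminorm_le u o &
    forall (n : nat) (X : 'I_n.+1 -> E), \sum_i o (X i) <= 1 ->
      (forall i, chart_cod Xi (X i)) /\
      Xi_le u (\prod_i chart_inv Xi (X i))%g (\sum_i o (X i)).

Definition cauchy_seq (g : nat -> G) : Prop :=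
  forall (p : cseminorm E) (eps : R), 0 < eps ->
    exists N : nat, forall m n : nat, (N <= m)%N -> (N <= n)%N ->
      Xi_le p ((g m)^-1 * g n)%g eps.

Definition null_double_seq (lam : nat -> nat -> R) : Prop :=
  (forall m n, 0 <= lam m n) /\
  lam mn.1 mn.2 @[mn --> filter_prod \oo \oo] --> (0 : R).

Definition mackey_cauchy_seq (g : nat -> G) : Prop :=
  exists (c : cseminorm E -> R) (l : cseminorm E -> nat)
      (lam : nat -> nat -> R),
    [/\ forall p, 0 <= c p, null_double_seq lam &
      forall p (m n : nat), (l p <= m)%N -> (l p <= n)%N ->
        Xi_le p ((g m)^-1 * g n)%g (c p * lam m n)].

Definition sequentially_complete : Prop :=
  forall g : nat -> G, cauchy_seq g -> exists x : G, g @ \oo --> x.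

Definition mackey_complete : Prop :=
  forall g : nat -> G, mackey_cauchy_seq g -> exists x : G, g @ \oo --> x.

Definition pw_decomp (phi : R -> lie_alg) (n : nat) (ts : nat -> R)
    (phis : nat -> R -> lie_alg) : Prop :=
  [/\ ts 0%N = 0, ts n = 1 & forall p : nat, (p < n)%N ->
    [/\ ts p < ts p.+1, Dk (Cfin 0) (ts p) (ts p.+1) (phis p) &
      forall t, t \in `]ts p, ts p.+1[ -> phi t = phis p t]].

Definition DP0 : set (R -> lie_alg) :=
  [set phi | exists n ts phis, pw_decomp phi n ts phis].

Fixpoint step_prodint (ts : nat -> R) (phis : nat -> R -> lie_alg) (p : nat) :
    G :=
  if p is q.+1 then
    (prodint (ts q) (ts q.+1) (phis q) (ts q.+1) * step_prodint ts phis q)%g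
  else 1%g.

(* Meant for phi in [DP0] and t in [0,1]; the value is then independent of the
   decomposition. *)
Definition pw_prodint (phi : R -> lie_alg) (t : R) : G :=
  if t == 0 then 1%g else
  xget 1%g [set g | exists n ts phis (p : nat),
    [/\ pw_decomp phi n ts phis, (p < n)%N, t \in `]ts p, ts p.+1] &
      g = (prodint (ts p) (ts p.+1) (phis p) t * step_prodint ts phis p)%g]].

Definition tame (phi : nat -> R -> lie_alg) : Prop :=
  forall v : cseminorm E, exists2 w : cseminorm E, seminorm_le v w &
    forall (n : nat) (t : R), t \in `[0, 1] -> forall X : lie_alg,
      sdot v (Ad (pw_prodint (phi n) t)^-1%g X) <= sdot w X.

Definition cauchy_curves (phi : nat -> R -> lie_alg) : Prop :=
  forall (p : cseminorm E) (eps : R), 0 < eps ->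
    exists N : nat, forall m n : nat, (N <= m)%N -> (N <= n)%N ->
      (sdot_sup p (fun t => (phi m t - phi n t)%R) <= eps%:E)%E.

Definition mackey_cauchy_curves (phi : nat -> R -> lie_alg) : Prop :=
  exists (c : cseminorm E -> R) (l : cseminorm E -> nat)
      (lam : nat -> nat -> R),
    [/\ forall p, 0 <= c p, null_double_seq lam &
      forall p (m n : nat), (l p <= m)%N -> (l p <= n)%N ->
        (sdot_sup p (fun t => (phi m t - phi n t)%R) <= (c p * lam m n)%:E)%E].

Definition cvg_unif (phi : nat -> R -> lie_alg) (psi : R -> lie_alg) : Prop :=
  forall p : cseminorm E,
    sdot_sup p (fun t => phi n t - psi t) @[n --> \oo] --> 0%E.

Definition s_integrable (psi : R -> lie_alg) : Prop :=
  exists phi : nat -> R -> lie_alg, [/\ forall n, DP0 (phi n), tame phi,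
    cauchy_curves phi & cvg_unif phi psi].

Definition m_integrable (psi : R -> lie_alg) : Prop :=
  exists phi : nat -> R -> lie_alg, [/\ forall n, DP0 (phi n), tame phi,
    mackey_cauchy_curves phi & cvg_unif phi psi].

Definition confined (k : regularity) : Prop :=
  forall psi, C_curve k 0 1 psi ->
    if k is Cfin 0 then s_integrable psi else m_integrable psi.

End LieGroups.

(* Main.v *)
Require Import Defs.
From mathcomp Require Import all_boot all_order all_algebra.
From mathcomp Require Import all_classical all_reals all_analysis.
From mathcomp Require Import ring lra.

Set Implicit Arguments.
Unset Strict Implicit.
Unset Printing Implicit Defensive.

Import Order.TTheory GRing.Theory Num.Theory.
Import numFieldNormedType.Exports.

Local Open Scope classical_set_scope.
Local Open Scope ring_scope.


(** Everything is read in the chart [Xi]; its inverse, written exp below, takes the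
    place of an exponential map.  Curves in G are handled through their one-sided
    right logarithmic derivatives read in [Xi] ([Rd]), and [good mu b x y] says that
    mu integrates b on the interval from x to y.

    Local mu-convexity acts mainly through one estimate, [mu_mean_value]: if the
    logarithmic derivatives of eta are at most M in a seminorm adapted to u, then
    eta(b) eta(a)^-1 has size at most M (b - a) in u.  Indeed, the short increments
    of eta are exponentials of vectors of size about M |h|, and mu-convexity bounds
    their product along the interval.  If P and Q have the logarithmic derivatives
    X and Y, then P^-1 Q has the logarithmic derivative Ad(P^-1)(Y - X)
    ([Rd_quotient]).  Hence product integrals are unique ([good_unique]), and along
    tame sequences they are as close to each other as their integrands
    ([tame_estimate]).

    Sufficiency.  Let a tame Cauchy or Mackey-Cauchy sequence converge to psi.  At
    each time its product integrals form a sequence of the same kind in G, which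
    converges by completeness.  A second mean value argument, for the curves read
    in [Xi], shows that the limit curve has the logarithmic derivative psi
    ([limit_Rd_right]), and it extends to a C^1 curve beyond the interval
    ([Dset_of_Rd]).  This gives [semiregular_mackey] and [semiregular_sequential].

    Necessity.  A continuous logarithmic derivative psi is the limit of the constant
    sequence psi, which is tame because the adjoint action is bounded along the
    product integral by compactness ([semiregular_confined]).  For Mackey completeness, a
    Mackey-Cauchy sequence has a subsequence g(s(j)) whose quotients
    g(s(j+1))^-1 g(s(j)) = exp(X_j) tend to the unit faster than any power of 2^-j.
    On the interval from 1 - 2^-j to 1 - 2^-(j+1) let a curve run from the unit to
    exp(X_j) as exp(rho X_j), where rho rises smoothly from 0 to 1.  Its logarithmic
    derivative is a bump, and the decrease of the X_j outweighs the shortness of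
    the intervals, so that the sum of the bumps is smooth on the line, also at 1
    ([bumps_near1]).  By semiregularity the sum is the logarithmic derivative of a
    C^1 curve on [0,1].  By uniqueness this curve passes through the points
    g(s(j))^-1, up to a common right factor, and so they converge to its value at
    time 1 ([fast_products_converge], [semiregular_mackey_complete]).

    The calculus rests on a recursive description of the classes C^k, in which the
    differential of a C^(k+1) map is C^k as a map of the point and the direction
    ([Sm], [Ck_Sm], [Sm_Ck]). *)

(** * Continuous seminorms *)

Section Seminorms.
Context {R : realType} {E : tvsType R}.
Implicit Types (p q : cseminorm E) (x y : E).

Lemma sn0 p : p 0 = 0.
Proof. by rewrite -(scale0r (0 : E)) seminormZ normr0 mul0r. Qed.

Lemma snN p x : p (- x) = p x.
Proof. by rewrite -scaleN1r seminormZ normrN1 mul1r. Qed.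

Lemma sn_ge0 p x : 0 <= p x.
Proof.
have := seminormD p x (- x); rewrite subrr sn0 snN; lra.
Qed.

Lemma snB p x y : p (x - y) = p (y - x).
Proof. by rewrite -snN opprB. Qed.

Lemma sn_trg p x y z : p (x - z) <= p (x - y) + p (y - z).
Proof. by rewrite (le_trans _ (seminormD _ _ _))// addrA subrK. Qed.

Lemma sn_le p x y : p x <= p y + p (x - y).
Proof. by rewrite -[X in p X <= _](subrKC y) seminormD. Qed.

Lemma convexP (A : set E) : convex_set A <->
  forall x y (t : R), A x -> A y -> 0 <= t -> t <= 1 ->
    A (t *: x + (1 - t) *: y).
Proof.
split=> [cA x y t Ax Ay t0 t1|cA x y t /set_mem Ax /set_mem Ay].
  have := cA x y (Itv01 t0 t1) (mem_set Ax) (mem_set Ay).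
  by move/set_mem.
by apply/mem_set; apply: cA.
Qed.

(** Limit rules in a topological vector space, from the joint continuity of its
    operations. *)
Section Limits.
Context {T : Type} {F : set_system T} {FF : Filter F}.
Implicit Types f g : T -> E.

Lemma tcvgD f g x y : f @ F --> x -> g @ F --> y ->
  f t + g t @[t --> F] --> x + y.
Proof.
move=> fx gy; apply: (cvg_comp (fun t => (f t, g t)) (fun z => z.1 + z.2)).
  exact: cvg_pair fx gy.
exact: (@add_continuous E (x, y)).
Qed.

Lemma tcvgZ (a : T -> R) (b : R) f x : a @ F --> b -> f @ F --> x ->
  a t *: f t @[t --> F] --> b *: x.
Proof.
move=> ab fx.
apply: (cvg_comp (fun t => (a t : R^o, f t)) (fun z => z.1 *: z.2)).
  exact: cvg_pair ab fx.
exact: (@scale_continuous R E (b, x)).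
Qed.

Lemma tcvgN f x : f @ F --> x -> - f t @[t --> F] --> - x.
Proof. by move=> fx; apply: (cvg_comp f -%R) fx (@opp_continuous _ x). Qed.

Lemma tcvgB f g x y : f @ F --> x -> g @ F --> y ->
  f t - g t @[t --> F] --> x - y.
Proof. by move=> fx gy; apply: tcvgD => //; apply: tcvgN. Qed.

End Limits.

Definition snadd_fun p q x := p x + q x.

Lemma snadd_subproof1 p q x y :
  snadd_fun p q (x + y) <= snadd_fun p q x + snadd_fun p q y.
Proof.
rewrite /snadd_fun; have := seminormD p x y; have := seminormD q x y; lra.
Qed.

Lemma snadd_subproof2 p q (a : R) x :
  snadd_fun p q (a *: x) = `|a| * snadd_fun p q x.
Proof. by rewrite /snadd_fun !seminormZ mulrDr. Qed.

Lemma snadd_subproof3 p q : continuous (snadd_fun p q).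
Proof.
move=> x; apply: (@cvgD R R^o); exact: seminorm_continuous.
Qed.

Definition snadd p q : cseminorm E := CSeminorm (@snadd_subproof1 p q)
  (@snadd_subproof2 p q) (@snadd_subproof3 p q).

Lemma snaddE p q x : snadd p q x = p x + q x. Proof. by []. Qed.

Lemma snzero_subproof (x y : E) : (0 : R) <= 0 + 0. Proof. by rewrite addr0. Qed.
Lemma snzero_subproof2 (a : R) (x : E) : 0 = `|a| * 0 :> R.
Proof. by rewrite mulr0. Qed.

Definition snzero : cseminorm E := @CSeminorm R E (fun=> 0)
  snzero_subproof snzero_subproof2 (fun=> cvg_cst _).

Lemma snscale_subproof1 (c : R) p (c0 : 0 <= c) x y :
  c * p (x + y) <= c * p x + c * p y.
Proof. by rewrite -mulrDr ler_wpM2l// seminormD. Qed.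

Lemma snscale_subproof2 c p (a : R) x : c * p (a *: x) = `|a| * (c * p x).
Proof. by rewrite seminormZ mulrCA. Qed.

Lemma snscale_subproof3 c p : continuous (fun x => c * p x).
Proof. by move=> x; apply: cvgMr; apply: seminorm_continuous. Qed.

Definition snscale c p (c0 : 0 <= c) : cseminorm E :=
  CSeminorm (@snscale_subproof1 c p c0) (@snscale_subproof2 c p)
    (@snscale_subproof3 c p).

Lemma nbhs_sn p x e : 0 < e -> \forall y \near x, p (y - x) < e.
Proof.
move=> e0.
have : p (y - x) @[y --> x] --> p (x - x).
  apply: (cvg_comp (fun y => y - x) p); last exact: seminorm_continuous.
  by apply: tcvgB; [exact: cvg_id|exact: cvg_cst].
by rewrite subrr sn0 => /cvgr_lt; apply.
Qed.

(** The Minkowski functional of a symmetric convex neighbourhood of the origin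
    is a continuous seminorm, so that seminorms generate the topology. *)
Lemma gauge (U : set E) : nbhs 0 U ->
  exists p : cseminorm E, forall x, p x < 1 -> U x.
Proof.
move=> U0; have [B Bconv [Bopen Bbasis]] := @locally_convex R E.
have [C [BC C0] CU] := Bbasis 0 U U0.
have /convexP cC := Bconv C (mem_set BC).
have nC : nbhs 0 C by apply: open_nbhs_nbhs; split=> //; exact: Bopen.
(* D is a symmetric convex neighbourhood of 0 contained in U, and the seminorm is
   its Minkowski functional g, the infimum of the factors t with x in t D. *)
pose D := C `&` [set x | C (- x)].
have nD : nbhs 0 D.
  apply: filterI => //.
  have := @opp_continuous E 0; rewrite /continuous_at oppr0; exact.
have D0 : D 0 by exact: nbhs_singleton.
have DN x : D x -> D (- x) by move=> [? ?]; split=> //=; rewrite opprK.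
have cD x y (t : R) : D x -> D y -> 0 <= t -> t <= 1 ->
    D (t *: x + (1 - t) *: y).
  move=> [Cx Nx] [Cy Ny] t0 t1; split; first exact: cC.
  by rewrite /= opprD -!scalerN; apply: cC.
pose S x := [set t : R | 0 < t /\ D (t^-1 *: x)].
have Sub x : has_lbound (S x) by exists 0 => t [/ltW].
have Sne x : S x !=set0.
  have : (a : R) *: x @[a --> (0:R)] --> (0 : R) *: x.
    by apply: tcvgZ; [exact: cvg_id|exact: cvg_cst].
  rewrite scale0r => /(_ D nD) /nbhs_ballP [e /= e0 eD].
  exists (2 / e); split; first by rewrite divr_gt0.
  rewrite invf_div; apply: eD.
  rewrite -ball_normE /ball_ /= sub0r normrN gtr0_norm ?divr_gt0//.
  by rewrite ltr_pdivrMr// ltr_pMr// ltr1n.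
have Sup x t t' : S x t -> t <= t' -> S x t'.
  move=> [t0 Dt] tt'; have t'0 := lt_le_trans t0 tt'; split=> //.
  have -> : t'^-1 *: x = (t / t') *: (t^-1 *: x) + (1 - t / t') *: 0.
    by rewrite scaler0 addr0 scalerA mulrAC divff ?gt_eqF// mul1r.
  by apply: cD => //; [rewrite divr_ge0 ?ltW|rewrite ler_pdivrMr// mul1r].
pose g x := inf (S x).
have g0 x : 0 <= g x by apply: lb_le_inf => // t [/ltW].
have gS x t : g x < t -> S x t.
  by move=> /(inf_lt (Sne x)) [s Ss /ltW]; exact: Sup.
have Sg x t : S x t -> g x <= t by move=> St; apply: ge_inf.
have gD x y : g (x + y) <= g x + g y.
  apply/ler_addgt0Pr => e e0.
  have [s0 Ds] := gS x (g x + e / 2) ltac:(rewrite ltrDl divr_gt0//).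
  have [t0 Dt] := gS y (g y + e / 2) ltac:(rewrite ltrDl divr_gt0//).
  have -> : g x + g y + e = (g x + e / 2) + (g y + e / 2) by lra.
  move: (g x + e / 2) (g y + e / 2) s0 Ds t0 Dt => s t s0 Ds t0 Dt.
  have st0 : 0 < s + t by lra.
  apply: Sg; split=> //.
  have -> : (s + t)^-1 *: (x + y) =
      (s / (s + t)) *: (s^-1 *: x) + (1 - s / (s + t)) *: (t^-1 *: y).
    have -> : 1 - s / (s + t) = t / (s + t) by field; rewrite gt_eqF.
    rewrite !scalerA scalerDr; congr (_ *: _ + _ *: _); field;
    by rewrite !gt_eqF.
  apply: cD => //; first by rewrite divr_ge0 ?ltW.
  by rewrite ler_pdivrMr// mul1r lerDl ltW.
have gpZ (a : R) x : 0 < a -> g (a *: x) <= a * g x.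
  move=> a0; apply/ler_addgt0Pr => e e0.
  have [s0 Ds] := gS x (g x + e / a) ltac:(rewrite ltrDl divr_gt0//).
  have -> : a * g x + e = a * (g x + e / a) by field; rewrite gt_eqF.
  move: (g x + e / a) s0 Ds => s s0 Ds; apply: Sg; split; first exact: mulr_gt0.
  rewrite scalerA; have -> : (a * s)^-1 * a = s^-1; last by [].
  by field; rewrite !gt_eqF.
have gN x : g (- x) = g x.
  congr inf; apply/seteqP; split=> t [t0 Dt]; split=> //.
    by rewrite -[_ *: x]opprK -scalerN; exact: DN.
  by rewrite scalerN; exact: DN.
have g00 : g 0 = 0.
  apply/eqP; rewrite eq_le g0 andbT; apply/ler_addgt0Pr => e e0.
  by rewrite add0r; apply: Sg; split=> //; rewrite scaler0.
have gZ (a : R) x : g (a *: x) = `|a| * g x.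
  wlog a0 : a / 0 < a => [hw|].
    have [a0|a0|<-] := ltgtP 0 a; first exact: hw.
      rewrite -[a *: x]opprK -scaleNr gN hw ?oppr_gt0//.
      by rewrite normrN.
    by rewrite scale0r g00 normr0 mul0r.
  rewrite gtr0_norm//; apply/eqP; rewrite eq_le gpZ//=.
  have a'0 : 0 < a^-1 by rewrite invr_gt0.
  have := gpZ a^-1 (a *: x) a'0; rewrite scalerA mulVf ?gt_eqF// scale1r.
  by rewrite ler_pdivlMl.
have gc : continuous g.
  move=> x; apply/cvgrPdist_le => e e0.
  have nx : \forall y \near x, D (e^-1 *: (y - x)).
    have : (e^-1 : R) *: (y - x) @[y --> x] --> e^-1 *: (x - x).
      apply: tcvgZ; first exact: cvg_cst.
      by apply: tcvgB; [exact: cvg_id|exact: cvg_cst].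
    by rewrite subrr scaler0; apply.
  near=> y.
  have gyx : g (y - x) <= e by apply: Sg; split=> //; near: y.
  have gxy : g (x - y) <= e by rewrite -opprB gN.
  rewrite ler_norml; apply/andP; split.
    have := gD (y - x) x; rewrite subrK; lra.
  have := gD (x - y) y; rewrite subrK; lra.
exists (CSeminorm gD gZ gc) => x /= /gS[_].
by rewrite invr1 scale1r => -[/CU].
Unshelve. all: by end_near. Qed.

Lemma nbhs_gauge x (U : set E) : nbhs x U ->
  exists p : cseminorm E, forall y, p (y - x) < 1 -> U y.
Proof.
move=> Ux; have : y + x @[y --> (0 : E)] --> 0 + x.
  by apply: tcvgD; [exact: cvg_id|exact: cvg_cst].
rewrite add0r => /(_ U Ux) /gauge[p pU]; exists p => y /pU.
by rewrite /= subrK.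
Qed.

Lemma cvg_snP {T : Type} {F : set_system T} {FF : Filter F} (f : T -> E) x :
  f @ F --> x <->
  forall p e, 0 < e -> \forall t \near F, p (f t - x) < e.
Proof.
split=> [fx p e e0|fx U /nbhs_gauge[p pU]]; first exact: (fx _ (nbhs_sn p x e0)).
by apply: filterS (fx p 1 ltr01) => t /pU.
Qed.

Lemma sn_eq0 (hE : hausdorff_space E) x : (forall p, p x = 0) -> x = 0.
Proof.
move=> px; apply: hE => A B Ax /nbhs_gauge[p pB]; exists x; split.
  exact: nbhs_singleton.
by apply: pB; rewrite subr0 px.
Qed.

Lemma cvg_sn_le {T : Type} {F : set_system T} {FF : ProperFilter F}
  (f : T -> E) x p (c : R) : f @ F --> x ->
  (\forall t \near F, p (f t) <= c) -> p x <= c.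
Proof.
move=> fx fc; apply/ler_addgt0Pr => e e0.
have /cvg_snP/(_ p e e0) fe := fx.
have [t []] := @filter_ex _ F _ _ (filterI fc fe) => ptc pte.
have := sn_le p x (f t); rewrite snB; lra.
Qed.

End Seminorms.

(** * One-sided difference quotients and the mean value inequality *)

Section Creeping.
Context {R : realType}.
Implicit Types (a b s t u h e : R).

Lemma at_right_dnbhs t : t^'+ `=>` t^'.
Proof.
by move=> A; rewrite /at_right /dnbhs /within /=; apply: filterS => x + tx;
apply; rewrite gt_eqF.
Qed.

Lemma at_left_dnbhs t : t^'- `=>` t^'.
Proof.
by move=> A; rewrite /at_left /dnbhs /within /=; apply: filterS => x + tx;
apply; rewrite lt_eqF.
Qed.

Lemma near_dnbhs0_neq : \forall h \near (0:R)^', h != 0.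
Proof. by apply/nbhs_ballP; exists 1 => /=. Qed.

Lemma cvg_shift (F : set_system R) {FF : Filter F} t :
  F `=>` (0:R)^' -> t + h @[h --> F] --> t.
Proof.
move=> F0; rewrite -[X in _ --> X]addr0; apply: cvgD; first exact: cvg_cst.
by move=> U U0; apply: F0; exact: nbhs_dnbhs.
Qed.

Lemma near_rightE (P : set R) :
  (\forall h \near (0:R)^'+, P h) <->
  exists2 d, 0 < d & forall h, 0 < h -> h < d -> P h.
Proof.
split=> [/nbhs_ballP[d /= d0 dP]|[d d0 dP]].
  exists d => // h h0 hd; apply: dP => //.
  by rewrite -ball_normE /ball_/= sub0r normrN gtr0_norm.
near=> h; apply: dP; near: h; [exact: nbhs_right_gt|exact: nbhs_right_lt].
Unshelve. all: by end_near. Qed.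

Lemma near_leftE (P : set R) :
  (\forall h \near (0:R)^'-, P h) <->
  exists2 d, 0 < d & forall h, h < 0 -> - d < h -> P h.
Proof.
split=> [/nbhs_ballP[d /= d0 dP]|[d d0 dP]].
  exists d => // h h0 hd; apply: dP => //.
  by rewrite -ball_normE /ball_/= sub0r normrN ltr0_norm// ltrNl.
near=> h; apply: dP; near: h; first exact: nbhs_left_lt.
by apply: nbhs_left_gt; rewrite oppr_lt0.
Unshelve. all: by end_near. Qed.

Lemma near_dnbhs0E (P : set R) :
  (\forall h \near (0:R)^'+, P h) -> (\forall h \near (0:R)^'-, P h) ->
  \forall h \near (0:R)^', P h.
Proof.
move=> /near_rightE[d d0 dP] /near_leftE[e e0 eP].
have de0 : 0 < Num.min d e by rewrite lt_min d0.
apply/nbhs_ballP; exists (Num.min d e) => //= h.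
rewrite -ball_normE /ball_/= sub0r normrN ltr_norml lt_min.
move=> /andP[h1 /andP[h2 h3]] h0.
have [hn|hp|h00] := ltgtP h 0; [|exact: dP|by rewrite h00 eqxx in h0].
by apply: eP => //; apply: le_lt_trans h1; rewrite lerN2 ge_min lexx orbT.
Qed.

(** An interval-additive relation that holds locally on both sides of every
    point holds between the end points: the supremum of the points reached from
    the left end is reached, and can be passed unless it is the right end. *)
Lemma creeping (P : R -> R -> Prop) a b : a <= b -> P a a ->
  (forall s t u, s <= t -> t <= u -> a <= s -> u <= b ->
    P s t -> P t u -> P s u) ->
  (forall t, a <= t -> t < b -> \forall h \near (0:R)^'+, P t (t + h)) ->
  (forall t, a < t -> t <= b -> \forall h \near (0:R)^'-, P (t + h) t) ->
  P a b.
Proof.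
move=> ab Paa Ptr Pr Pl.
pose S := [set t | [/\ a <= t, t <= b & P a t]].
have Sa : S a by split.
have Sub : has_ubound S by exists b => t [].
have Sne : S !=set0 by exists a.
have as_ : a <= sup S by exact: ub_le_sup.
have sb : sup S <= b by apply: ge_sup => // t [].
have Ps : P a (sup S).
  have [<-//|aNs] := eqVneq a (sup S).
  have as' : a < sup S by rewrite lt_neqAle aNs.
  have /near_leftE[d d0 dP] := Pl _ as' sb.
  have [t [at_ tb Pt] ts] := sup_adherent d0 (conj Sne Sub).
  have ts' : t <= sup S by exact: ub_le_sup.
  have [<-//|tNs] := eqVneq t (sup S).
  apply: (Ptr a t) => //.
  rewrite -[t](subrKC (sup S)); apply: dP.
    by rewrite subr_lt0 lt_neqAle tNs.
  by rewrite ltrBrDl.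
have [<-//|sNb] := eqVneq (sup S) b.
have sltb : sup S < b by rewrite lt_neqAle sNb.
have /near_rightE[d d0 dP] := Pr _ as_ sltb.
pose h := Num.min (d / 2) (b - sup S).
have h0 : 0 < h by rewrite lt_min divr_gt0//= subr_gt0.
have hd : h < d by rewrite gt_min ltr_pdivrMr// ltr_pMr// ltr1n.
have hb : sup S + h <= b by rewrite -lerBrDl ge_min lexx orbT.
suff : sup S + h <= sup S by rewrite gerDl leNgt h0.
apply: ub_le_sup => //; split=> //; first by rewrite (le_trans as_)// lerDl ltW.
by apply: (Ptr a (sup S)) => //; [rewrite lerDl ltW|exact: dP].
Qed.

End Creeping.

Section MeanValue.
Context {R : realType} {E : tvsType R}.
Implicit Types (p : cseminorm E) (c : R -> E).

Lemma quot_le (F : set_system R) {FF : Filter F} p (c : R -> E) X (M e : R) :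
  F `=>` (0:R)^' -> h^-1 *: c h @[h --> F] --> X -> p X <= M -> 0 < e ->
  \forall h \near F, p (c h) <= (M + e) * `|h|.
Proof.
move=> F0 cX pX e0; have h0 : \forall h \near F, h != 0.
  by apply: F0; exact: near_dnbhs0_neq.
have /cvg_snP/(_ p e e0) := cX; apply: filterS2 h0 => h h0 phe.
have -> : c h = h *: (h^-1 *: c h) by rewrite scalerA divff// scale1r.
rewrite seminormZ mulrC ler_wpM2r//.
have := sn_le p (h^-1 *: c h) X; lra.
Qed.

(** The inequality with M + e is additive in the interval and holds locally, hence
    globally by [creeping], and e is arbitrary.  One-sided quotients are used since
    product integrals of piecewise continuous curves have no two-sided ones at
    the break points. *)
Lemma mean_value_local p c (a b M : R) : a <= b ->
  (forall t, a <= t -> t < b -> forall e, 0 < e ->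
     \forall h \near (0:R)^'+, p (c (t + h) - c t) <= (M + e) * `|h|) ->
  (forall t, a < t -> t <= b -> forall e, 0 < e ->
     \forall h \near (0:R)^'-, p (c (t + h) - c t) <= (M + e) * `|h|) ->
  p (c b - c a) <= M * (b - a).
Proof.
move=> ab cr cl.
suff H e : 0 < e -> p (c b - c a) <= (M + e) * (b - a).
  have [->|ab'] := eqVneq a b; first by rewrite !subrr sn0 mulr0.
  have ba0 : 0 < b - a by rewrite subr_gt0 lt_neqAle ab'.
  apply/ler_addgt0Pr => e e0.
  have := H (e / (b - a)) ltac:(by rewrite divr_gt0).
  by rewrite mulrDl divfK// gt_eqF.
move=> e0; apply: (@creeping _ (fun s t => p (c t - c s) <= (M + e) * (t - s))).
- exact: ab.
- by rewrite !subrr sn0 mulr0.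
- move=> s t u _ _ _ _ st tu; have := sn_trg p (c u) (c t) (c s); lra.
- move=> t at_ tb; have := cr t at_ tb e e0; apply: filterS2 (nbhs_right_gt 0).
  by move=> h h0; rewrite gtr0_norm// [t + h]addrC addrK.
- move=> t at_ tb; have := cl t at_ tb e e0; apply: filterS2 (nbhs_left_lt 0).
  by move=> h h0; rewrite ltr0_norm// opprD addNKr snB.
Qed.

Lemma mean_value p c (a b M : R) : a <= b ->
  (forall t, a <= t -> t < b -> exists2 X,
     h^-1 *: (c (t + h) - c t) @[h --> (0:R)^'+] --> X & p X <= M) ->
  (forall t, a < t -> t <= b -> exists2 X,
     h^-1 *: (c (t + h) - c t) @[h --> (0:R)^'-] --> X & p X <= M) ->
  p (c b - c a) <= M * (b - a).
Proof.
move=> ab cr cl; apply: mean_value_local => // t ta tb e e0.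
  have [X cX pX] := cr t ta tb; apply: quot_le cX pX e0.
  exact: at_right_dnbhs.
have [X cX pX] := cl t ta tb; apply: quot_le cX pX e0.
exact: at_left_dnbhs.
Qed.

End MeanValue.

(** * Directional derivatives *)

Section Derivatives.
Context {R : realType} {F E : tvsType R}.
Implicit Types (f g : F -> E) (U : set F) (x v w : F).

Lemma open_near U x : open U -> U x -> \forall y \near x, U y.
Proof. by move=> oU Ux; exact: open_nbhs_nbhs. Qed.

Lemma cvg_line x v : x + h *: v @[h --> (0:R)^'] --> x.
Proof.
rewrite -[X in _ --> X]addr0 -[X in _ --> _ + X](scale0r v).
apply: tcvgD; first exact: cvg_cst.
by apply: tcvgZ; [exact: nbhs_dnbhs|exact: cvg_cst].
Qed.

Lemma has_dderiv_congr f g x v d : (\forall y \near x, f y = g y) ->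
  has_dderiv f x v d -> has_dderiv g x v d.
Proof.
move=> fg fd; apply: cvg_trans fd; apply: near_eq_cvg.
have fgx : f x = g x by exact: nbhs_singleton fg.
have /= := @cvg_line x v _ fg; rewrite /nbhs /=.
by apply: filterS => h /= ->; rewrite fgx.
Qed.

Lemma dderiv_congr f g x v : (\forall y \near x, f y = g y) ->
  dderiv f x v = dderiv g x v.
Proof.
move=> fg; rewrite /dderiv; congr (xget 0 _).
apply/funext => d; apply/propext; split.
  exact: has_dderiv_congr.
have gf : \forall y \near x, g y = f y by apply: filterS fg.
exact: has_dderiv_congr gf.
Qed.

Lemma has_dderivZ f x v d (a : R) :
  has_dderiv f x v d -> has_dderiv f x (a *: v) (a *: d).
Proof.
move=> fd; have [->|a0] := eqVneq a 0.
  rewrite !scale0r; apply: cvg_near_cst; apply: nearW => h.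
  by rewrite scaler0 addr0 subrr scaler0.
have ha : a * h @[h --> (0:R)^'] `=>` (0:R)^'.
  move=> A /nbhs_ballP[e /= e0 eA]; apply/nbhs_ballP.
  exists (e / `|a|) => /=; first by rewrite divr_gt0 ?normr_gt0.
  move=> h; rewrite -!ball_normE /ball_/= !sub0r !normrN => he h0.
  apply: eA; last by rewrite mulf_neq0.
  by rewrite -ball_normE /ball_/= sub0r normrN normrM mulrC -ltr_pdivlMr ?normr_gt0.
rewrite /has_dderiv.
have -> : (fun h : R => h^-1 *: (f (x + h *: (a *: v)) - f x)) =
    (fun h => a *: ((a * h)^-1 *: (f (x + (a * h) *: v) - f x))).
  apply/funext => h; rewrite !scalerA [h * a]mulrC; congr (_ *: _).
  by rewrite invfM mulrA divff// mul1r.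
apply: tcvgZ; first exact: cvg_cst.
exact: (cvg_comp (fun h => a * h)
  (fun k => k^-1 *: (f (x + k *: v) - f x)) ha fd).
Qed.

Lemma has_dderivD f g x v d d' : has_dderiv f x v d -> has_dderiv g x v d' ->
  has_dderiv (fun y => f y + g y) x v (d + d').
Proof.
move=> fd gd; rewrite /has_dderiv.
under eq_fun do rewrite opprD addrACA scalerDr.
exact: tcvgD.
Qed.

Lemma has_dderivZl f (a : R) x v d : has_dderiv f x v d ->
  has_dderiv (fun y => a *: f y) x v (a *: d).
Proof.
move=> fd; rewrite /has_dderiv.
under eq_fun do rewrite -scalerBr scalerA mulrC -scalerA.
by apply: tcvgZ => //; exact: cvg_cst.
Qed.

Lemma has_dderiv_cst (y : E) x v : has_dderiv (fun=> y) x v 0.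
Proof.
by apply: cvg_near_cst; apply: nearW => h; rewrite subrr scaler0.
Qed.

Lemma has_dderiv_sum (n : nat) (f : 'I_n -> F -> E) x v (d : 'I_n -> E) :
  (forall i, has_dderiv (f i) x v (d i)) ->
  has_dderiv (fun y => \sum_i f i y) x v (\sum_i d i).
Proof.
elim: n f d => [|n IH] f d fd.
  rewrite big_ord0 (_ : (fun y => _) = (fun=> 0)); first exact: has_dderiv_cst.
  by apply/funext => y; rewrite big_ord0.
rewrite big_ord_recl (_ : (fun y => _) =
  (fun y => f ord0 y + \sum_(i < n) f (lift ord0 i) y)); last first.
  by apply/funext => y; rewrite big_ord_recl.
by apply: has_dderivD => //; apply: IH.
Qed.

Lemma has_dderiv_unique (hE : hausdorff_space E) f x v d d' :
  has_dderiv f x v d -> has_dderiv f x v d' -> d = d'.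
Proof. by move=> fd fd'; apply: (cvg_unique hE fd fd'). Qed.

Lemma dderivE (hE : hausdorff_space E) f x v d :
  has_dderiv f x v d -> dderiv f x v = d.
Proof.
move=> fd; rewrite /dderiv; case: xgetP => [d' _ fd'|/(_ d)//].
exact: has_dderiv_unique fd' fd.
Qed.

(** Difference quotients with moving base point and moving direction still
    converge to the directional derivative, when the latter is jointly
    continuous: by the mean value inequality they are close to values of the
    derivative near the limit point. *)
Lemma hadamard (U : set F) f (f' : F * F -> E) x0 v0
    (T : Type) (G : set_system T) (GG : Filter G)
    (x v : T -> F) (h : T -> R) :
  open U -> U x0 -> (forall x v, U x -> has_dderiv f x v (f' (x, v))) ->
  {for (x0, v0), continuous f'} ->
  x @ G --> x0 -> v @ G --> v0 -> h @ G --> (0 : R) ->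
  (\forall t \near G, h t != 0) ->
  (h t)^-1 *: (f (x t + h t *: v t) - f (x t)) @[t --> G] --> f' (x0, v0).
Proof.
move=> oU Ux0 ff' cf' xx0 vv0 h0 hN0.
apply/cvg_snP => p e e0; have e2 : 0 < e / 2 by rewrite divr_gt0.
have [[A B] [/= nA nB] AB] := cf' _ (nbhs_sn p (f' (x0, v0)) e2).
have [q qAU] := nbhs_gauge (filterI nA (open_near oU Ux0)).
have xhv : x t + h t *: v t @[t --> G] --> x0.
  rewrite -[X in _ --> X]addr0 -[X in _ --> _ + X](scale0r v0).
  by apply: tcvgD => //; apply: tcvgZ.
have q1 : \forall t \near G, q (x t - x0) < 1 := xx0 _ (nbhs_sn q x0 ltr01).
have q2 : \forall t \near G, q (x t + h t *: v t - x0) < 1 :=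
  xhv _ (nbhs_sn q x0 ltr01).
have vB : \forall t \near G, B (v t) := vv0 _ nB.
apply: filterS2 (filterI q1 q2) (filterI vB hN0) => t [qx qxh] [Bv ht0].
set y := x t; set k := h t; set w := v t.
(* The segment from x t to x t + h t *: v t stays where the derivative is close to
   its value at (x0, v0), the seminorm balls being convex. *)
have seg s : 0 <= s -> s <= 1 -> (A `&` U) (y + (s * k) *: w).
  move=> s0 s1; apply: qAU.
  have -> : y + (s * k) *: w - x0 =
      (1 - s) *: (y - x0) + s *: (y + k *: w - x0).
    rewrite addrAC [y + k *: w - x0]addrAC.
    by move: (y - x0) => a; rewrite scalerBl scale1r scalerDr scalerA addrA subrK.
  apply: le_lt_trans (seminormD _ _ _) _; rewrite !seminormZ.
  rewrite ger0_norm ?subr_ge0// ger0_norm//.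
  move: qx qxh; rewrite -/y -/k -/w => qx qxh.
  apply: (@le_lt_trans _ _ (Num.max (q (y - x0)) (q (y + k *: w - x0)))).
    set m := Num.max _ _; have -> : m = (1 - s) * m + s * m by ring.
    by apply: lerD; rewrite ler_wpM2l ?subr_ge0// le_max lexx ?orbT.
  by rewrite gt_max qx qxh.
(* The mean value inequality, for f along the segment minus the expected linear
   part. *)
pose c s := f (y + (s * k) *: w) - (s * k) *: f' (x0, v0).
have cd s : 0 <= s -> s <= 1 -> exists2 X,
    h^-1 *: (c (s + h) - c s) @[h --> (0:R)^'] --> X & p X <= `|k| * (e / 2).
  move=> s0 s1; have [As Us] := seg s s0 s1.
  have fd := has_dderivZ (a := k) (ff' (y + (s * k) *: w) w Us).
  exists (k *: (f' (y + (s * k) *: w, w) - f' (x0, v0))).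
    have -> : (fun r : R => r^-1 *: (c (s + r) - c s)) = (fun r : R =>
       r^-1 *: (f (y + (s * k) *: w + r *: (k *: w)) - f (y + (s * k) *: w))
       - r^-1 *: (r *: (k *: f' (x0, v0)))).
      apply/funext => r; rewrite -scalerBr; congr (_ *: _).
      have H (a b d z : E) : a - (d + z) - (b - d) = a - b - z.
        by rewrite opprD opprB !addrA (addrAC a) subrK addrAC.
      by rewrite /c mulrDl !scalerDl !scalerA addrA H.
    rewrite scalerBr; apply: tcvgB => //.
    apply: cvg_near_cst; apply: filterS near_dnbhs0_neq => r r0.
    by rewrite scalerK.
  rewrite seminormZ ler_wpM2l//; apply/ltW.
  exact: (AB (y + (s * k) *: w, w)).
have := @mean_value _ _ p c 0 1 (`|k| * (e / 2)) ler01.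
rewrite /c !mul1r !mul0r !scale0r !addr0 !subr0 => /(_ _ _)/[!mulr1] mv.
have -> : k^-1 *: (f (y + k *: w) - f y) - f' (x0, v0) =
    k^-1 *: (f (y + k *: w) - k *: f' (x0, v0) - f y).
  by rewrite !scalerDr !scalerN scalerA mulVf// scale1r addrAC.
rewrite seminormZ normrV ?unitfE// ltr_pdivrMl ?normr_gt0//.
apply: le_lt_trans (mv _ _) _.
- move=> s s0 s1; have [X cX pX] := cd s s0 (ltW s1).
  by exists X => //; apply: cvg_trans cX; apply: cvg_app; exact: at_right_dnbhs.
- move=> s s0 s1; have [X cX pX] := cd s (ltW s0) s1.
  by exists X => //; apply: cvg_trans cX; apply: cvg_app; exact: at_left_dnbhs.
by rewrite ltr_pM2l ?normr_gt0// ltr_pdivrMr// ltr_pMr// ltr1n.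
Qed.

End Derivatives.

(** * The classes C^k in recursive form *)

Lemma cont_pair (S T T' : topologicalType) (f : S -> T) (g : S -> T') x :
  {for x, continuous f} -> {for x, continuous g} ->
  {for x, continuous (fun y => (f y, g y))}.
Proof. by move=> fc gc; apply: cvg_pair. Qed.

Lemma cont_ext (S T : topologicalType) (f g : S -> T) x :
  f =1 g -> {for x, continuous f} -> {for x, continuous g}.
Proof. by move=> /funext ->. Qed.

Section SmoothClass.
Context {R : realType}.

(** The classes C^k in recursive form: a C^(k+1) map is one whose differential,
    as a map of both the point and the direction, is C^k.  Differentials being
    maps of the same kind, the chain rule becomes an induction on k. *)
Fixpoint Sm (k : nat) (F E : tvsType R) (U : set F) (f : F -> E) : Prop :=
  (forall x, U x -> {for x, continuous f}) /\
  if k is k'.+1 then exists f' : F * F -> E,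
    (forall x v, U x -> has_dderiv f x v (f' (x, v))) /\
    Sm k' (U `*` setT) f'
  else True.

Lemma Sm_cont k (F E : tvsType R) (U : set F) (f : F -> E) x :
  Sm k U f -> U x -> {for x, continuous f}.
Proof. by case: k => [|k] [fc _] Ux; exact: fc. Qed.

Lemma Sm0 (F E : tvsType R) (U : set F) (f : F -> E) :
  (forall x, U x -> {for x, continuous f}) -> Sm 0 U f.
Proof. by []. Qed.

Lemma SmW k (F E : tvsType R) (U : set F) (f : F -> E) : Sm k.+1 U f -> Sm k U f.
Proof.
elim: k F E U f => [|k IH] F E U f [fc [f' [ff' Sf']]]; first exact: Sm0.
by split=> //; exists f'; split=> //; exact: IH.
Qed.

Lemma Sm_le k l (F E : tvsType R) (U : set F) (f : F -> E) :
  (k <= l)%N -> Sm l U f -> Sm k U f.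
Proof.
elim: l => [|l IH]; first by rewrite leqn0 => /eqP ->.
by rewrite leq_eqVlt => /predU1P[->//|/IH H] /SmW.
Qed.

Lemma Sm_sub k (F E : tvsType R) (U V : set F) (f : F -> E) :
  V `<=` U -> Sm k U f -> Sm k V f.
Proof.
elim: k F E U V f => [|k IH] F E U V f VU [fc]; first by split=> // x /VU/fc.
move=> [f' [ff' Sf']]; split; first by move=> x /VU/fc.
exists f'; split; first by move=> x v /VU; exact: ff'.
by apply: IH Sf' => -[x v] [/= /VU].
Qed.

Lemma cont_congr (S T : topologicalType) (f g : S -> T) x :
  (\forall y \near x, f y = g y) -> {for x, continuous f} ->
  {for x, continuous g}.
Proof.
move=> fg fc; have e : f x = g x := nbhs_singleton fg.
suff : g @ x --> g x by [].
by rewrite -e; apply: cvg_trans fc; apply: near_eq_cvg.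
Qed.

Lemma Sm_congr k (F E : tvsType R) (U : set F) (f g : F -> E) :
  open U -> (forall x, U x -> f x = g x) -> Sm k U f -> Sm k U g.
Proof.
have near_fg (F' : tvsType R) (V : set F') (f' g' : F' -> E) x : open V -> V x ->
    (forall x, V x -> f' x = g' x) -> \forall y \near x, f' y = g' y.
  by move=> oV Vx fg'; apply: filterS (open_near oV Vx).
have ct l (V : set F) (f' g' : F -> E) : open V ->
    (forall x, V x -> f' x = g' x) -> Sm l V f' ->
    forall x, V x -> {for x, continuous g'}.
  move=> oV fg' Sf x Vx; apply: cont_congr (Sm_cont Sf Vx); exact: (near_fg _ V).
case: k => [|k] oU fg Sf; first by split=> //; exact: ct Sf.
split; first exact: ct Sf.
case: Sf => _ [f' [ff' Sf']]; exists f'; split=> // x v Ux.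
by apply: has_dderiv_congr (ff' x v Ux); exact: (near_fg _ U).
Qed.

Lemma open_setXT (F H : topologicalType) (U : set F) :
  open U -> open (U `*` [set: H]).
Proof. by move=> oU; apply: open_setX => //; exact: openT. Qed.

Lemma Sm_hadamard k (F E : tvsType R) (U : set F) (f : F -> E) f' x0 v0
    (T : Type) (G : set_system T) (GG : Filter G)
    (x v : T -> F) (h : T -> R) :
  (forall x v, U x -> has_dderiv f x v (f' (x, v))) -> Sm k (U `*` setT) f' ->
  open U -> U x0 -> x @ G --> x0 -> v @ G --> v0 -> h @ G --> (0 : R) ->
  (\forall t \near G, h t != 0) ->
  (h t)^-1 *: (f (x t + h t *: v t) - f (x t)) @[t --> G] --> f' (x0, v0).
Proof.
move=> ff' Sf' oU Ux0; apply: (@hadamard _ _ _ U) => //.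
by apply: (Sm_cont Sf').
Qed.

Lemma has_dderiv_comp (F E H : tvsType R) (V : set E) (f : F -> E) (g : E -> H)
   k g' x v d : open V ->
  (forall x v, V x -> has_dderiv g x v (g' (x, v))) -> Sm k (V `*` setT) g' ->
  V (f x) -> has_dderiv f x v d -> has_dderiv (g \o f) x v (g' (f x, d)).
Proof.
move=> oV gg' Sg' Vfx fd; rewrite /has_dderiv.
pose q h : E := h^-1 *: (f (x + h *: v) - f x).
have gfd : h^-1 *: (g (f x + h *: q h) - g (f x)) @[h --> (0:R)^']
    --> g' (f x, d).
  apply: (@Sm_hadamard k E H V g g' (f x) d R (0:R)^' _ (fun=> f x) q id) => //;
    first exact: cvg_cst.
    exact: nbhs_dnbhs.
  exact: near_dnbhs0_neq.
apply: cvg_trans gfd; apply: near_eq_cvg.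
apply: filterS near_dnbhs0_neq => h h0.
by rewrite /= scalerA divff// scale1r subrKC.
Qed.

Lemma Sm_pair k (F E H : tvsType R) (U : set F) (f : F -> E) (g : F -> H) :
  Sm k U f -> Sm k U g -> Sm k U (fun x => (f x, g x)).
Proof.
have ct l (F' E' H' : tvsType R) (U' : set F') (f' : F' -> E') (g' : F' -> H') :
    Sm l U' f' -> Sm l U' g' ->
    forall x, U' x -> {for x, continuous (fun x => (f' x, g' x))}.
  by move=> Sf Sg x Ux; apply: cvg_pair; [exact: (Sm_cont Sf)|exact: (Sm_cont Sg)].
elim: k F E H U f g => [|k IH] F E H U f g Sf Sg.
  by split=> //; exact: ct Sf Sg.
split; first exact: ct Sf Sg.
case: Sf Sg => _ [f' [ff' Sf']] [_ [g' [gg' Sg']]].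
exists (fun z => (f' z, g' z)); split; last exact: IH.
move=> x v Ux; apply: cvg_pair; [exact: ff'|exact: gg'].
Qed.

Lemma Sm_linear k (F E : tvsType R) (U : set F) (L : F -> E) :
  (forall (a : R) x y, L (a *: x + y) = a *: L x + L y) -> continuous L ->
  Sm k U L.
Proof.
elim: k F E U L => [|k IH] F E U L lL cL; first by split=> // x _; exact: cL.
split; first by move=> x _; exact: cL.
exists (fun z => L z.2); split.
  move=> x v Ux; apply: cvg_near_cst; apply: filterS near_dnbhs0_neq => h h0.
  by rewrite [x + _]addrC lL addrK scalerK.
apply: IH => [a [x v] [y w] //=|[x v]].
by apply: (cvg_comp snd L) (cL v); exact: cvg_snd.
Qed.

Lemma Sm_cst k (F E : tvsType R) (U : set F) (y : E) : Sm k U (fun=> y).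
Proof.
case: k => [|k]; first by split=> // x _; exact: cvg_cst.
split; first by move=> x _; exact: cvg_cst.
exists (fun=> 0); split; first by move=> x v _; exact: has_dderiv_cst.
by apply: Sm_linear => [a x z|z]; [rewrite scaler0 addr0|exact: cvg_cst].
Qed.

Lemma Sm_fst k (F E : tvsType R) (U : set (F * E)) : Sm k U fst.
Proof. by apply: Sm_linear => // -[x y]; exact: cvg_fst. Qed.

Lemma Sm_snd k (F E : tvsType R) (U : set (F * E)) : Sm k U snd.
Proof. by apply: Sm_linear => // -[x y]; exact: cvg_snd. Qed.

Lemma Sm_id k (F : tvsType R) (U : set F) : Sm k U id.
Proof. by apply: Sm_linear => // x; exact: cvg_id. Qed.

(** The chain rule; the induction uses d(g o f)(x,v) = dg(f x, df(x,v)). *)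
Lemma Sm_comp k (F E H : tvsType R) (U : set F) (V : set E) (f : F -> E)
    (g : E -> H) : open U -> open V -> (forall x, U x -> V (f x)) ->
  Sm k U f -> Sm k V g -> Sm k U (g \o f).
Proof.
have ct l (F' E' H' : tvsType R) (U' : set F') (V' : set E') (f' : F' -> E')
    (g' : E' -> H') : (forall x, U' x -> V' (f' x)) -> Sm l U' f' -> Sm l V' g' ->
    forall x, U' x -> {for x, continuous (g' \o f')}.
  move=> UV Sf Sg x Ux; apply: continuous_comp; first exact: Sm_cont Sf Ux.
  by apply: (Sm_cont Sg); exact: UV.
elim: k F E H U V f g => [|k IH] F E H U V f g oU oV UV Sf Sg.
  by split=> //; exact: ct Sf Sg.
split; first exact: ct Sf Sg.
have Sf1 := SmW Sf.
case: Sf Sg => _ [f' [ff' Sf']] [_ [g' [gg' Sg']]].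
exists (g' \o (fun z => (f z.1, f' z))); split.
  move=> x v Ux; apply: (has_dderiv_comp oV gg' Sg') => //; first exact: UV.
  exact: ff'.
apply: (IH _ _ _ _ (V `*` setT)) => //; try exact: open_setXT.
  by move=> [x v] [/= Ux _]; split=> //; exact: UV.
apply: Sm_pair => //.
apply: (IH _ _ _ _ U fst f) => //; first exact: open_setXT.
  by move=> [x v] [].
exact: Sm_fst.
Qed.

End SmoothClass.

Section SmoothTheory.
Context {R : realType}.

Lemma Sm_comp2 k (F E H K : tvsType R) (U : set F) (V : set (E * H))
    (f : F -> E) (h : F -> H) (g : E * H -> K) : open U -> open V ->
  (forall x, U x -> V (f x, h x)) -> Sm k U f -> Sm k U h -> Sm k V g ->
  Sm k U (fun x => g (f x, h x)).
Proof.
move=> oU oV UV Sf Sh Sg.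
exact: (Sm_comp (f := fun x => (f x, h x)) oU oV UV (Sm_pair Sf Sh) Sg).
Qed.

Lemma Sm_add k (F E : tvsType R) (U : set F) (f g : F -> E) : open U ->
  Sm k U f -> Sm k U g -> Sm k U (fun x => f x + g x).
Proof.
move=> oU Sf Sg.
apply: (Sm_comp2 (V := setT) (g := fun z : E * E => z.1 + z.2)) => //.
  exact: openT.
apply: Sm_linear; last exact: add_continuous.
by move=> a [x y] [z w] /=; rewrite scalerDr addrACA.
Qed.

(** The differential at (a,x) in the direction (b,y) is a *: y + b *: x, a sum of
    maps of the same kind. *)
Lemma Sm_scale_aux k (E : tvsType R) :
  Sm k setT (fun z : R^o * E => z.1 *: z.2).
Proof.
have key (a b h : R) (x v : E) : (a + h * b) *: (x + h *: v) - a *: x =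
    h *: (a *: v + b *: (x + h *: v)).
  rewrite scalerDl [a *: _ in LHS]scalerDr -!addrA addrCA.
  by rewrite (addrCA (a *: x)) subrr addr0 [RHS]scalerDr !scalerA [a * h]mulrC.
elim: k => [|k IH]; first by apply: Sm0 => x _; exact: scale_continuous.
split; first by move=> x _; exact: scale_continuous.
exists (fun z => z.1.1 *: z.2.2 + z.2.1 *: z.1.2); split.
  move=> [a x] [b v] _ /=.
  have cv : a *: v + b *: (x + h *: v) @[h --> (0:R)^'] --> a *: v + b *: x.
    apply: tcvgD; first exact: cvg_cst.
    by apply: tcvgZ; [exact: cvg_cst|exact: cvg_line].
  apply: cvg_trans cv; apply: near_eq_cvg.
  apply: filterS near_dnbhs0_neq => h h0 /=.
  by rewrite [X in _ = _ *: X](key a b h x v) scalerK.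
apply: Sm_add; first exact: open_setXT openT.
  apply: (Sm_comp2 (V := setT) _ openT _ _ _ IH) => //.
  - exact: open_setXT openT.
  - by apply: Sm_linear => // -[[a x] [b v]]; apply: (cvg_comp fst fst cvg_fst cvg_fst).
  - by apply: Sm_linear => // -[[a x] [b v]]; apply: (cvg_comp snd snd cvg_snd cvg_snd).
apply: (Sm_comp2 (V := setT) _ openT _ _ _ IH) => //.
- exact: open_setXT openT.
- by apply: Sm_linear => // -[[a x] [b v]]; apply: (cvg_comp snd fst cvg_snd cvg_fst).
- by apply: Sm_linear => // -[[a x] [b v]]; apply: (cvg_comp fst snd cvg_fst cvg_snd).
Qed.

Lemma Sm_scale k (F E : tvsType R) (U : set F) (a : F -> R^o) (f : F -> E) :
  open U -> Sm k U a -> Sm k U f -> Sm k U (fun x => a x *: f x).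
Proof.
move=> oU Sa Sf.
exact: (Sm_comp2 oU openT _ Sa Sf (@Sm_scale_aux k E)).
Qed.

Section Differential.
Context {F E : tvsType R} (hE : hausdorff_space E).

(** A C^(k+1) map has a C^k differential, the total function [dderiv]. *)
Lemma Sm_dderiv k (U : set F) (f : F -> E) : open U -> Sm k.+1 U f ->
  (forall x v, U x -> has_dderiv f x v (dderiv f x v)) /\
  Sm k (U `*` setT) (fun z => dderiv f z.1 z.2).
Proof.
move=> oU [_ [f' [ff' Sf']]]; split.
  by move=> x v Ux; rewrite (dderivE hE (ff' x v Ux)); exact: ff'.
apply: Sm_congr Sf'; first exact: open_setXT.
by move=> [x v] [/= Ux _]; rewrite (dderivE hE (ff' x v Ux)).
Qed.

Lemma dderivZ (U : set F) (f : F -> E) (x v : F) (a : R) :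
  open U -> Sm 1 U f -> U x -> dderiv f x (a *: v) = a *: dderiv f x v.
Proof.
move=> oU /(Sm_dderiv oU)[df _] Ux; apply: (dderivE hE).
by apply: has_dderivZ; exact: df.
Qed.

Lemma dderivD (U : set F) (f : F -> E) (x v w : F) :
  open U -> Sm 1 U f -> U x -> dderiv f x (v + w) = dderiv f x v + dderiv f x w.
Proof.
move=> oU Sf Ux; have [df Sdf] := Sm_dderiv oU Sf; apply: (dderivE hE).
have cw : (h : R)^-1 *: (f ((x + h *: v) + h *: w) - f (x + h *: v))
    @[h --> (0:R)^'] --> dderiv f x w.
  apply: (@Sm_hadamard _ 0 F E U f (fun z => dderiv f z.1 z.2) x w R (0:R)^' _
    (fun h => x + h *: v) (fun=> w) id) => //.
  - exact: cvg_line.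
  - exact: cvg_cst.
  - exact: nbhs_dnbhs.
  - exact: near_dnbhs0_neq.
apply: cvg_trans (tcvgD (df x v Ux) cw); apply: near_eq_cvg.
apply: nearW => h /=; rewrite -scalerDr; congr (_ *: _).
by rewrite scalerDr (addrA x) [LHS]addrC addrA subrK.
Qed.

End Differential.

End SmoothTheory.

(** * Iterated directional derivatives *)

Section Iterated.
Context {R : realType} {F E : tvsType R}.
Implicit Types (U : set F) (f g : F -> E) (vs : seq F).

Lemma iter_dderiv_rcons f vs v x :
  iter_dderiv f (rcons vs v) x = dderiv (iter_dderiv f vs) x v.
Proof. by rewrite /iter_dderiv foldl_rcons. Qed.

Lemma iter_derivable_rcons U f vs v :
  iter_derivable U f (rcons vs v) <-> iter_derivable U f vs /\
    forall x, U x -> exists d, has_dderiv (iter_dderiv f vs) x v d.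
Proof.
elim: vs f => [|w vs IH] f /=; first by split=> [[]|[]].
by rewrite IH; split=> [[? []]|[[]]].
Qed.

Lemma iter_derivable_dd U f vs v x (hE : hausdorff_space E) :
  iter_derivable U f (rcons vs v) -> U x ->
  has_dderiv (iter_dderiv f vs) x v (iter_dderiv f (rcons vs v) x).
Proof.
move=> /iter_derivable_rcons[_ /(_ x) fd] /fd[d xd].
by rewrite iter_dderiv_rcons (dderivE hE xd).
Qed.

Lemma iter_dderiv_congr U f g vs : open U -> (forall x, U x -> f x = g x) ->
  forall x, U x -> iter_dderiv f vs x = iter_dderiv g vs x.
Proof.
move=> oU; elim: vs f g => [//|v vs IH] f g fg; apply: IH => x Ux.
by apply: dderiv_congr; apply: filterS (open_near oU Ux).
Qed.

(** Iterated derivatives are linear in the function. *)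
Lemma iter_dderiv_linear (hE : hausdorff_space E) U f g (a : R) vs : open U ->
  iter_derivable U f vs -> iter_derivable U g vs -> forall x, U x ->
  iter_dderiv (fun y => f y + a *: g y) vs x =
    iter_dderiv f vs x + a *: iter_dderiv g vs x.
Proof.
move=> oU; elim: vs f g => [//|v vs IH] f g [fd fvs] [gd gvs] x Ux /=.
rewrite -IH//; apply: (iter_dderiv_congr _ oU) => // y Uy.
have [d yd] := fd y Uy; have [d' yd'] := gd y Uy.
rewrite (dderivE hE yd) (dderivE hE yd'); apply: (dderivE hE).
by apply: has_dderivD => //; exact: has_dderivZl.
Qed.

(** The class C^k, with continuity of the iterated derivatives along arbitrary
    continuous families of points and directions: differentiating a differential
    produces directions that vary with the point. *)
Definition Ckp (k : nat) U f : Prop :=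
  forall p : nat, (p <= k)%N ->
    (forall vs, size vs = p -> iter_derivable U f vs) /\
    (forall (T : topologicalType) (z0 : T) (a : T -> F) (vs : seq (T -> F)),
       size vs = p -> U (a z0) -> {for z0, continuous a} ->
       (forall i, (i < p)%N -> {for z0, continuous (nth (fun=> 0) vs i)}) ->
       {for z0, continuous (fun z => iter_dderiv f [seq v z | v <- vs] (a z))}).

Lemma cvg_row (T : Type) (G : set_system T) (GG : Filter G) p
    (M : T -> 'rV[F]_p) (N : 'rV[F]_p) :
  (forall i, M t ord0 i @[t --> G] --> N ord0 i) -> M @ G --> N.
Proof.
move=> MN A [P NP PA]; rewrite /nbhs /=.
have : \forall t \near G, forall i, P ord0 i (M t ord0 i).
  by apply: filter_forall => i; apply: MN; exact: NP.
by apply: filterS => t tP; apply: PA => i j; rewrite (ord1 i).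
Qed.

Lemma row_continuous p (i : 'I_p) :
  continuous (fun M : 'rV[F]_p => M ord0 i).
Proof.
move=> M A AM; exists (fun _ j => if j == i then A else setT) => [j l|N NA].
  by rewrite (ord1 j); case: eqP => [->//|_]; exact: filterT.
by have := NA ord0 i; rewrite eqxx.
Qed.

(** Every continuous family of p directions factors through the space of rows. *)
Lemma Ck_Ckp k U f : Ck k U f -> Ckp k U f.
Proof.
move=> fk p pk; have [fd fc] := fk p pk; split=> // T z0 a vs svs Ua ca cvs.
pose r z : 'rV[F]_p := \row_i nth (fun=> 0) vs i z.
have seqE z : [seq v z | v <- vs] = [seq r z ord0 i | i <- enum 'I_p].
  apply: (@eq_from_nth _ 0); first by rewrite 2!size_map size_enum_ord.
  move=> i; rewrite size_map => ivs.
  rewrite (nth_map (fun=> 0))//; have ip : (i < p)%N by rewrite -svs.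
  rewrite (nth_map (Ordinal ip)) ?size_enum_ord// mxE.
  by rewrite nth_enum_ord.
have cr : {for z0, continuous (fun z => (a z, r z))}.
  apply: cont_pair => //; apply: cvg_row => i; rewrite mxE.
  apply: cvg_trans (cvs i (ltn_ord i)); apply: near_eq_cvg.
  by apply: nearW => z; rewrite mxE.
have := continuous_comp cr (fc (a z0, r z0) Ua).
by apply: cont_ext => z /=; rewrite seqE.
Qed.

Lemma Ckp_Ck k U f : Ckp k U f -> Ck k U f.
Proof.
move=> fk p pk; have [fd fc] := fk p pk; split=> // z Uz.
pose vs := [seq (fun y : F * 'rV[F]_p => y.2 ord0 i) | i <- enum 'I_p].
have svs : size vs = p by rewrite size_map size_enum_ord.
have : {for z, continuous (fun y : F * 'rV[F]_p =>
    iter_dderiv f [seq v y | v <- vs] y.1)}.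
  apply: fc => //; first exact: cvg_fst.
  move=> i ip; rewrite (nth_map (Ordinal ip)) ?size_enum_ord//.
  apply: (@continuous_comp _ _ _ snd
    (fun M : 'rV[F]_p => M ord0 (nth (Ordinal ip) (enum 'I_p) i))).
    exact: cvg_snd.
  exact: row_continuous.
by apply: cont_ext => y; rewrite -map_comp.
Qed.

Lemma Ckp_cont k U f x : Ckp k U f -> U x -> {for x, continuous f}.
Proof.
move=> fk Ux; have [_ fc] := fk 0%N isT.
by apply: (fc F x id [::]) => //; exact: cvg_id.
Qed.

Lemma Ckp_dderiv k U f (hE : hausdorff_space E) : Ckp k.+1 U f ->
  (forall x v, U x -> has_dderiv f x v (dderiv f x v)) /\
  forall x v, U x ->
    {for (x, v), continuous (fun z : F * F => dderiv f z.1 z.2)}.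
Proof.
move=> fk; have [fd fc] := fk 1%N isT; split=> [x v Ux|x v Ux].
  by have [/(_ x Ux)[d xd] _] := fd [:: v] erefl; rewrite (dderivE hE xd).
apply: (fc (F * F)%type (x, v) fst [:: snd]) => //; first exact: cvg_fst.
by case=> // _; exact: cvg_snd.
Qed.

Lemma Ckp1_linear k U f (hE : hausdorff_space E) x v w (a : R) : open U ->
  Ckp k.+1 U f -> U x ->
  dderiv f x (v + a *: w) = dderiv f x v + a *: dderiv f x w.
Proof.
move=> oU fk Ux; have [fd fc] := Ckp_dderiv hE fk.
have S1 : Sm 1 U f.
  split; first by move=> y Uy; exact: Ckp_cont fk Uy.
  exists (fun z => dderiv f z.1 z.2); split=> //.
  by apply: Sm0 => -[y u] [Uy _]; exact: fc.
by rewrite (dderivD hE _ _ oU S1 Ux) (dderivZ hE _ _ oU S1 Ux).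
Qed.

End Iterated.

Lemma cont_sum {R : realType} {E : tvsType R} (T : topologicalType) (z0 : T) n
    (g : 'I_n -> T -> E) : (forall i, {for z0, continuous (g i)}) ->
  {for z0, continuous (fun z => \sum_i g i z)}.
Proof.
elim: n g => [|n IH] g gc.
  by apply: (@cont_ext _ _ (fun=> 0)) => [z|]; [rewrite big_ord0|exact: cvg_cst].
apply: (@cont_ext _ _ (fun z => g ord0 z + \sum_(i < n) g (lift ord0 i) z)).
  by move=> z; rewrite big_ord_recl.
by apply: tcvgD; [exact: gc|exact: IH].
Qed.

Section CkpDifferential.
Context {R : realType} {F E : tvsType R} (hE : hausdorff_space E).
Context (k : nat) (U : set F) (f : F -> E) (oU : open U) (fk : Ckp k.+1 U f).
Implicit Types (zs : seq (F * F)).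

Let df (z : F * F) : E := dderiv f z.1 z.2.

Let near_UT (z : F * F) : U z.1 -> \forall y \near z, U y.1.
Proof.
move=> Uz; have : nbhs z (U `*` [set: F]).
  apply: open_nbhs_nbhs; split; [exact: open_setXT|by []].
by apply: filterS => y [].
Qed.

(** The iterated derivative of df(x,v) along (w_1,u_1),...,(w_p,u_p): by linearity
    of df in v, each direction w_i acts on the point, and one of the u_i may
    instead replace v. *)
Let dd zs (z : F * F) : E := iter_dderiv f (z.2 :: map fst zs) z.1 +
  \sum_(i < size zs)
    iter_dderiv f ((nth 0 zs i).2 :: map fst (take i zs ++ drop i.+1 zs)) z.1.

Let size_omit zs i : (i < size zs)%N ->
  size (take i zs ++ drop i.+1 zs) = (size zs).-1.
Proof.
move=> izs; rewrite size_cat size_drop size_take izs.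
by rewrite subnS -subn1 addnBA ?subn_gt0// subnKC 1?ltnW// subn1.
Qed.

Let fd vs x v : (size vs <= k)%N -> U x ->
  has_dderiv (iter_dderiv f vs) x v (iter_dderiv f (rcons vs v) x).
Proof.
move=> vsk Ux; apply: (iter_derivable_dd hE) Ux.
have [H _] := fk (p := size (rcons vs v)) ltac:(by rewrite size_rcons).
exact: H.
Qed.

Let fder vs : (size vs <= k.+1)%N -> iter_derivable U f vs.
Proof. by move=> vsk; have [H _] := fk vsk; exact: H. Qed.

Let dd_first vs x v u (a : R) : (size vs <= k)%N -> U x ->
  iter_dderiv f ((v + a *: u) :: vs) x =
  iter_dderiv f (v :: vs) x + a *: iter_dderiv f (u :: vs) x.
Proof.
move=> vsk Ux /=.
have dv w : iter_derivable U (dderiv f ^~ w) vs by have [] := @fder (w :: vs) vsk.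
rewrite -(iter_dderiv_linear hE a oU (dv v) (dv u) Ux).
apply: (iter_dderiv_congr _ oU) => // y Uy.
exact: Ckp1_linear oU fk Uy.
Qed.

Let has_dd zs z wu : (size zs < k)%N -> U z.1 ->
  has_dderiv (dd zs) z wu (dd (rcons zs wu) z).
Proof.
case: z wu => [x v] [w u] zsk /= Ux.
have zsk' := ltnW zsk.
set ws := map fst zs.
have sws : size ws = size zs by rewrite size_map.
pose T y v' := iter_dderiv f (v' :: ws) y.
have T1 : has_dderiv (fun z : F * F => T z.1 z.2) (x, v) (w, u)
    (iter_dderiv f (v :: rcons ws w) x + iter_dderiv f (u :: ws) x).
  have T1a : has_dderiv (fun y => T y v) x w (iter_dderiv f (v :: rcons ws w) x).
    by rewrite -rcons_cons; apply: fd => //=; rewrite sws.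
  have T1b : T (x + h *: w) u @[h --> (0:R)^'] --> T x u.
    have : {for x, continuous (fun y => iter_dderiv f [seq v' y |
        v' <- [seq (fun=> w') | w' <- u :: ws]] (id y))}.
      have [_ H] := fk (p := (size ws).+1) ltac:(by rewrite sws ltnS ltnW).
      apply: H => //; first by rewrite size_map.
      move=> i iws; rewrite (nth_map 0)//; exact: cvg_cst.
    have -> : (fun y => iter_dderiv f [seq v' y |
        v' <- [seq (fun=> w') | w' <- u :: ws]] (id y)) = (fun y => T y u).
      by apply/funext => y; rewrite -map_comp map_id.
    by move=> Tc; apply: (cvg_comp _ _ (@cvg_line _ _ x w) Tc).
  rewrite /has_dderiv /=.
  apply: cvg_trans (tcvgD T1a T1b); apply: near_eq_cvg.
  have Uw : \forall h \near (0:R)^', U (x + h *: w).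
    exact: (@cvg_line _ _ x w _ (open_near oU Ux)).
  apply: filterS2 near_dnbhs0_neq Uw => h h0 Uh /=.
  by rewrite /T dd_first ?sws// addrAC [RHS]scalerDr scalerK.
have T2 : has_dderiv (fun z : F * F => \sum_(i < size zs)
    iter_dderiv f ((nth 0 zs i).2 :: map fst (take i zs ++ drop i.+1 zs)) z.1)
    (x, v) (w, u) (\sum_(i < size zs)
    iter_dderiv f (rcons ((nth 0 zs i).2 :: map fst (take i zs ++ drop i.+1 zs)) w) x).
  apply: has_dderiv_sum => i.
  apply: (@fd ((nth 0 zs i).2 :: map fst (take i zs ++ drop i.+1 zs))) => //=.
  by rewrite size_map size_omit// (leq_ltn_trans (leq_pred _)).
have := has_dderivD T1 T2; congr (has_dderiv _ _ _ _).
rewrite /dd size_rcons big_ord_recr /= map_rcons -!addrA; congr (_ + _).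
rewrite addrC; congr (_ + _); last first.
  rewrite nth_rcons ltnn eqxx /= -cats1 take_size_cat//.
  by rewrite drop_oversize ?cats0// size_cat addn1.
apply: eq_bigr => i _; rewrite nth_rcons ltn_ord.
rewrite -[w in LHS]/((w, u).1) -map_rcons; congr (iter_dderiv _ (map fst _) x).
rewrite -!cats1 take_cat ltn_ord -catA; congr (_ ++ _); rewrite drop_cat.
case: ltnP => // izs; have -> : i.+1 = size zs by apply/eqP; rewrite eqn_leq izs andbT.
by rewrite subnn drop_size.
Qed.

Let iter_df zs : (size zs <= k)%N ->
  iter_derivable (U `*` setT) df zs /\
  forall z, U z.1 -> iter_dderiv df zs z = dd zs z.
Proof.
elim/last_ind: zs => [_|zs wu IH].
  by split=> // z Uz; rewrite /dd big_ord0 addr0.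
rewrite size_rcons => zsk; have [dfd dfE] := IH (ltnW zsk).
have step z : U z.1 ->
    has_dderiv (iter_dderiv df zs) z wu (dd (rcons zs wu) z).
  move=> Uz; apply: (@has_dderiv_congr _ _ _ (dd zs)); last exact: has_dd.
  by apply: filterS (near_UT Uz) => y Uy; rewrite dfE.
split.
  apply/iter_derivable_rcons; split=> // z [Uz _].
  by exists (dd (rcons zs wu) z); exact: step.
by move=> z Uz; rewrite iter_dderiv_rcons (dderivE hE (step z Uz)).
Qed.

(** The differential of a C^(k+1) map is C^k: as (x,v) moves in the direction
    (w,u), the derivative of D_vf(x) is D_wD_vf(x) + D_uf(x). *)
Lemma Ckp_differential : Ckp k (U `*` setT) (fun z => dderiv f z.1 z.2).
Proof.
move=> p pk; split=> [zs szs|]; first by have [] := @iter_df zs ltac:(by rewrite szs).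
move=> T z0 a vs svs [Uaz0 _] ca cvs.
have near_U : \forall z \near z0, U (a z).1.
  exact: (ca _ (near_UT Uaz0)).
have c1 (b : T -> F * F) : {for z0, continuous b} ->
  {for z0, continuous (fun z => (b z).1)} /\ {for z0, continuous (fun z => (b z).2)}.
  move=> cb; split.
    by apply: (@continuous_comp _ _ _ b fst) => //; exact: cvg_fst.
  by apply: (@continuous_comp _ _ _ b snd) => //; exact: cvg_snd.
have [ca1 ca2] := c1 _ ca.
have ddc : {for z0, continuous (fun z => dd [seq v z | v <- vs] (a z))}.
  rewrite /dd.
  have cT : {for z0, continuous (fun z =>
      iter_dderiv f ((a z).2 :: map fst [seq v z | v <- vs]) (a z).1)}.
    have [_ H] := fk (p := p.+1) ltac:(by rewrite ltnS).
    have := H T z0 (fun z => (a z).1) ((fun z => (a z).2) ::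
      [seq (fun z => (v z).1) | v <- vs]) _ Uaz0 ca1 _.
    rewrite /= size_map svs => /(_ erefl) => {}H.
    have : {for z0, continuous (fun z => iter_dderiv f [seq v z | v <-
      (fun z => (a z).2) :: [seq (fun z => (v z).1) | v <- vs]] (a z).1)}.
      apply: H => -[_|i]; first exact: ca2.
      rewrite ltnS => ip /=; rewrite (nth_map (fun=> 0)) ?svs//.
      by have [] := c1 _ (cvs i ip).
    by apply: cont_ext => z /=; rewrite -!map_comp.
  have cS (i : 'I_p) : {for z0, continuous (fun z =>
      iter_dderiv f ((nth 0 [seq v z | v <- vs] i).2 :: map fst
        (take i [seq v z | v <- vs] ++ drop i.+1 [seq v z | v <- vs])) (a z).1)}.
    pose ws := take i vs ++ drop i.+1 vs.
    have ip := ltn_ord i.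
    have sws : size ws = p.-1.
      rewrite /ws size_cat size_drop size_take svs ltn_ord.
      by rewrite subnS -subn1 addnBA ?subn_gt0// subnKC 1?ltnW// subn1.
    have [_ H] := fk (p := p) ltac:(by rewrite ltnW// ltnS).
    have {}H := H T z0 (fun z => (a z).1) ((fun z => (nth (fun=> 0) vs i z).2) ::
      [seq (fun z => (v z).1) | v <- ws]) _ Uaz0 ca1 _.
    have : {for z0, continuous (fun z => iter_dderiv f [seq v z | v <-
      (fun z => (nth (fun=> 0) vs i z).2) :: [seq (fun z => (v z).1) | v <- ws]] (a z).1)}.
      apply: H => [|[_|j]].
      - by rewrite /= size_map sws prednK// (leq_ltn_trans _ ip).
      - by have [] := c1 _ (cvs i ip).
      move=> jp /=; have jp' : (j < p.-1)%N by rewrite -ltnS prednK// (leq_ltn_trans _ ip).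
      rewrite (nth_map (fun=> 0)) ?sws// /ws nth_cat size_take svs ip.
      case: ltnP => ji; first by rewrite nth_take//; have [] := c1 _ (cvs j (ltn_trans ji ip)).
      rewrite nth_drop addSn subnKC//.
      by have [] := c1 _ (cvs j.+1 ltac:(by rewrite -(prednK (leq_ltn_trans (leq0n i) ip)) ltnS)).
    apply: cont_ext => z /=; rewrite (nth_map (fun=> 0)) ?svs//.
    by rewrite /ws -map_take -map_drop -map_cat -!map_comp.
  have sE z : size [seq v z | v <- vs] = p by rewrite size_map.
  have -> : (fun z => iter_dderiv f ((a z).2 :: map fst [seq v z | v <- vs]) (a z).1 +
    \sum_(i < size [seq v z | v <- vs]) iter_dderiv f
     ((nth 0 [seq v z | v <- vs] i).2 :: map fst
        (take i [seq v z | v <- vs] ++ drop i.+1 [seq v z | v <- vs])) (a z).1) =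
    (fun z => iter_dderiv f ((a z).2 :: map fst [seq v z | v <- vs]) (a z).1 +
    \sum_(i < p) iter_dderiv f
     ((nth 0 [seq v z | v <- vs] i).2 :: map fst
        (take i [seq v z | v <- vs] ++ drop i.+1 [seq v z | v <- vs])) (a z).1).
    by apply/funext => z; rewrite sE.
  apply: tcvgD; first exact: cT.
  exact: cont_sum cS.
apply: cont_congr ddc; apply: filterS near_U => z Uz.
have [_ ->//] := @iter_df [seq v z | v <- vs] ltac:(by rewrite size_map svs).
Qed.

End CkpDifferential.

Section CkSm.
Context {R : realType}.

(** Induction on k, the differential of a C^(k+1) map being C^k. *)
Lemma Ck_Sm k (F E : tvsType R) (hE : hausdorff_space E) (U : set F)
    (f : F -> E) : open U -> Ck k U f -> Sm k U f.
Proof.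
move=> oU /Ck_Ckp; elim: k F U f oU => [|k IH] F U f oU fk.
  by apply: Sm0 => x; exact: Ckp_cont fk.
split; first by move=> x; exact: Ckp_cont fk.
have [df _] := Ckp_dderiv hE fk.
exists (fun z => dderiv f z.1 z.2); split=> //.
by apply: IH; [exact: open_setXT|exact: Ckp_differential].
Qed.

(** With a parameter y, the iterated derivatives of g(.,y) are obtained by
   repeatedly absorbing the first direction into the parameter. *)
Lemma Sm_iter_param p (F H E : tvsType R) (hE : hausdorff_space E)
    (W : set (F * H)) (g : F * H -> E) : open W -> Sm p W g ->
  (forall y vs, size vs = p ->
     iter_derivable [set x | W (x, y)] (fun x => g (x, y)) vs) /\
  forall (T : topologicalType) (z0 : T) (a : T -> F) (b : T -> H)
    (vs : seq (T -> F)), size vs = p -> W (a z0, b z0) ->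
    {for z0, continuous a} -> {for z0, continuous b} ->
    (forall i, (i < p)%N -> {for z0, continuous (nth (fun=> 0) vs i)}) ->
    {for z0, continuous (fun z =>
       iter_dderiv (fun x => g (x, b z)) [seq v z | v <- vs] (a z))}.
Proof.
elim: p H W g => [|p IH] H W g oW Sg.
  split=> [y [|//] _ //|T z0 a b [|//] _ Wz ca cb _ /=].
  apply: (@continuous_comp _ _ _ (fun z => (a z, b z)) g).
    exact: cont_pair.
  exact: Sm_cont Sg Wz.
pose g1 (w : F * (H * F)) : E := dderiv g (w.1, w.2.1) (w.2.2, 0).
pose W1 : set (F * (H * F)) := [set w | W (w.1, w.2.1)].
have [dg Sdg] := Sm_dderiv hE oW Sg.
have dE y v : dderiv (fun x => g (x, y)) ^~ v = fun x => g1 (x, (y, v)).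
  apply/funext => x; rewrite /g1 /dderiv /has_dderiv /=.
  congr (xget 0 _); apply/funext => d.
  suff -> : (fun h : R => h^-1 *: (g ((x, y) + h *: (v, 0)) - g (x, y))) =
    (fun h : R => h^-1 *: (g (x + h *: v, y) - g (x, y))) by [].
  apply/funext => h; congr (_ *: (g _ - _)); congr (_, _) => /=.
  by rewrite scaler0 addr0.
have SL k : Sm k setT (fun w : F * (H * F) => ((w.1, w.2.1), (w.2.2, 0 : H))).
  apply: Sm_pair; apply: Sm_pair; [exact: Sm_fst| | |exact: Sm_cst].
    by apply: Sm_linear => // w; apply: (cvg_comp snd fst cvg_snd cvg_fst).
  by apply: Sm_linear => // w; apply: (cvg_comp snd snd cvg_snd cvg_snd).
have oW1 : open W1.
  suff -> : W1 = (fun w : F * (H * F) => (w.1, w.2.1)) @^-1` W.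
    move: oW; apply: open_comp => w _; apply: cont_pair; first exact: cvg_fst.
    exact: (cvg_comp snd fst cvg_snd cvg_fst).
  by [].
have Sg1 : Sm p W1 g1.
  have oWT : open (W `*` [set: F * H]) by exact: open_setXT.
  apply: (Sm_comp (f := fun w : F * (H * F) => ((w.1, w.2.1), (w.2.2, 0 : H)))
    oW1 oWT _ (Sm_sub _ (SL p)) Sdg); last by [].
  by move=> w Ww; split.
have [IHd IHc] := IH _ _ _ oW1 Sg1; split=> [y [//|v vs] [svs]|].
  split=> [x Wx|]; last by rewrite dE; exact: (IHd (y, v) vs svs).
  exists (g1 (x, (y, v))); rewrite -[g1 _]/((fun x => g1 (x, (y, v))) x) -dE.
  have := dg (x, y) (v, 0) Wx.
  rewrite -[dderiv g _ _]/((fun x => g1 (x, (y, v))) x) -dE /has_dderiv.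
  suff -> : (fun h : R => h^-1 *: (g ((x, y) + h *: (v, 0)) - g (x, y))) =
    (fun h : R => h^-1 *: (g (x + h *: v, y) - g (x, y))) by [].
  apply/funext => h; congr (_ *: (g _ - _)); congr (_, _) => /=.
  by rewrite scaler0 addr0.
move=> T z0 a b [//|v vs] [svs] Wz ca cb cvs /=.
apply: (@cont_ext _ _ (fun z => iter_dderiv (fun x => g1 (x, (b z, v z)))
    [seq v z | v <- vs] (a z))).
  by move=> z; rewrite -dE.
apply: (IHc T z0 a (fun z => (b z, v z)) vs) => //.
  by apply: cont_pair => //; exact: (cvs 0%N).
by move=> i ip; exact: (cvs i.+1).
Qed.

(** The case of a parameter on which nothing depends. *)
Lemma Sm_Ck k (F E : tvsType R) (hE : hausdorff_space E) (U : set F)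
    (f : F -> E) : open U -> Sm k U f -> Ck k U f.
Proof.
move=> oU Sf; apply: Ckp_Ck => p pk.
have {}Sf := Sm_le pk Sf.
pose H : tvsType R := R^o.
have oUT : open (U `*` [set: H]) by exact: open_setXT.
have Sg : Sm p (U `*` [set: H]) (f \o fst).
  apply: (Sm_comp oUT oU _ (@Sm_fst _ _ _ _ _) Sf).
  by move=> [x y] [].
have [fd fc] := Sm_iter_param hE oUT Sg; split=> [vs svs|T z0 a vs svs Ua ca cvs].
  have := fd 0 vs svs; congr (iter_derivable _ _ _).
  by apply/seteqP; split=> x /=; [case|].
by apply: (fc T z0 a (fun=> 0) vs) => //; exact: cvg_cst.
Qed.

End CkSm.

(** * Smooth maps into a Lie group *)

Section LocalSmooth.
Context {R : realType}.

(** Differentiability near a point, without naming the open set: maps read in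
    charts are defined on varying open sets. *)
Definition Smat k (F E : tvsType R) (f : F -> E) (x : F) : Prop :=
  exists U : set F, [/\ open U, U x & Sm k U f].

Lemma Smat_cont k (F E : tvsType R) (f : F -> E) x :
  Smat k f x -> {for x, continuous f}.
Proof. by move=> [U [oU Ux Sf]]; exact: Sm_cont Sf Ux. Qed.

Lemma open_setI_preimage (S T : topologicalType) (U : set S) (V : set T)
    (f : S -> T) : open U -> open V -> (forall x, U x -> {for x, continuous f}) ->
  open (U `&` f @^-1` V).
Proof.
move=> oU oV fc; rewrite openE => x [Ux Vfx].
apply: filterI; first exact: open_nbhs_nbhs.
by apply: fc => //; exact: open_nbhs_nbhs.
Qed.

Lemma Smat_comp k (F E H : tvsType R) (f : F -> E) (g : E -> H) x :
  Smat k f x -> Smat k g (f x) -> Smat k (g \o f) x.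
Proof.
move=> [U [oU Ux Sf]] [V [oV Vfx Sg]].
have oUV : open (U `&` f @^-1` V).
  by apply: open_setI_preimage => // y Uy; exact: Sm_cont Sf Uy.
exists (U `&` f @^-1` V); split=> //.
apply: (Sm_comp oUV oV _ _ Sg); first by move=> y [].
by apply: Sm_sub Sf => y [].
Qed.

Lemma Smat_congr k (F E : tvsType R) (f g : F -> E) x :
  (\forall y \near x, f y = g y) -> Smat k f x -> Smat k g x.
Proof.
move=> fg [U [oU Ux Sf]].
have [V [oV Vx] Vfg] : exists2 V, open_nbhs x V & V `<=` [set y | f y = g y].
  by have : nbhs x [set y | f y = g y] := fg; rewrite nbhsE.
exists (U `&` V); split=> //; first exact: openI.
apply: (@Sm_congr _ k _ _ _ f); first exact: openI.
  by move=> y [_ /Vfg].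
by apply: Sm_sub Sf => y [].
Qed.

(** The differentials obtained near the various points all agree with [dderiv],
    and therefore fit together. *)
Lemma Sm_local k (F E : tvsType R) (hE : hausdorff_space E) (U : set F)
    (f : F -> E) : (forall x, U x -> Smat k f x) -> Sm k U f.
Proof.
elim: k F U f => [|k IH] F U f Sf.
  by apply: Sm0 => x /Sf; exact: Smat_cont.
split; first by move=> x /Sf; exact: Smat_cont.
exists (fun z => dderiv f z.1 z.2); split.
  by move=> x v /Sf[V [oV Vx SV]]; have [+ _] := Sm_dderiv hE oV SV; exact.
apply: IH => -[x v] [/Sf[V [oV Vx SV]] _].
exists (V `*` setT); split=> //; first exact: open_setXT.
by have [] := Sm_dderiv hE oV SV.
Qed.

Section Dderiv.
Context {F E : tvsType R} (hE : hausdorff_space E).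

Lemma Smat_has_dderiv (f : F -> E) x v :
  Smat 1 f x -> has_dderiv f x v (dderiv f x v).
Proof. by move=> [U [oU Ux Sf]]; have [+ _] := Sm_dderiv hE oU Sf; exact. Qed.

Lemma Smat_dderiv k (f : F -> E) x v :
  Smat k.+1 f x -> Smat k (fun z : F * F => dderiv f z.1 z.2) (x, v).
Proof.
move=> [U [oU Ux Sf]]; exists (U `*` setT); split=> //; first exact: open_setXT.
by have [] := Sm_dderiv hE oU Sf.
Qed.

Lemma Smat_dderivD (f : F -> E) x v w :
  Smat 1 f x -> dderiv f x (v + w) = dderiv f x v + dderiv f x w.
Proof. by move=> [U [oU Ux Sf]]; exact: dderivD Sf Ux. Qed.

Lemma Smat_dderivZ (f : F -> E) x a v :
  Smat 1 f x -> dderiv f x (a *: v) = a *: dderiv f x v.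
Proof. by move=> [U [oU Ux Sf]]; exact: dderivZ Sf Ux. Qed.

Lemma Smat_hadamard (f : F -> E) x0 v0
    (T : Type) (G : set_system T) (GG : Filter G)
    (x v : T -> F) (h : T -> R) : Smat 1 f x0 ->
  x @ G --> x0 -> v @ G --> v0 -> h @ G --> (0 : R) ->
  (\forall t \near G, h t != 0) ->
  (h t)^-1 *: (f (x t + h t *: v t) - f (x t)) @[t --> G] --> dderiv f x0 v0.
Proof.
move=> [U [oU Ux Sf]]; have [df Sdf] := Sm_dderiv hE oU Sf.
exact: (@Sm_hadamard _ 0 F E U f (fun z => dderiv f z.1 z.2)).
Qed.

End Dderiv.

Lemma Smat_has_dderiv_comp (F E H : tvsType R) (hH : hausdorff_space H)
    (f : F -> E) (g : E -> H) x v d :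
  has_dderiv f x v d -> Smat 1 g (f x) ->
  has_dderiv (g \o f) x v (dderiv g (f x) d).
Proof.
move=> fd [V [oV Vx Sg]]; have [dg Sdg] := Sm_dderiv hH oV Sg.
exact: (has_dderiv_comp (g' := fun z => dderiv g z.1 z.2) oV dg Sdg Vx fd).
Qed.

Lemma dderiv_comp (F E H : tvsType R) (hE : hausdorff_space E)
    (hH : hausdorff_space H) (f : F -> E) (g : E -> H) x v :
  Smat 1 f x -> Smat 1 g (f x) ->
  dderiv (g \o f) x v = dderiv g (f x) (dderiv f x v).
Proof.
move=> Sf Sg; apply: (dderivE hH); apply: Smat_has_dderiv_comp => //.
exact: Smat_has_dderiv.
Qed.

Lemma dderiv_id (F : tvsType R) (hF : hausdorff_space F) (x v : F) :
  dderiv id x v = v.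
Proof.
apply: (dderivE hF); apply: cvg_near_cst.
by apply: filterS near_dnbhs0_neq => h h0; rewrite addrAC subrr add0r scalerK.
Qed.

Lemma dderiv_partial1 (F H E : tvsType R) (f : F * H -> E) x y v :
  dderiv (fun x => f (x, y)) x v = dderiv f (x, y) (v, 0).
Proof.
rewrite /dderiv /has_dderiv /=; congr (xget 0 _); apply/funext => d.
suff -> : (fun h : R => h^-1 *: (f ((x, y) + h *: (v, 0)) - f (x, y))) =
    (fun h : R => h^-1 *: (f (x + h *: v, y) - f (x, y))) by [].
apply/funext => h; congr (_ *: (f _ - _)); congr (_, _) => /=.
by rewrite scaler0 addr0.
Qed.

Lemma dderiv_partial2 (F H E : tvsType R) (f : F * H -> E) x y v :
  dderiv (fun y => f (x, y)) y v = dderiv f (x, y) (0, v).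
Proof.
rewrite /dderiv /has_dderiv /=; congr (xget 0 _); apply/funext => d.
suff -> : (fun h : R => h^-1 *: (f ((x, y) + h *: (0, v)) - f (x, y))) =
    (fun h : R => h^-1 *: (f (x, y + h *: v) - f (x, y))) by [].
apply/funext => h; congr (_ *: (f _ - _)); congr (_, _) => /=.
by rewrite scaler0 addr0.
Qed.

End LocalSmooth.

Section GroupSmooth.
Context {R : realType} {E : tvsType R} (hE : hausdorff_space E) (G : lieGroup E).

Let A := lie_manifold G.

Lemma atlas_smooth_chart c : atlas A c -> smooth_chart A c.
Proof.
move=> Ac c' Ac'; split.
  exact: (atlas_compatible Ac Ac').
exact: (atlas_compatible Ac' Ac).
Qed.

Lemma chart_atP (g : G) : atlas A (chart_at A g) /\ chart_dom (chart_at A g) g.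
Proof. by rewrite /chart_at; case: cid2. Qed.

Lemma mulG_continuous (g h : G) :
  {for (g, h), continuous (fun z : G * G => (z.1 * z.2)%g)}.
Proof. by have [+ _] := lie_mul_smooth G 0; exact. Qed.

Lemma invG_continuous (g : G) : {for g, continuous (fun z : G => z^-1%g)}.
Proof. by have [+ _] := lie_inv_smooth G 0; exact. Qed.

Section Limits.
Context {T : Type} {F : set_system T} {FF : Filter F}.

Lemma cvg_mulG (f f' : T -> G) g g' : f @ F --> g -> f' @ F --> g' ->
  (f t * f' t)%g @[t --> F] --> (g * g')%g.
Proof.
move=> fg fg'; apply: (cvg_comp (fun t => (f t, f' t)) (fun z => (z.1 * z.2)%g)).
  exact: cvg_pair fg fg'.
exact: mulG_continuous.
Qed.

Lemma cvg_invG (f : T -> G) g : f @ F --> g -> (f t)^-1%g @[t --> F] --> g^-1%g.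
Proof. by move=> fg; apply: (cvg_comp f _ fg); exact: invG_continuous. Qed.

Lemma cvg_chart (c : chart G E) (f : T -> G) g : f @ F --> g -> chart_dom c g ->
  c (f t) @[t --> F] --> c g.
Proof.
by move=> fg cg; apply: (cvg_comp f _ fg); exact: chart_map_continuous.
Qed.

Lemma cvg_chart_inv (c : chart G E) (f : T -> E) y : f @ F --> y ->
  chart_cod c y -> chart_inv c (f t) @[t --> F] --> chart_inv c y.
Proof.
by move=> fg cg; apply: (cvg_comp f _ fg); exact: chart_inv_continuous.
Qed.

Lemma near_chart_dom (c : chart G E) (f : T -> G) g : f @ F --> g ->
  chart_dom c g -> \forall t \near F, chart_dom c (f t).
Proof.
move=> fg cg; apply: fg; apply: open_nbhs_nbhs; split=> //.
exact: chart_dom_open.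
Qed.

End Limits.

Lemma compatible_Smat k (c c' : chart G E) y : compatible c c' ->
  chart_cod c y -> chart_dom c' (chart_inv c y) -> Smat k (c' \o chart_inv c) y.
Proof.
move=> /(_ k) cc' cy c'y.
have o : open (chart_cod c `&` chart_inv c @^-1` chart_dom c').
  apply: open_setI_preimage; [exact: chart_cod_open|exact: chart_dom_open|].
  exact: chart_inv_continuous.
exists (chart_cod c `&` chart_inv c @^-1` chart_dom c'); split=> //.
exact: Ck_Sm.
Qed.

(** A G-valued map is smooth at a point when it is continuous there and smooth
    in one chart of the atlas; by compatibility it is then smooth in every smooth
    chart, see [SmG_read]. *)
Definition SmG k (F : tvsType R) (f : F -> G) (x : F) : Prop :=
  {for x, continuous f} /\
  exists c, [/\ atlas A c, chart_dom c (f x) & Smat k (c \o f) x].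

Lemma SmG_transfer k (F : tvsType R) (f : F -> G) x (c c' : chart G E) :
  {for x, continuous f} -> chart_dom c (f x) -> chart_dom c' (f x) ->
  compatible c c' -> Smat k (c \o f) x -> Smat k (c' \o f) x.
Proof.
move=> fc cx c'x cc' Sf.
have : Smat k ((c' \o chart_inv c) \o (c \o f)) x.
  apply: Smat_comp => //; apply: compatible_Smat => //=; first exact: chart_mapP.
  by rewrite chart_mapK.
apply: Smat_congr; apply: filterS (near_chart_dom fc cx) => y /= cy.
by rewrite chart_mapK.
Qed.

Lemma SmG_read k (F : tvsType R) (f : F -> G) x c : smooth_chart A c ->
  chart_dom c (f x) -> SmG k f x -> Smat k (c \o f) x.
Proof.
move=> sc cx [fc [c' [Ac' c'x Sf]]]; apply: SmG_transfer Sf => //.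
by have [] := sc c' Ac'.
Qed.

Lemma SmG_intro k (F : tvsType R) (f : F -> G) x c : smooth_chart A c ->
  chart_dom c (f x) -> {for x, continuous f} -> Smat k (c \o f) x -> SmG k f x.
Proof.
move=> sc cx fc Sf; have [Ac' c'x] := chart_atP (f x); split=> //.
exists (chart_at A (f x)); split=> //; apply: SmG_transfer Sf => //.
by have [] := sc _ Ac'.
Qed.

Lemma SmG_chart_inv k c y : smooth_chart A c -> chart_cod c y ->
  SmG k (chart_inv c) y.
Proof.
move=> sc cy; apply: (SmG_intro sc); first exact: chart_invP.
  exact: chart_inv_continuous.
have nc : \forall z \near y, chart_cod c z.
  by apply: open_near => //; exact: chart_cod_open.
apply: (@Smat_congr _ _ _ _ id); last by exists setT; split=> //; [exact: openT|exact: Sm_id].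
by apply: filterS nc => z cz; rewrite /= chart_invK.
Qed.

Lemma SmG_cst k (F : tvsType R) (g : G) (x : F) : SmG k (fun=> g) x.
Proof.
have [Ac cg] := chart_atP g.
apply: (SmG_intro (atlas_smooth_chart Ac)) => //; first exact: cvg_cst.
by exists setT; split=> //; [exact: openT|exact: Sm_cst].
Qed.

Lemma SmG_comp k (F H : tvsType R) (f : H -> G) (h : F -> H) x :
  Smat k h x -> SmG k f (h x) -> SmG k (f \o h) x.
Proof.
move=> Sh [fc [c [Ac cx Sf]]]; split.
  by apply: continuous_comp fc; exact: Smat_cont Sh.
by exists c; split=> //; exact: (Smat_comp Sh Sf).
Qed.

Lemma SmG_inv k (F : tvsType R) (f : F -> G) x :
  SmG k f x -> SmG k (fun y => (f y)^-1%g) x.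
Proof.
move=> [fc [c [Ac cx Sf]]]; have [Ac' c'x] := chart_atP (f x)^-1%g.
set c' := chart_at A _ in Ac' c'x.
apply: (SmG_intro (atlas_smooth_chart Ac')) => //; first exact: cvg_invG.
pose i g : G := g^-1%g.
have : Smat k ((c' \o i \o chart_inv c) \o (c \o f)) x.
  apply: Smat_comp => //.
  have [_ /(_ c c' Ac Ac')] := lie_inv_smooth G k.
  set D := (X in Ck _ X _) => Si.
  have oD : open D.
    apply: open_setI_preimage; first exact: chart_cod_open; last first.
      exact: chart_inv_continuous.
    apply: open_setI_preimage; [exact: openT|exact: chart_dom_open|].
    by move=> g _; exact: invG_continuous.
  exists D; split=> //; last exact: Ck_Sm.
  by split; [exact: chart_mapP|rewrite /= chart_mapK].
apply: Smat_congr; apply: filterS (near_chart_dom fc cx) => y /= cy.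
by rewrite chart_mapK.
Qed.

Lemma SmG_mul k (F : tvsType R) (f g : F -> G) x :
  SmG k f x -> SmG k g x -> SmG k (fun y => (f y * g y)%g) x.
Proof.
move=> [fc [c [Ac cx Sf]]] [gc [d [Ad dx Sg]]].
have [Ac' c'x] := chart_atP (f x * g x)%g.
set c' := chart_at A _ in Ac' c'x.
apply: (SmG_intro (atlas_smooth_chart Ac')) => //; first exact: cvg_mulG.
pose m (z : G * G) : G := (z.1 * z.2)%g.
have : Smat k ((c' \o m \o chart_inv (prod_chart c d)) \o
    (fun y => (c (f y), d (g y)))) x.
  apply: Smat_comp.
    have [U [oU Ux SU]] := Sf; have [V [oV Vx SV]] := Sg.
    exists (U `&` V); split=> //; first exact: openI.
    by apply: Sm_pair; [apply: Sm_sub SU => y []|apply: Sm_sub SV => y []].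
  have Acd : prod_atlas (atlas A) (atlas A) (prod_chart c d) by exists c, d.
  have [_ /(_ _ c' Acd Ac')] := lie_mul_smooth G k.
  set D := (X in Ck _ X _) => Si.
  have oD : open D.
    apply: open_setI_preimage; first exact: chart_cod_open; last first.
      exact: chart_inv_continuous.
    apply: open_setI_preimage; [exact: openT|exact: chart_dom_open|].
    by move=> [y z] _; exact: mulG_continuous.
  exists D; split=> //; last exact: Ck_Sm.
  split; first by split; exact: chart_mapP.
  by split=> //=; rewrite !chart_mapK.
apply: Smat_congr.
apply: filterS2 (near_chart_dom fc cx) (near_chart_dom gc dx) => y /= cy dy.
by rewrite /m /= !chart_mapK.
Qed.

End GroupSmooth.

(** * Right logarithmic derivatives *)

Section Logarithm.
Context {R : realType} {E : tvsType R} (hE : hausdorff_space E) (G : lieGroup E).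
Context (Xi : chart G E) (Xi_chart : smooth_chart (lie_manifold G) Xi)
  (Xi_dom1 : chart_dom Xi 1%g) (Xi1 : Xi 1%g = 0).

Let A := lie_manifold G.
Local Notation exp := (chart_inv Xi).

Lemma cod0 : chart_cod Xi 0.
Proof. by rewrite -Xi1; exact: chart_mapP. Qed.

Lemma exp0 : exp 0 = 1%g.
Proof. by rewrite -Xi1 chart_mapK. Qed.

Lemma SmG_exp k y : chart_cod Xi y -> SmG k exp y.
Proof. exact: SmG_chart_inv. Qed.

Lemma SmG_exp_comp k (F : tvsType R) (f : F -> E) x : Smat k f x ->
  chart_cod Xi (f x) -> SmG k (fun y => exp (f y)) x.
Proof. by move=> Sf fx; apply: (SmG_comp Sf); exact: SmG_exp. Qed.

Lemma Smat_fst k (F H : tvsType R) (x : F * H) : Smat k fst x.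
Proof. by exists setT; split=> //; [exact: openT|exact: Sm_fst]. Qed.

Lemma Smat_snd k (F H : tvsType R) (x : F * H) : Smat k snd x.
Proof. by exists setT; split=> //; [exact: openT|exact: Sm_snd]. Qed.

Lemma Smat_id k (F : tvsType R) (x : F) : Smat k id x.
Proof. by exists setT; split=> //; [exact: openT|exact: Sm_id]. Qed.

(** [vfield c g X] is the value in the chart c, at the point g, of the right
    invariant vector field given by X in the chart [Xi]. *)
Definition vfield (c : chart G E) (g : G) (X : E) : E :=
  dderiv (fun y => c (exp y * g)%g) 0 X.

(** The adjoint action read in the chart [Xi]. *)
Definition AdE (g : G) (X : E) : E :=
  dderiv (fun y => Xi (g * exp y * g^-1)%g) 0 X.

Lemma Smat_vfield k c g : smooth_chart A c -> chart_dom c g ->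
  Smat k (fun y => c (exp y * g)%g) 0.
Proof.
move=> sc cg; apply: (SmG_read hE sc); first by rewrite exp0 mul1g.
apply: SmG_mul => //; last exact: SmG_cst.
by apply: SmG_exp; exact: cod0.
Qed.

Lemma Smat_AdE k g : Smat k (fun y => Xi (g * exp y * g^-1)%g) 0.
Proof.
apply: (SmG_read hE Xi_chart); first by rewrite exp0 mulg1 mulgV.
apply: SmG_mul => //; last exact: SmG_cst.
apply: SmG_mul => //; first exact: SmG_cst.
by apply: SmG_exp; exact: cod0.
Qed.

Lemma AdEZ g a X : AdE g (a *: X) = a *: AdE g X.
Proof. by apply: (Smat_dderivZ hE); exact: Smat_AdE. Qed.

Lemma AdE0 g : AdE g 0 = 0.
Proof. by rewrite -[X in AdE g X](scale0r (0 : E)) AdEZ scale0r. Qed.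

Lemma vfield1 X : vfield Xi 1%g X = X.
Proof.
rewrite /vfield -[RHS](dderiv_id hE 0); apply: dderiv_congr.
have nc := open_near (@chart_cod_open _ _ _ Xi) cod0.
by apply: filterS nc => y cy; rewrite mulg1 chart_invK.
Qed.

(** In a chart d around g this is the continuity of the differential of the map
    (y,w) |-> m(y, d^-1(w)) of two vector variables. *)
Lemma dderiv0_continuous (m : E -> G -> E) g X :
  (forall d, atlas A d -> chart_dom d g ->
    Smat 1 (fun z : E * E => m z.1 (chart_inv d z.2)) (0, d g)) ->
  {for (g, X), continuous (fun z : G * E => dderiv (m^~ z.1) 0 z.2)}.
Proof.
have [Ad dg] := chart_atP g; set d := chart_at _ g in Ad dg.
move=> /(_ d Ad dg) Sth; set th := (fun z : E * E => _) in Sth.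
have := Smat_cont (Smat_dderiv hE (X, 0) Sth) => dth.
pose r (z : G * E) : (E * E) * (E * E) := ((0, d z.1), (z.2, 0)).
have rc : {for (g, X), continuous r}.
  apply: cont_pair; apply: cont_pair; [exact: cvg_cst| | |exact: cvg_cst].
    apply: (@continuous_comp _ _ _ fst d); first exact: cvg_fst.
    exact: chart_map_continuous.
  exact: cvg_snd.
have rd : {for (g, X), continuous (fun z => dderiv th (r z).1 (r z).2)}.
  exact: continuous_comp rc dth.
apply: cont_congr rd.
have nd : \forall z \near (g, X), chart_dom d z.1.
  have nd : nbhs g (chart_dom d).
    by apply: open_nbhs_nbhs; split=> //; exact: chart_dom_open.
  by exists (chart_dom d, setT) => [|[? ?] []//]; split=> //=; exact: filterT.
apply: filterS nd => -[g' X'] /= dg'.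
rewrite -dderiv_partial1; congr (dderiv _ _ _).
by apply/funext => y; rewrite /th /= chart_mapK.
Qed.

Let SmG_chart_inv_snd d g : atlas A d -> chart_dom d g ->
  SmG 1 (fun z : E * E => chart_inv d z.2) (0, d g).
Proof.
move=> Ad dg; apply: SmG_comp; first exact: Smat_snd.
by apply: (SmG_chart_inv hE); [exact: (atlas_smooth_chart Ad)|exact: chart_mapP].
Qed.

Lemma vfield_continuous c g X : smooth_chart A c -> chart_dom c g ->
  {for (g, X), continuous (fun z : G * E => vfield c z.1 z.2)}.
Proof.
move=> sc cg; apply: (dderiv0_continuous (m := fun y g => c (exp y * g)%g)) => d Ad dg.
apply: (SmG_read hE sc (f := fun z => (exp z.1 * chart_inv d z.2)%g)).
  by rewrite /= exp0 mul1g chart_mapK.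
apply: SmG_mul => //; last exact: SmG_chart_inv_snd.
by apply: SmG_exp_comp; [exact: Smat_fst|exact: cod0].
Qed.

Lemma AdE_continuous g X : {for (g, X), continuous (fun z : G * E => AdE z.1 z.2)}.
Proof.
apply: (dderiv0_continuous (m := fun y g => Xi (g * exp y * g^-1)%g)) => d Ad dg.
have Sd := SmG_chart_inv_snd Ad dg.
apply: (SmG_read hE Xi_chart
  (f := fun z => (chart_inv d z.2 * exp z.1 * (chart_inv d z.2)^-1)%g)).
  by rewrite /= exp0 mulg1 mulgV.
apply: SmG_mul => //; last exact: SmG_inv.
apply: SmG_mul => //.
by apply: SmG_exp_comp; [exact: Smat_fst|exact: cod0].
Qed.

(** The right logarithmic derivative at t read in [Xi], along a filter of
    increments; the one-sided derivatives are obtained from the filters of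
    positive and of negative increments. *)
Definition Rd (F : set_system R) (eta : R -> G) (t : R) (X : E) : Prop :=
  eta (t + h) @[h --> F] --> eta t /\
  h^-1 *: Xi (eta (t + h) * (eta t)^-1)%g @[h --> F] --> X.

Section RdTheory.
Context {F : set_system R} {FF : ProperFilter F} (F0 : F `=>` (0:R)^').

Let cvgF0 : h @[h --> F] --> (0 : R).
Proof. by move=> U U0; apply: F0; exact: nbhs_dnbhs. Qed.

Let F_neq0 : \forall h \near F, h != 0.
Proof. by apply: F0; exact: near_dnbhs0_neq. Qed.

Lemma Rd_unique eta t X Y : Rd F eta t X -> Rd F eta t Y -> X = Y.
Proof. by move=> [_ X1] [_ Y1]; apply: (cvg_unique hE X1 Y1). Qed.

Lemma Rd_quot eta t X : Rd F eta t X ->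
  (eta (t + h) * (eta t)^-1)%g @[h --> F] --> (1%g : G).
Proof.
move=> [ec _]; rewrite -(mulgV (eta t)); apply: cvg_mulG => //.
exact: cvg_cst.
Qed.

Lemma Rd_dom eta t X : Rd F eta t X ->
  \forall h \near F, chart_dom Xi (eta (t + h) * (eta t)^-1)%g.
Proof. by move=> /Rd_quot ec; exact: near_chart_dom ec _. Qed.

Lemma Rd_congr eta eta' t X : (\forall h \near F, eta (t + h) = eta' (t + h)) ->
  eta t = eta' t -> Rd F eta t X -> Rd F eta' t X.
Proof.
move=> ee et [ec eX]; rewrite /Rd -et; split.
  by apply: cvg_trans ec; apply: near_eq_cvg.
by apply: cvg_trans eX; apply: near_eq_cvg; apply: filterS ee => h ->.
Qed.

Lemma Rd_mulr eta t X (g : G) : Rd F eta t X -> Rd F (fun s => eta s * g)%g t X.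
Proof.
move=> [ec eX]; split; first by apply: cvg_mulG => //; exact: cvg_cst.
have -> : (fun h : R => h^-1 *: Xi (eta (t + h) * g * (eta t * g)^-1)%g) =
    (fun h => h^-1 *: Xi (eta (t + h) * (eta t)^-1)%g).
  by apply/funext => h; rewrite invgM mulgA mulgK.
by [].
Qed.

(** Maps of the logarithmic increments of two curves are differentiated at the
    origin in the direction of the logarithmic derivatives. *)
Lemma Rd_map2 (H : tvsType R) (hH : hausdorff_space H) (f : E * E -> H)
    eta th t X Y :
  Smat 1 f (0, 0) -> Rd F eta t X -> Rd F th t Y ->
  h^-1 *: (f (Xi (eta (t + h) * (eta t)^-1)%g, Xi (th (t + h) * (th t)^-1)%g)
    - f (0, 0)) @[h --> F] --> dderiv f (0, 0) (X, Y).
Proof.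
move=> Sf [_ eX] [_ eY].
pose w h := (h^-1 *: Xi (eta (t + h) * (eta t)^-1)%g,
             h^-1 *: Xi (th (t + h) * (th t)^-1)%g).
have wXY : w @ F --> (X, Y) by exact: cvg_pair eX eY.
have Hf : h^-1 *: (f ((0, 0) + h *: w h) - f (0, 0)) @[h --> F] -->
    dderiv f (0, 0) (X, Y).
  by apply: (Smat_hadamard hH) => //; exact: cvg_cst.
apply: cvg_trans Hf; apply: near_eq_cvg; apply: filterS F_neq0 => h h0.
by congr (_ *: (f _ - _)); congr pair; rewrite /= add0r scalerA divff// scale1r.
Qed.

Lemma Rd_map (H : tvsType R) (hH : hausdorff_space H) (f : E -> H) eta t X :
  Smat 1 f 0 -> Rd F eta t X ->
  h^-1 *: (f (Xi (eta (t + h) * (eta t)^-1)%g) - f 0) @[h --> F] -->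
    dderiv f 0 X.
Proof.
move=> Sf [_ eX].
pose w h := h^-1 *: Xi (eta (t + h) * (eta t)^-1)%g.
have Hf : h^-1 *: (f (0 + h *: w h) - f 0) @[h --> F] --> dderiv f 0 X.
  by apply: (Smat_hadamard hH) => //; exact: cvg_cst.
apply: cvg_trans Hf; apply: near_eq_cvg; apply: filterS F_neq0 => h h0.
by rewrite /= add0r scalerA divff// scale1r.
Qed.

Lemma Rd_chart c eta t X : smooth_chart A c -> chart_dom c (eta t) ->
  Rd F eta t X ->
  h^-1 *: (c (eta (t + h)) - c (eta t)) @[h --> F] --> vfield c (eta t) X.
Proof.
move=> sc cg eX; have := Rd_map hE (Smat_vfield 1 sc cg) eX.
move=> Hf; apply: cvg_trans Hf; apply: near_eq_cvg.
apply: filterS (Rd_dom eX) => h dh.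
by rewrite chart_mapK// mulgVK exp0 mul1g.
Qed.

(** The derivative at (0,0) of (x,y) |-> g^-1 exp(x)^-1 exp(y) g depends only on
   the difference of the directions, as the map is constant on the diagonal;
    along (0,y) it is the adjoint action of g^-1. *)
Lemma Rd_quotient eta th t X Y : Rd F eta t X -> Rd F th t Y ->
  Rd F (fun s => (eta s)^-1 * th s)%g t (AdE (eta t)^-1%g (Y - X)).
Proof.
move=> eX tY; have [ec _] := eX; have [tc _] := tY; split.
  by apply: cvg_mulG => //; exact: cvg_invG.
set g := eta t.
pose K (z : E * E) := Xi (g^-1 * (exp z.1)^-1 * exp z.2 * g)%g.
have SK : Smat 1 K (0, 0).
  apply: (SmG_read hE Xi_chart).
    by rewrite /= exp0 invg1 !mulg1 mulVg.
  apply: SmG_mul => //; last exact: SmG_cst.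
  apply: SmG_mul => //; last first.
    by apply: SmG_exp_comp; [exact: Smat_snd|exact: cod0].
  apply: SmG_mul => //; first exact: SmG_cst.
  apply: SmG_inv => //.
  by apply: SmG_exp_comp; [exact: Smat_fst|exact: cod0].
have K0 : K (0, 0) = 0 by rewrite /K /= exp0 invg1 !mulg1 mulVg.
have -> : AdE g^-1%g (Y - X) = dderiv K (0, 0) (X, Y).
  have -> : (X, Y) = (0, Y - X) + (X, X) :> E * E.
    by congr pair; rewrite /= ?add0r ?subrK.
  rewrite (Smat_dderivD hE _ _ SK) -dderiv_partial2.
  have -> : dderiv K (0, 0) (X, X) = 0.
    apply: (dderivE hE); apply: cvg_near_cst; apply: nearW => h /=.
    rewrite K0 subr0 /K /= -!mulgA mulKg mulVg.
    by rewrite Xi1 scaler0.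
  rewrite addr0 /AdE /K /=; congr (dderiv _ _ _); apply/funext => y.
  by rewrite exp0 invg1 mulg1 invgK.
have Hf := Rd_map2 hE SK eX tY.
apply: cvg_trans Hf; apply: near_eq_cvg.
apply: filterS2 (Rd_dom eX) (Rd_dom tY) => h dh dh'.
rewrite K0 subr0 /K /= !chart_mapK//; congr (_ *: Xi _).
rewrite !invgM !invgK !mulgA mulVg mul1g.
by rewrite -!mulgA.
Qed.

End RdTheory.

End Logarithm.

(** * The Lie algebra read in the chart *)

Section LieAlgebra.
Context {R : realType} {E : tvsType R} (hE : hausdorff_space E) (G : lieGroup E).
Context (Xi : chart G E) (Xi_chart : smooth_chart (lie_manifold G) Xi)
  (Xi_dom1 : chart_dom Xi 1%g) (Xi1 : Xi 1%g = 0).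

Let A := lie_manifold G.
Local Notation exp := (chart_inv Xi).

Let c1 : chart G E := chart_at A 1%g.

Let c1P : atlas A c1 /\ chart_dom c1 1%g. Proof. exact: chart_atP. Qed.

Let cod0' : chart_cod Xi 0. Proof. exact: cod0. Qed.

Let Smat_Xi_c1 k : Smat k (Xi \o chart_inv c1) (c1 1%g).
Proof.
have [Ac1 d1] := c1P.
apply: (SmG_read hE Xi_chart); first by rewrite chart_mapK.
by apply: (SmG_chart_inv hE _ (atlas_smooth_chart Ac1)); exact: chart_mapP.
Qed.

Let Smat_c1_exp k : Smat k (c1 \o exp) 0.
Proof.
have [Ac1 d1] := c1P.
apply: (SmG_read hE (atlas_smooth_chart Ac1)); first by rewrite exp0.
exact: (SmG_chart_inv hE _ Xi_chart).
Qed.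

(** The inverse of the isomorphism [dXi Xi]: the differential at 0 of the inverse
    chart, read in the chart that encodes the tangent space at 1. *)
Definition dXi_inv (X : E) : lie_alg G := dderiv (c1 \o exp) 0 X.

Lemma dXi_invK X : dXi Xi (dXi_inv X) = X.
Proof.
have [Ac1 d1] := c1P.
have e1 : (c1 \o exp) 0 = c1 1%g by rewrite /= exp0.
rewrite /dXi /vdiff -/A -/c1 /dXi_inv -e1.
rewrite -(dderiv_comp hE hE _ (Smat_c1_exp 1)); last by rewrite e1; exact: Smat_Xi_c1.
rewrite -[RHS](dderiv_id hE 0); apply: dderiv_congr.
have nexp : \forall y \near (0 : E), chart_dom c1 (exp y).
  by apply: near_chart_dom; [apply: chart_inv_continuous|rewrite exp0].
have nc := open_near (@chart_cod_open _ _ _ Xi) cod0'.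
by apply: filterS2 nexp nc => y dy cy; rewrite /= chart_mapK// chart_invK.
Qed.

Lemma dXiK (Y : lie_alg G) : dXi_inv (dXi Xi Y) = Y.
Proof.
have [Ac1 d1] := c1P.
have e1 : (Xi \o chart_inv c1) (c1 1%g) = 0 by rewrite /= chart_mapK.
rewrite /dXi /vdiff -/A -/c1 /dXi_inv -e1.
rewrite -(dderiv_comp hE hE _ (Smat_Xi_c1 1)); last by rewrite e1; exact: Smat_c1_exp.
rewrite -[RHS](dderiv_id hE (c1 1%g)); apply: dderiv_congr.
have cc1 : chart_cod c1 (c1 1%g) by exact: chart_mapP.
have nexp : \forall y \near c1 1%g, chart_dom Xi (chart_inv c1 y).
  by apply: near_chart_dom; [apply: chart_inv_continuous|rewrite chart_mapK].
have nc := open_near (@chart_cod_open _ _ _ c1) cc1.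
by apply: filterS2 nexp nc => y dy cy; rewrite /= chart_mapK// chart_invK.
Qed.

Lemma dXiD (X Y : lie_alg G) : dXi Xi (X + Y) = dXi Xi X + dXi Xi Y.
Proof. by apply: (Smat_dderivD hE); exact: Smat_Xi_c1. Qed.

Lemma dXiZ a (X : lie_alg G) : dXi Xi (a *: X) = a *: dXi Xi X.
Proof. by apply: (Smat_dderivZ hE); exact: Smat_Xi_c1. Qed.

Lemma dXiB (X Y : lie_alg G) : dXi Xi (X - Y) = dXi Xi X - dXi Xi Y.
Proof. by rewrite -scaleN1r dXiD dXiZ scaleN1r. Qed.

Lemma dXi_continuous : continuous (dXi Xi : E -> E).
Proof.
move=> X; have dc := Smat_cont (Smat_dderiv hE X (Smat_Xi_c1 1)).
apply: (@continuous_comp _ _ _ (fun X : E => (c1 1%g, X))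
  (fun z => dderiv (Xi \o chart_inv c1) z.1 z.2)); last exact: dc.
by apply: cont_pair; [exact: cvg_cst|exact: cvg_id].
Qed.

Lemma dXi_inv_continuous : continuous (dXi_inv : E -> E).
Proof.
move=> X; have dc := Smat_cont (Smat_dderiv hE X (Smat_c1_exp 1)).
apply: (@continuous_comp _ _ _ (fun X : E => (0, X))
  (fun z => dderiv (c1 \o exp) z.1 z.2)); last exact: dc.
by apply: cont_pair; [exact: cvg_cst|exact: cvg_id].
Qed.

Lemma dXi_Ad (g : G) (X : lie_alg G) : dXi Xi (Ad g X) = AdE Xi g (dXi Xi X).
Proof.
have [Ac1 d1] := c1P.
rewrite /Ad /mdiff -/A (_ : (g * 1 * g^-1)%g = 1%g) ?mulg1 ?mulgV// -/c1.
set f := c1 \o _ \o chart_inv c1.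
have Sg : SmG 1 (fun y => g * chart_inv c1 y * g^-1)%g (c1 1%g).
  apply: (SmG_mul hE); last exact: SmG_cst.
  apply: (SmG_mul hE); first exact: SmG_cst.
  by apply: (SmG_chart_inv hE _ (atlas_smooth_chart Ac1)); exact: chart_mapP.
have Sf : Smat 1 f (c1 1%g).
  apply: (SmG_read hE (atlas_smooth_chart Ac1)) Sg.
  by rewrite chart_mapK// mulg1 mulgV.
have f1 : f (c1 1%g) = c1 1%g by rewrite /f /= chart_mapK// mulg1 mulgV.
rewrite /dXi /vdiff -/A -/c1.
have -> : dderiv (Xi \o chart_inv c1) (c1 1%g) (dderiv f (c1 1%g) X) =
    dderiv ((Xi \o chart_inv c1) \o f) (c1 1%g) X.
  by rewrite (dderiv_comp hE hE _ Sf) f1//; exact: Smat_Xi_c1.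
have e1 : (Xi \o chart_inv c1) (c1 1%g) = 0 by rewrite /= chart_mapK.
have LE : forall L : E -> E, Smat 1 L 0 ->
    dderiv L 0 (dderiv (Xi \o chart_inv c1) (c1 1%g) X) =
    dderiv (L \o (Xi \o chart_inv c1)) (c1 1%g) X.
  by move=> L SL; rewrite (dderiv_comp hE hE _ (Smat_Xi_c1 1)) e1.
rewrite /AdE LE; last exact: Smat_AdE.
apply: dderiv_congr.
have cc1 : chart_cod c1 (c1 1%g) by exact: chart_mapP.
have nXi : \forall y \near c1 1%g, chart_dom Xi (chart_inv c1 y).
  by apply: near_chart_dom; [apply: chart_inv_continuous|rewrite chart_mapK].
have nc1 : \forall y \near c1 1%g, chart_dom c1 (g * chart_inv c1 y * g^-1)%g.
  have [gc _] := Sg.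
  by apply: near_chart_dom gc _; rewrite chart_mapK// mulg1 mulgV.
by apply: filterS2 nXi nc1 => y dy cy; rewrite /f /= !chart_mapK.
Qed.

Lemma AdE1 X : AdE Xi 1%g X = X.
Proof.
rewrite /AdE -[RHS](dderiv_id hE 0); apply: dderiv_congr.
have nc := open_near (@chart_cod_open _ _ _ Xi) cod0'.
by apply: filterS nc => y cy; rewrite invg1 mulg1 mul1g chart_invK.
Qed.

Lemma C1_curve_chart r r' mu t c : C1_curve r r' mu -> t \in `[r, r'] ->
  atlas A c -> chart_dom c (mu t) ->
  {for t, continuous mu} /\ Smat 1 (c \o mu : R^o -> E) t.
Proof.
move=> [J [oJ _ rJ] [mc mCk]] tr Ac ct; have Jt : J t by exact: rJ.
split; first exact: mc.
have := mCk (id_chart R^o) c erefl Ac; set D := (X in Ck _ X _) => Cm.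
have oD : open D.
  have -> : D = J `&` mu @^-1` chart_dom c.
    by apply/seteqP; split=> s; [move=> [_ []]|move=> []].
  by apply: open_setI_preimage => //; exact: chart_dom_open.
by exists D; split=> //; exact: Ck_Sm.
Qed.

Lemma has_dderiv_R (f : R -> E) (t : R) d :
  @has_dderiv R R^o E f t 1 d <->
  h^-1 *: (f (t + h) - f t) @[h --> (0:R)^'] --> d.
Proof.
rewrite /has_dderiv.
by under eq_fun do rewrite [_ *: (1 : R^o)]mulr1.
Qed.

(** The translation to the unit and the passage from the chart around mu(t) to
    [Xi] are instances of the chain rule. *)
Lemma Rd_C1_curve r r' mu t : C1_curve r r' mu -> t \in `[r, r'] ->
  Rd Xi (0:R)^' mu t (dXi Xi (deltar mu t)).
Proof.
move=> Cmu tr; set g := mu t.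
have [Ac cg] := chart_atP g; set c := chart_at _ g in Ac cg.
have [mc Sm] := C1_curve_chart Cmu tr Ac cg.
have nat0 : t + h @[h --> (0:R)^'] --> t by exact: cvg_shift.
have mct : mu (t + h) @[h --> (0:R)^'] --> mu t by exact: cvg_comp nat0 mc.
split=> //.
have [Ac1 d1] := c1P.
pose f1 := c1 \o (fun h : G => h * g^-1)%g \o chart_inv c.
have Sg : SmG 1 (fun y => chart_inv c y * g^-1)%g (c g).
  apply: (SmG_mul hE); last exact: SmG_cst.
  by apply: (SmG_chart_inv hE _ (atlas_smooth_chart Ac)); exact: chart_mapP.
have Sf1 : Smat 1 f1 (c g).
  apply: (SmG_read hE (atlas_smooth_chart Ac1)) Sg.
  by rewrite chart_mapK// mulgV.
have f1g : f1 (c g) = c1 1%g by rewrite /f1 /= chart_mapK// mulgV.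
have vE : @has_dderiv R R^o E (c \o mu) t 1 (velocity A mu t).
  exact: Smat_has_dderiv.
have dE : deltar mu t = dderiv f1 (c g) (velocity A mu t).
  by rewrite /deltar /mdiff -/A -/g mulgV.
have H1 := Smat_has_dderiv_comp hE vE Sf1.
rewrite -dE in H1.
have S2 : Smat 1 (Xi \o chart_inv c1) ((f1 \o (c \o mu)) t).
  by rewrite /= -/g f1g; exact: Smat_Xi_c1.
have := Smat_has_dderiv_comp hE H1 S2.
rewrite [X in dderiv _ X]/= -/g f1g => /has_dderiv_R H2.
apply: cvg_trans H2; apply: near_eq_cvg.
have n1 := near_chart_dom mct cg.
have mct' : (mu (t + h) * g^-1)%g @[h --> (0:R)^'] --> (1%g : G).
  by rewrite -(mulgV g); apply: cvg_mulG => //; exact: cvg_cst.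
have n2 := near_chart_dom mct' d1.
apply: filterS2 n1 n2 => h h1 h2; rewrite /f1 /= !chart_mapK ?mulgV//.
by rewrite Xi1 subr0.
Qed.

(** Read in a chart, the curve has the derivative [vfield] evaluated at the curve
    and at its logarithmic derivative, which is continuous. *)
Lemma C1_curve_Rd (J : set R) r r' mu (b : R -> E) : interval_nbhs r r' J ->
  (forall t, J t -> Rd Xi (0:R)^' mu t (b t)) ->
  (forall t, J t -> {for t, continuous b}) -> C1_curve r r' mu.
Proof.
move=> Jr mub bc; exists J => //; have [oJ _ _] := Jr.
have mc t : J t -> {for t, continuous mu}.
  move=> /mub[mc _]; suff : mu s @[s --> t] --> mu t by [].
  have : mu (t + h) @[h --> (0:R)] --> mu t.
    move=> U Ut; have := mc U Ut; rewrite /nbhs /= /dnbhs /within /=.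
    apply: filterS => h Hh; case: (pselect (h = 0)) => [->|/eqP h0].
      by rewrite /= addr0; exact: nbhs_singleton.
    exact: Hh.
  move=> m0; have st : s - t @[s --> t] --> (0 : R).
    by rewrite -(subrr t); apply: cvgB; [exact: cvg_id|exact: cvg_cst].
  apply: cvg_trans (cvg_comp _ _ st m0); apply: near_eq_cvg.
  by apply: nearW => s; rewrite /= subrKC.
split=> // _ c -> Ac; set D := (X in Ck _ X _).
have DE : D = J `&` mu @^-1` chart_dom c.
  by apply/seteqP; split=> s; [move=> [_ []]|move=> []].
have oD : open (D : set R^o).
  by rewrite DE; apply: open_setI_preimage => //; exact: chart_dom_open.
apply: Sm_Ck => //; split.
  move=> t; rewrite DE => -[Jt ct].
  apply: (@continuous_comp _ _ _ mu c); first exact: mc.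
  exact: chart_map_continuous.
exists (fun z => (z.2 : R) *: vfield Xi c (mu z.1) (b z.1)); split.
  move=> t v; rewrite DE => -[Jt ct].
  have H : h^-1 *: ((c \o mu) (t + h) - (c \o mu) t) @[h --> (0:R)^'] -->
      vfield Xi c (mu t) (b t).
    exact: (Rd_chart hE Xi_chart Xi_dom1 Xi1 _ (atlas_smooth_chart Ac) ct (mub t Jt)).
  have := has_dderivZ (a := v) ((has_dderiv_R _ _ _).2 H).
  by rewrite [_ *: (1 : R^o)]mulr1.
apply: Sm0 => -[t v]; rewrite DE => -[[Jt ct] _].
apply: tcvgZ; first exact: cvg_snd.
have vc := vfield_continuous hE Xi_chart Xi_dom1 Xi1 (X := b t) (atlas_smooth_chart Ac) ct.
apply: (@continuous_comp _ _ _ (fun z : R^o * R^o => (mu z.1, b z.1))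
  (fun z : G * E => vfield Xi c z.1 z.2)); last exact: vc.
apply: cont_pair.
  by apply: (@continuous_comp _ _ _ fst mu); [exact: cvg_fst|exact: mc].
by apply: (@continuous_comp _ _ _ fst b); [exact: cvg_fst|exact: bc].
Qed.

End LieAlgebra.

(** * Product integrals *)

Section Estimate.
Context {R : realType} {E : tvsType R} (hE : hausdorff_space E) (G : lieGroup E).
Context (Xi : chart G E) (Xi_chart : smooth_chart (lie_manifold G) Xi)
  (Xi_dom1 : chart_dom Xi 1%g) (Xi1 : Xi 1%g = 0).

Local Notation exp := (chart_inv Xi).

(** The relation between two seminorms in the definition of local mu-convexity. *)
Definition mu_bound (u o : cseminorm E) : Prop :=
  forall (n : nat) (X : 'I_n.+1 -> E), \sum_i o (X i) <= 1 ->
    (forall i, chart_cod Xi (X i)) /\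
    Xi_le Xi u (\prod_i exp (X i))%g (\sum_i o (X i)).

Lemma mu_bound_seq u o (s : seq E) (c : R) : mu_bound u o ->
  \sum_(X <- s) o X <= c -> c <= 1 -> Xi_le Xi u (\prod_(X <- s) exp X)%g c.
Proof.
move=> uo sc c1; pose X (i : 'I_(size s).+1) := nth 0 (0 :: s) i.
have eS : \sum_i o (X i) = \sum_(X <- s) o X.
  by rewrite big_ord_recl /= /X /= sn0 add0r (big_nth 0) big_mkord.
have eP : (\prod_i exp (X i) = \prod_(X <- s) exp X)%g.
  rewrite big_ord_recl /= /X /= (exp0 Xi_dom1 Xi1) mul1g.
  by rewrite (big_nth 0) big_mkord.
have [_ [Xd Xu]] := uo _ X ltac:(by rewrite eS (le_trans sc)).
by rewrite -eP; split=> //; apply: le_trans sc; rewrite -eS.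
Qed.

Lemma mu_bound2 u o (g h : G) (a b : R) : mu_bound u o ->
  Xi_le Xi o g a -> Xi_le Xi o h b -> a + b <= 1 -> Xi_le Xi u (g * h)%g (a + b).
Proof.
move=> uo [gd ga] [hd hb] ab.
have := @mu_bound_seq u o [:: Xi g; Xi h] (a + b) uo.
rewrite !big_cons !big_nil addr0 mulg1 !chart_mapK//; apply=> //.
exact: lerD.
Qed.

Lemma Rd_cst (F : set_system R) {FF : ProperFilter F} (g : G) t :
  Rd Xi F (fun=> g) t 0.
Proof.
split; first exact: cvg_cst.
by apply: cvg_near_cst; apply: nearW => h; rewrite mulgV Xi1 scaler0.
Qed.

(** The product integral is bounded by the integral of its integrand, in the
    form of a mean value inequality: near every point the increments of the
    curve are exponentials of controlled length, and such increments multiply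
    along the interval. *)
Lemma mu_mean_value u o (eta : R -> G) a b M : mu_bound u o ->
  a <= b -> 0 <= M -> M * (b - a) < 1 ->
  (forall t, a <= t -> t < b -> exists2 X, Rd Xi 0^'+ eta t X & o X <= M) ->
  (forall t, a < t -> t <= b -> exists2 X, Rd Xi 0^'- eta t X & o X <= M) ->
  Xi_le Xi u (eta b * (eta a)^-1)%g (M * (b - a)).
Proof.
move=> uo ab M0 Mab er el.
pose P e s t := exists l : seq E, \sum_(X <- l) o X <= (M + e) * (t - s) /\
  (\prod_(X <- l) exp X = eta t * (eta s)^-1)%g.
have HP e : 0 < e -> P e a b.
  move=> e0; apply: creeping => //.
  - by exists [::]; rewrite !big_nil subrr mulr0 mulgV.
  - move=> s t v st tv _ _ [l [lo lp]] [l' [lo' lp']]; exists (l' ++ l).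
    rewrite !big_cat /= lp lp' mulgA mulgVK; split=> //.
    by move: lo lo'; lra.
  - move=> t at_ tb; have [X eR oX] := er t at_ tb; have [ec eX] := eR.
    have ne : \forall h \near (0:R)^'+,
        o (Xi (eta (t + h) * (eta t)^-1)%g) <= (M + e) * `|h|.
      exact: quot_le (@at_right_dnbhs _ 0) eX oX e0.
    have nd : \forall h \near (0:R)^'+, chart_dom Xi (eta (t + h) * (eta t)^-1)%g.
      by apply: Rd_dom eR.
    apply: filterS2 (nbhs_right_gt 0) (filterI ne nd) => h h0 [oh hd].
    exists [:: Xi (eta (t + h) * (eta t)^-1)%g]; rewrite !big_cons !big_nil.
    rewrite addr0 mulg1 chart_mapK//; split=> //.
    have -> : t + h - t = h by rewrite addrC addKr.
    by rewrite gtr0_norm in oh.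
  (* The increment eta(t) eta(t+h)^-1 belongs to the curve z, the inverse of
     s |-> eta(s) eta(t)^-1, whose logarithmic derivative at t is - X. *)
  - move=> t at_ tb; have [X eR oX] := el t at_ tb.
    have e1 : Rd Xi 0^'- (fun s => eta s * (eta t)^-1)%g t X by apply: Rd_mulr.
    have e3 : Rd Xi 0^'- (fun=> 1%g : G) t 0 by apply: Rd_cst.
    pose z s := ((eta s * (eta t)^-1)^-1 * 1)%g.
    have e2 : Rd Xi 0^'- z t (- X).
      have := Rd_quotient hE Xi_chart Xi_dom1 Xi1 (@at_left_dnbhs _ 0) e1 e3.
      by rewrite mulgV invg1 AdE1// sub0r; exact.
    have [_ eX'] := e2; have oX' : o (- X) <= M by rewrite snN.
    have ne : \forall h \near (0:R)^'-, o (Xi (z (t + h) * (z t)^-1)%g) <= (M + e) * `|h|.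
      exact: quot_le (@at_left_dnbhs _ 0) eX' oX' e0.
    have nd : \forall h \near (0:R)^'-, chart_dom Xi (z (t + h) * (z t)^-1)%g.
      by apply: Rd_dom e2.
    have zE h : (z (t + h) * (z t)^-1 = eta t * (eta (t + h))^-1)%g.
      by rewrite /z mulgV invg1 !mulg1 invg1 mulg1 invgM invgK.
    apply: filterS2 (nbhs_left_lt 0) (filterI ne nd) => h h0 [].
    rewrite zE => oh hd.
    exists [:: Xi (eta t * (eta (t + h))^-1)%g]; rewrite !big_cons !big_nil.
    rewrite addr0 mulg1 chart_mapK//; split=> //.
    have -> : t - (t + h) = - h by rewrite opprD addNKr.
    by rewrite ltr0_norm in oh.
have ba0 : 0 <= b - a by rewrite subr_ge0.
(* For e <= c the lengths add up to at most 1, as mu-convexity requires. *)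
pose c := (1 - M * (b - a)) / (b - a + 1).
have c0 : 0 < c by rewrite divr_gt0 ?subr_gt0// ltr_wpDl.
have le1 e : e <= c -> (M + e) * (b - a) <= 1.
  move=> ec; have : e * (b - a) <= c * (b - a) by rewrite ler_wpM2r.
  have : c * (b - a) <= 1 - M * (b - a).
    rewrite /c mulrAC ler_pdivrMr ?ltr_wpDl//.
    by rewrite ler_wpM2l ?subr_ge0 ?lerDl// ltW.
  by rewrite mulrDl; lra.
have main e : 0 < e -> e <= c ->
    Xi_le Xi u (eta b * (eta a)^-1)%g ((M + e) * (b - a)).
  move=> e0 ec; have [l [lo <-]] := HP e e0.
  exact: mu_bound_seq uo lo (le1 _ ec).
have [d _] := main c c0 (lexx _); split=> //.
apply/ler_addgt0Pr => e e0.
pose e' := Num.min c (e / (b - a + 1)).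
have b1 : 0 < b - a + 1 by rewrite ltr_wpDl.
have e'0 : 0 < e' by rewrite lt_min c0 divr_gt0.
have [_ ue] := main e' e'0 ltac:(by rewrite ge_min lexx).
apply: le_trans ue _; rewrite mulrDl lerD2l.
have : e' * (b - a) <= e / (b - a + 1) * (b - a).
  by rewrite ler_wpM2r// ge_min lexx orbT.
move=> h; apply: le_trans h _; rewrite mulrAC ler_pdivrMr//.
by rewrite ler_wpM2l ?lerDl// ltW.
Qed.

End Estimate.

Section Good.
Context {R : realType} {E : tvsType R} (hE : hausdorff_space E) (G : lieGroup E).
Context (Xi : chart G E) (Xi_chart : smooth_chart (lie_manifold G) Xi)
  (Xi_dom1 : chart_dom Xi 1%g) (Xi1 : Xi 1%g = 0)
  (G_mu_convex : locally_mu_convex Xi).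
Implicit Types (eta P Q : R -> G) (b : R -> E).

(** The one-sided logarithmic derivatives of eta are the one-sided limits of b:
    the defining property of product integrals of piecewise continuous maps. *)
Definition good eta b (x y : R) : Prop :=
  (forall t, x <= t -> t < y -> exists2 X,
     b (t + h) @[h --> (0:R)^'+] --> X & Rd Xi 0^'+ eta t X) /\
  (forall t, x < t -> t <= y -> exists2 X,
     b (t + h) @[h --> (0:R)^'-] --> X & Rd Xi 0^'- eta t X).

Lemma good_sub eta b x y x' y' : x <= x' -> y' <= y ->
  good eta b x y -> good eta b x' y'.
Proof.
move=> xx yy [gr gl]; split=> t xt ty.
  by apply: gr; [exact: le_trans xt|exact: lt_le_trans ty _].
by apply: gl; [exact: le_lt_trans xt|exact: le_trans ty _].
Qed.

Lemma near_right_itv (t y : R) : t < y -> \forall h \near (0:R)^'+, t < t + h < y.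
Proof.
move=> ty; apply/near_rightE; exists (y - t); first by rewrite subr_gt0.
by move=> h h0 hy; rewrite ltrDl h0 -ltrBrDl.
Qed.

Lemma near_left_itv (x t : R) : x < t -> \forall h \near (0:R)^'-, x < t + h < t.
Proof.
move=> xt; apply/near_leftE; exists (t - x); first by rewrite subr_gt0.
by move=> h h0 hy; rewrite gtrDl h0 andbT -ltrBlDl -opprB.
Qed.

Lemma good_congr eta eta' b b' x y :
  (forall t, x <= t <= y -> eta t = eta' t) ->
  (forall t, x < t < y -> b t = b' t) -> good eta b x y -> good eta' b' x y.
Proof.
move=> ee bb [gr gl]; split=> t xt ty.
  have [X bX eX] := gr t xt ty; exists X.
    apply: cvg_trans bX; apply: near_eq_cvg.
    apply: filterS (near_right_itv ty) => h /andP[h1 h2].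
    by apply: bb; rewrite h2 (le_lt_trans xt).
  apply: Rd_congr eX; last by apply: ee; rewrite xt ltW.
  apply: filterS (near_right_itv ty) => h /andP[h1 h2].
  by apply: ee; rewrite (le_trans xt) ?ltW.
have [X bX eX] := gl t xt ty; exists X.
  apply: cvg_trans bX; apply: near_eq_cvg.
  apply: filterS (near_left_itv xt) => h /andP[h1 h2].
  by apply: bb; rewrite h1 (lt_le_trans h2).
apply: Rd_congr eX; last by apply: ee; rewrite ty ltW.
apply: filterS (near_left_itv xt) => h /andP[h1 h2].
by apply: ee; rewrite (ltW h1) (le_trans (ltW h2)).
Qed.

Lemma good_mulr eta b x y (g : G) :
  good eta b x y -> good (fun t => eta t * g)%g b x y.
Proof.
move=> [gr gl]; split=> t xt ty.
  by have [X bX eX] := gr t xt ty; exists X => //; apply: Rd_mulr.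
by have [X bX eX] := gl t xt ty; exists X => //; apply: Rd_mulr.
Qed.

Lemma good_glue eta b x y z : good eta b x y -> good eta b y z -> good eta b x z.
Proof.
move=> [gr gl] [gr' gl']; split=> t xt ty.
  by case: (ltP t y) => h; [exact: gr|exact: gr'].
by case: (ltP y t) => h; [exact: gl'|exact: gl].
Qed.

Lemma Xi_eq0 g : (forall u, Xi_le Xi u g 0) -> g = 1%g.
Proof.
move=> ug; have [gd _] := ug snzero.
have : Xi g = 0.
  by apply: (sn_eq0 hE) => p; apply/eqP; rewrite eq_le sn_ge0 andbT; have [] := ug p.
by move=> g0; rewrite -(chart_mapK gd) g0 exp0.
Qed.

(** Product integrals are determined by their integrand up to right
    translation: the quotient has zero logarithmic derivative. *)
Lemma good_unique P Q b x y : x <= y -> good P b x y -> good Q b x y ->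
  ((P y)^-1 * Q y = (P x)^-1 * Q x)%g.
Proof.
move=> xy [Pr Pl] [Qr Ql].
pose eta t := ((P t)^-1 * Q t)%g.
suff e1 : (eta y * (eta x)^-1 = 1)%g by rewrite -[LHS](mulgVK (eta x)) e1 mul1g.
apply: Xi_eq0 => u; have [q _ uq] := G_mu_convex u.
have := @mu_mean_value _ _ hE G Xi Xi_chart Xi_dom1 Xi1 u q eta x y 0 uq xy (lexx _).
rewrite mul0r; apply=> //.
- move=> t xt ty; have [X bX PX] := Pr t xt ty; have [Y bY QY] := Qr t xt ty.
  exists (AdE Xi (P t)^-1%g (Y - X)).
    exact: (Rd_quotient hE Xi_chart Xi_dom1 Xi1 (@at_right_dnbhs _ 0)).
  by rewrite (cvg_unique hE bY bX) subrr AdE0// sn0.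
- move=> t xt ty; have [X bX PX] := Pl t xt ty; have [Y bY QY] := Ql t xt ty.
  exists (AdE Xi (P t)^-1%g (Y - X)).
    exact: (Rd_quotient hE Xi_chart Xi_dom1 Xi1 (@at_left_dnbhs _ 0)).
  by rewrite (cvg_unique hE bY bX) subrr AdE0// sn0.
Qed.

Lemma Rd_at_right eta t X : Rd Xi (0:R)^' eta t X -> Rd Xi 0^'+ eta t X.
Proof.
by move=> [ec eX]; split; [apply: cvg_trans ec|apply: cvg_trans eX];
  apply: cvg_app; exact: at_right_dnbhs.
Qed.

Lemma Rd_at_left eta t X : Rd Xi (0:R)^' eta t X -> Rd Xi 0^'- eta t X.
Proof.
by move=> [ec eX]; split; [apply: cvg_trans ec|apply: cvg_trans eX];
  apply: cvg_app; exact: at_left_dnbhs.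
Qed.

Lemma C_curve0_cvg x y (phi : R -> lie_alg G) t : C_curve Xi (Cfin 0) x y phi ->
  (x <= t -> t < y -> dXi Xi (phi (t + h)) @[h --> (0:R)^'+] --> dXi Xi (phi t)) /\
  (x < t -> t <= y -> dXi Xi (phi (t + h)) @[h --> (0:R)^'-] --> dXi Xi (phi t)).
Proof.
move=> [J [psi [[oJ _ xyJ] Cpsi ppsi]]].
have cpsi s : s \in `[x, y] -> psi (s + h) @[h --> (0:R)^'] --> (psi s : E).
  move=> sxy; have : {for s, continuous (psi : R^o -> E)}.
    by apply: (Ckp_cont (Ck_Ckp Cpsi)); exact: xyJ.
  have sh : s + h @[h --> (0:R)^'] --> s by exact: cvg_shift.
  by move=> cs; apply: (cvg_comp _ _ sh cs).
have dpsi s : s \in `[x, y] ->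
    dXi Xi (psi (s + h)) @[h --> (0:R)^'] --> dXi Xi (psi s).
  move=> sxy; apply: (cvg_comp (fun h => psi (s + h)) (dXi Xi) (cpsi s sxy)).
  exact: dXi_continuous.
split=> xt ty.
  have txy : t \in `[x, y] by rewrite in_itv /= xt ltW.
  rewrite (ppsi t txy).
  have H : dXi Xi (psi (t + h)) @[h --> (0:R)^'+] --> dXi Xi (psi t).
    by apply: cvg_trans (dpsi t txy); apply: cvg_app; exact: at_right_dnbhs.
  apply: cvg_trans H; apply: near_eq_cvg.
  apply: filterS (near_right_itv ty) => h /andP[h1 h2].
  by rewrite ppsi// in_itv /= (le_trans xt) ?ltW.
have txy : t \in `[x, y] by rewrite in_itv /= ty ltW.
rewrite (ppsi t txy).
have H : dXi Xi (psi (t + h)) @[h --> (0:R)^'-] --> dXi Xi (psi t).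
  by apply: cvg_trans (dpsi t txy); apply: cvg_app; exact: at_left_dnbhs.
apply: cvg_trans H; apply: near_eq_cvg.
apply: filterS (near_left_itv xt) => h /andP[h1 h2].
by rewrite ppsi// in_itv /= (ltW h1) (le_trans (ltW h2)).
Qed.

Lemma good_C1_curve x y mu (phi : R -> lie_alg G) : C1_curve x y mu ->
  (forall t, t \in `[x, y] -> phi t = deltar mu t) ->
  C_curve Xi (Cfin 0) x y phi -> good mu (dXi Xi \o phi) x y.
Proof.
move=> Cmu pmu Cphi; split=> t xt ty; have [cr cl] := C_curve0_cvg t Cphi.
  have txy : t \in `[x, y] by rewrite in_itv /= xt ltW.
  exists (dXi Xi (phi t)); first exact: cr.
  apply: Rd_at_right; rewrite pmu//.
  exact: (Rd_C1_curve hE Xi_chart Xi_dom1 Xi1 Cmu).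
have txy : t \in `[x, y] by rewrite in_itv /= ty ltW.
exists (dXi Xi (phi t)); first exact: cl.
apply: Rd_at_left; rewrite pmu//.
exact: (Rd_C1_curve hE Xi_chart Xi_dom1 Xi1 Cmu).
Qed.

(** By [good_unique], the choice of the curve mu does not matter. *)
Lemma prodintE x y mu (phi : R -> lie_alg G) t : C1_curve x y mu ->
  (forall t, t \in `[x, y] -> phi t = deltar mu t) ->
  C_curve Xi (Cfin 0) x y phi -> t \in `[x, y] ->
  prodint x y phi t = (mu t * (mu x)^-1)%g.
Proof.
move=> Cmu pmu Cphi; rewrite in_itv /= => /andP[xt ty]; rewrite /prodint.
case: xgetP => [g _ [nu [Cnu pnu ->]]|/(_ (mu t * (mu x)^-1)%g)[]]; last by exists mu.
have gnu := good_sub (lexx x) ty (good_C1_curve Cnu pnu Cphi).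
have gmu := good_sub (lexx x) ty (good_C1_curve Cmu pmu Cphi).
have := good_unique xt gmu gnu => e.
apply: (mulgI (mu t)^-1%g); rewrite mulKg mulgA e.
by rewrite -mulgA mulgV mulg1.
Qed.

Lemma prodint_good x y (phi : R -> lie_alg G) : x <= y -> Dk Xi (Cfin 0) x y phi ->
  good (prodint x y phi) (dXi Xi \o phi) x y /\ prodint x y phi x = 1%g.
Proof.
move=> xy [[mu Cmu pmu] Cphi]; split; last first.
  by rewrite (prodintE Cmu pmu Cphi) ?mulgV// in_itv /= lexx.
have := good_mulr (mu x)^-1%g (good_C1_curve Cmu pmu Cphi); apply: good_congr => //.
by move=> t txy; rewrite (prodintE Cmu pmu Cphi).
Qed.

(** The product integrals of the first p pieces form one curve, as consecutive
    pieces agree at the break point after the right translation. *)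
Lemma step_good phi n ts phis p : @pw_decomp R E G Xi phi n ts phis -> (p <= n)%N ->
  0 <= ts p /\ exists P : R -> G, [/\ good P (dXi Xi \o phi) 0 (ts p), P 0 = 1%g,
    P (ts p) = step_prodint ts phis p & forall q t, (q < p)%N ->
      t \in `]ts q, ts q.+1] ->
      P t = (prodint (ts q) (ts q.+1) (phis q) t * step_prodint ts phis q)%g].
Proof.
move=> [ts0 tsn dec]; elim: p => [_|p IH pn].
  split; first by rewrite ts0.
  exists (fun=> 1%g); split=> //; split=> t; rewrite ts0 => a b.
    by have := le_lt_trans a b; rewrite ltxx.
  by have := lt_le_trans a b; rewrite ltxx.
have [t0 [P [gP P0 Pp Pq]]] := IH (ltnW pn).
have [tpp Dp php] := dec p pn; split; first by rewrite (le_trans t0)// ltW.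
have [gp p1] := prodint_good (ltW tpp) Dp.
set S := step_prodint ts phis p in Pp *.
pose Q t := if t <= ts p then P t else
  (prodint (ts p) (ts p.+1) (phis p) t * S)%g.
have Qp t : ts p <= t -> Q t = (prodint (ts p) (ts p.+1) (phis p) t * S)%g.
  rewrite /Q le_eqVlt => /predU1P[<-|tt]; last by rewrite leNgt tt.
  by rewrite lexx p1 mul1g.
exists Q; split.
- apply: (@good_glue _ _ _ (ts p)).
    by apply: good_congr gP => // t /andP[_ tt]; rewrite /Q tt.
  apply: good_congr (good_mulr S gp) => t /andP[tt tt'].
    by rewrite Qp.
  by rewrite /= php// in_itv /= tt.
- by rewrite /Q t0.
- by rewrite Qp ?(ltW tpp).
- move=> q t; rewrite ltnS leq_eqVlt => /predU1P[->|qp] tq.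
    by rewrite Qp//; move: tq; rewrite in_itv /= => /andP[/ltW].
  rewrite /Q ifT; first exact: Pq.
  move: tq; rewrite in_itv /= => /andP[_] /le_trans; apply.
  have mono m : (q.+1 + m <= p)%N -> ts q.+1 <= ts (q.+1 + m)%N.
    elim: m => [|m IHm]; first by rewrite addn0.
    rewrite addnS => mp; apply: le_trans (IHm (ltnW mp)) (ltW _).
    by have [] := dec (q.+1 + m)%N (leq_trans mp (ltnW pn)).
  by have := mono (p - q.+1)%N; rewrite subnKC//; exact.
Qed.

(** The curves obtained from two decompositions have the same integrand and the
    same initial value, and coincide by [good_unique]. *)
Lemma pw_prodint_good phi : DP0 Xi phi ->
  good (pw_prodint Xi phi) (dXi Xi \o phi) 0 1 /\ pw_prodint Xi phi 0 = 1%g.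
Proof.
move=> [n [ts [phis dec]]]; split; last by rewrite /pw_prodint eqxx.
have [_ [P [gP P0 _ Pq]]] := step_good dec (leqnn n).
have [ts0 tsn decq] := dec; rewrite tsn in gP.
apply: (good_congr _ _ gP) => // t /andP[t0 t1]; rewrite /pw_prodint.
case: eqP => [->//|/eqP tN0].
have t0' : 0 < t by rewrite lt_neqAle eq_sym tN0.
case: xgetP => [g _ [n' [ts' [phis' [p [dec' pn tp ->]]]]]|].
  have [_ [P' [gP' P'0 _ Pq']]] := step_good dec' (leqnn n').
  rewrite -(Pq' p t pn tp).
  have tsn' : ts' n' = 1 by have [] := dec'.
  rewrite tsn' in gP'.
  have := good_unique t0 (good_sub (lexx 0) t1 gP) (good_sub (lexx 0) t1 gP').
  rewrite P0 P'0 invg1 mulg1 => e.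
  by apply: (mulgI (P t)^-1%g); rewrite e mulVg.
have [q qn tq] : exists2 q, (q < n)%N & t \in `]ts q, ts q.+1].
  have : t <= ts n by rewrite tsn.
  elim: (n) => [|m IHm]; first by rewrite ts0 leNgt t0'.
  have [tm|tm] := leP t (ts m); last by exists m => //; rewrite in_itv /= tm.
  by have [q qm tq] := IHm tm; exists q => //; exact: ltnW.
by move=> /(_ (P t))[]; exists n, ts, phis, q; split=> //; exact: Pq.
Qed.

End Good.

(** * Gluing of curves and curves of exponentials *)

Section Gluing.
Context {R : realType} {E : tvsType R} (hE : hausdorff_space E) (G : lieGroup E).
Context (Xi : chart G E) (Xi_chart : smooth_chart (lie_manifold G) Xi)
  (Xi_dom1 : chart_dom Xi 1%g) (Xi1 : Xi 1%g = 0).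
Implicit Types (eta : R -> G) (t c : R).

Local Notation exp := (chart_inv Xi).

Lemma near_dnbhs_sides (T : Type) (f : R -> T) (A : set_system T) :
  f @ (0:R)^'+ `=>` A -> f @ (0:R)^'- `=>` A -> f @ (0:R)^' `=>` A.
Proof. by move=> fr fl U AU; apply: near_dnbhs0E; [exact: fr|exact: fl]. Qed.

Lemma Rd_sides eta t X : Rd Xi 0^'+ eta t X -> Rd Xi 0^'- eta t X ->
  Rd Xi (0:R)^' eta t X.
Proof. by move=> [c1 d1] [c2 d2]; split; apply: near_dnbhs_sides. Qed.

Lemma Rd_right_congr eta eta' t X : (\forall s \near t^'+, eta s = eta' s) ->
  eta t = eta' t -> Rd Xi 0^'+ eta t X -> Rd Xi 0^'+ eta' t X.
Proof.
move=> ee et; apply: Rd_congr => //.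
have H : t + h @[h --> (0:R)^'+] `=>` t^'+.
  move=> A /nbhs_ballP[e /= e0 eA]; apply/near_rightE; exists e => // h h0 he.
  apply: eA; rewrite ?ltrDl//.
  by rewrite -ball_normE /ball_/= opprD addNKr normrN gtr0_norm.
exact: (H _ ee).
Qed.

Lemma Rd_left_congr eta eta' t X : (\forall s \near t^'-, eta s = eta' s) ->
  eta t = eta' t -> Rd Xi 0^'- eta t X -> Rd Xi 0^'- eta' t X.
Proof.
move=> ee et; apply: Rd_congr => //.
have H : t + h @[h --> (0:R)^'-] `=>` t^'-.
  move=> A /nbhs_ballP[e /= e0 eA]; apply/near_leftE; exists e => // h h0 he.
  apply: eA; rewrite ?gtrDl//.
  by rewrite -ball_normE /ball_/= opprD addNKr normrN ltr0_norm// ltrNl.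
exact: (H _ ee).
Qed.

Definition patch_at (T : Type) c (f g : R -> T) t := if t < c then f t else g t.

Lemma patch_at_lt (T : Type) c (f g : R -> T) t : t < c -> patch_at c f g t = f t.
Proof. by rewrite /patch_at => ->. Qed.

Lemma patch_at_ge (T : Type) c (f g : R -> T) t : c <= t -> patch_at c f g t = g t.
Proof. by rewrite /patch_at ltNge => ->. Qed.

Lemma Rd_patch_right c eta1 eta2 t X :
  (t < c -> Rd Xi 0^'+ eta1 t X) -> (c <= t -> Rd Xi 0^'+ eta2 t X) ->
  Rd Xi 0^'+ (patch_at c eta1 eta2) t X.
Proof.
move=> e1 e2; case: (ltP t c) => tc.
  apply: Rd_right_congr (e1 tc); last by rewrite patch_at_lt.
  by apply: filterS (nbhs_right_lt tc) => s sc; rewrite patch_at_lt.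
apply: Rd_right_congr (e2 tc); last by rewrite patch_at_ge.
by apply: filterS (nbhs_right_gt t) => s sc; rewrite patch_at_ge// (le_trans tc)// ltW.
Qed.

Lemma Rd_patch_left c eta1 eta2 t X : eta1 c = eta2 c ->
  (t <= c -> Rd Xi 0^'- eta1 t X) -> (c < t -> Rd Xi 0^'- eta2 t X) ->
  Rd Xi 0^'- (patch_at c eta1 eta2) t X.
Proof.
move=> ec e1 e2; case: (leP t c) => tc.
  apply: Rd_left_congr (e1 tc).
    by apply: filterS (nbhs_left_lt t) => s sc; rewrite patch_at_lt// (lt_le_trans sc).
  by rewrite /patch_at; case: ltP => // ct; have -> : t = c by apply/eqP; rewrite eq_le tc.
apply: Rd_left_congr (e2 tc); last by rewrite patch_at_ge// ltW.
by apply: filterS (nbhs_left_gt tc) => s sc; rewrite patch_at_ge// ltW.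
Qed.

Lemma patch_at_continuous (T : topologicalType) c (f g : R -> T) t : f c = g c ->
  (t <= c -> {for t, continuous f}) -> (c <= t -> {for t, continuous g}) ->
  {for t, continuous (patch_at c f g)}.
Proof.
move=> fgc cf cg; have [tc|ct|tc] := ltgtP t c.
- apply: cont_congr (cf (ltW tc)).
  have := (@open_nbhs_nbhs _ t [set s | s < c]) (conj (@open_lt _ c) tc).
  by apply: filterS => s /= sc; rewrite patch_at_lt.
- apply: cont_congr (cg (ltW ct)).
  have := (@open_nbhs_nbhs _ t [set s | c < s]) (conj (@open_gt _ c) ct).
  by apply: filterS => s /= sc; rewrite patch_at_ge// ltW.
subst c; have {}cf := cf (lexx t); have {}cg := cg (lexx t).
move=> U; rewrite patch_at_ge// => Uc.
have Uf : nbhs t (f @^-1` U) by apply: cf; rewrite fgc.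
have Ug : nbhs t (g @^-1` U) by exact: cg.
by apply: filterS2 Uf Ug => s; rewrite /preimage /= /patch_at; case: ifP.
Qed.

(** The right logarithmic derivative of the inverse chart: its differential at x
    in direction X, translated from exp(x) to the unit. *)
Definition omega (x X : E) : E :=
  dderiv (fun z => Xi (exp z * (exp x)^-1)%g) x X.

Let Smat_quot k (x : E) : chart_cod Xi x ->
  Smat k (fun z : E * E => Xi (exp z.1 * (exp z.2)^-1)%g) (x, x).
Proof.
move=> cx; apply: (SmG_read hE Xi_chart); first by rewrite /= mulgV.
apply: (SmG_mul hE); first by apply: SmG_exp_comp => //; exact: Smat_fst.
by apply: (SmG_inv hE); apply: SmG_exp_comp => //; exact: Smat_snd.
Qed.

Lemma Smat_omega k x X : chart_cod Xi x ->
  Smat k (fun z : E * E => omega z.1 z.2) (x, X).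
Proof.
move=> cx; have S := Smat_dderiv hE (X, 0) (Smat_quot k.+1 cx).
set m := (fun z : E * E => Xi _) in S.
have e : (fun z : E * E => omega z.1 z.2) =
    (fun w => dderiv m w.1 w.2) \o (fun z : E * E => ((z.1, z.1), (z.2, 0 : E))).
  by apply/funext => z; rewrite /omega /= -dderiv_partial1.
rewrite e; apply: Smat_comp => //; exists setT; split=> //; first exact: openT.
by apply: Sm_pair; apply: Sm_pair;
  [exact: Sm_fst|exact: Sm_fst|exact: Sm_snd|exact: Sm_cst].
Qed.

Lemma omega0 X : omega 0 X = X.
Proof.
rewrite /omega -[RHS](dderiv_id hE 0); apply: dderiv_congr.
have nc := open_near (@chart_cod_open _ _ _ Xi) (cod0 Xi_dom1 Xi1).
by apply: filterS nc => y cy; rewrite exp0// invg1 mulg1 chart_invK.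
Qed.

Lemma omegaZ x a X : chart_cod Xi x -> omega x (a *: X) = a *: omega x X.
Proof.
move=> cx; apply: (Smat_dderivZ hE).
apply: (SmG_read hE Xi_chart); first by rewrite /= mulgV.
by apply: (SmG_mul hE); [exact: (SmG_exp hE)|exact: SmG_cst].
Qed.

Lemma Rd_exp (f : R -> E) (g : G) t X :
  h^-1 *: (f (t + h) - f t) @[h --> (0:R)^'] --> X -> chart_cod Xi (f t) ->
  Rd Xi (0:R)^' (fun s => exp (f s) * g)%g t (omega (f t) X).
Proof.
move=> fX ct.
pose q h := h^-1 *: (f (t + h) - f t).
have qE : \forall h \near (0:R)^', f (t + h) = f t + h *: q h.
  apply: filterS near_dnbhs0_neq => h h0.
  by rewrite /q scalerA divff// scale1r subrKC.
have fc : f (t + h) @[h --> (0:R)^'] --> f t.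
  have : f t + h *: q h @[h --> (0:R)^'] --> f t + 0 *: X.
    apply: tcvgD; first exact: cvg_cst.
    by apply: tcvgZ => //; exact: nbhs_dnbhs.
  rewrite scale0r addr0 => H; apply: cvg_trans H; apply: near_eq_cvg.
  by apply: filterS qE => h ->.
split.
  by apply: cvg_mulG; [exact: cvg_chart_inv|exact: cvg_cst].
have S1 : Smat 1 (fun z => Xi (exp z * (exp (f t))^-1)%g) (f t).
  apply: (SmG_read hE Xi_chart); first by rewrite /= mulgV.
  by apply: (SmG_mul hE); [exact: (SmG_exp hE)|exact: SmG_cst].
have H : h^-1 *: (Xi (exp (f t + h *: q h) * (exp (f t))^-1)%g -
    Xi (exp (f t) * (exp (f t))^-1)%g) @[h --> (0:R)^'] --> omega (f t) X.
  apply: (@Smat_hadamard _ _ _ hE _ (f t) X R (0:R)^' _ (fun=> f t) q id) => //.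
  - exact: cvg_cst.
  - exact: nbhs_dnbhs.
  - exact: near_dnbhs0_neq.
apply: cvg_trans H; apply: near_eq_cvg; apply: filterS qE => h hE'.
by rewrite -hE' mulgV Xi1 subr0 invgM mulgA mulgK.
Qed.

End Gluing.

(** * Limits of product integrals *)

Section LimitCurve.
Context {R : realType} {E : tvsType R} (hE : hausdorff_space E) (G : lieGroup E).
Context (Xi : chart G E) (Xi_chart : smooth_chart (lie_manifold G) Xi)
  (Xi_dom1 : chart_dom Xi 1%g) (Xi1 : Xi 1%g = 0)
  (G_mu_convex : locally_mu_convex Xi).

Local Notation exp := (chart_inv Xi).

(** Limits of group elements that stay small do not leave the domain of [Xi]:
    the limit is the product of a member of the sequence and of an element
    close to the unit. *)
Lemma limit_in_dom : exists q : cseminorm E, forall (g : nat -> G) (g0 : G),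
  g @ \oo --> g0 -> (\forall n \near \oo, Xi_le Xi q (g n) 2^-1) ->
  chart_dom Xi g0.
Proof.
have [q _ uq] := G_mu_convex snzero; exists q => g g0 gg0 gq.
have g1 : ((g n)^-1 * g0)%g @[n --> \oo] --> (1%g : G).
  rewrite -(mulVg g0); apply: cvg_mulG; last exact: cvg_cst.
  exact: cvg_invG.
have d1 := near_chart_dom g1 Xi_dom1.
have x1 : Xi ((g n)^-1 * g0)%g @[n --> \oo] --> (0 : E).
  by rewrite -Xi1; exact: cvg_chart.
have q1 : \forall n \near \oo, q (Xi ((g n)^-1 * g0)%g) < 2^-1.
  have half0 : 0 < 2^-1 :> R by rewrite invr_gt0.
  have H : \forall n \near \oo, q (Xi ((g n)^-1 * g0)%g - 0) < 2^-1.
    by move/cvg_snP : x1; apply.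
  by apply: filterS H => n; rewrite subr0.
have [n [[dn qn] gn]] := filter_ex (filterI (filterI d1 q1) gq).
have [] := mu_bound2 Xi_dom1 Xi1 uq gn (conj dn (ltW qn)) _.
  lra.
by rewrite mulgA mulgV mul1g.
Qed.

(** Uniform limits of product integrals have the expected right derivatives.
    In the chart [Xi] the translated curves start at the origin, stay in a
    prescribed neighbourhood of it during a time independent of n, and have
    derivatives close to the limit there, so that the mean value inequality
    passes to the limit. *)
Lemma limit_Rd_right (P : nat -> R -> G) (b : nat -> R -> E) (b0 : E)
    (t0 tau : R) (mu : R -> G) : 0 < tau ->
  (forall n, good Xi (P n) (b n) t0 (t0 + tau)) ->
  (forall (p : cseminorm E) e, 0 < e -> exists2 d, 0 < d &
     \forall n \near \oo, forall t, t0 < t -> t < t0 + d ->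
       p (b n t - b0) <= e) ->
  (forall t, t0 <= t -> t <= t0 + tau -> P n t @[n --> \oo] --> mu t) ->
  Rd Xi 0^'+ mu t0 b0.
Proof.
move=> tau0 gP bb Pmu; have [q1 q1P] := limit_in_dom.
suff key : forall (p : cseminorm E) e, 0 < e -> \forall h \near (0:R)^'+,
    chart_dom Xi (mu (t0 + h) * (mu t0)^-1)%g /\
    p (h^-1 *: Xi (mu (t0 + h) * (mu t0)^-1)%g - b0) < e.
  have lim : h^-1 *: Xi (mu (t0 + h) * (mu t0)^-1)%g @[h --> (0:R)^'+] --> b0.
    by apply/cvg_snP => p e e0; apply: filterS (key p e e0) => h [].
  split=> //.
  have nd : \forall h \near (0:R)^'+, chart_dom Xi (mu (t0 + h) * (mu t0)^-1)%g.
    by apply: filterS (key snzero 1 ltr01) => h [].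
  have hN : \forall h \near (0:R)^'+, h != 0.
    by apply: at_right_dnbhs; exact: near_dnbhs0_neq.
  have x0 : Xi (mu (t0 + h) * (mu t0)^-1)%g @[h --> (0:R)^'+] --> (0 : E).
    have H : (h : R) *: (h^-1 *: Xi (mu (t0 + h) * (mu t0)^-1)%g)
        @[h --> (0:R)^'+] --> (0 : R) *: b0.
      by apply: tcvgZ => // U U0; apply: at_right_dnbhs; exact: nbhs_dnbhs.
    rewrite scale0r in H; apply: cvg_trans H; apply: near_eq_cvg.
    by apply: filterS hN => h h0; rewrite scalerA divff// scale1r.
  have H : (exp (Xi (mu (t0 + h) * (mu t0)^-1)) * mu t0)%g @[h --> (0:R)^'+]
      --> (1 * mu t0)%g.
    apply: cvg_mulG; last exact: cvg_cst.
    rewrite -(exp0 Xi_dom1 Xi1); apply: cvg_chart_inv => //; exact: cod0.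
  rewrite mul1g in H; apply: cvg_trans H; apply: near_eq_cvg.
  by apply: filterS nd => h hd; rewrite chart_mapK// mulgVK.
move=> p e e0; have e2 : 0 < e / 2 by rewrite divr_gt0.
have vc := vfield_continuous hE Xi_chart Xi_dom1 Xi1 (X := b0) Xi_chart Xi_dom1.
have [[W1 W2] [/= nW1 nW2] W12] : nbhs (1%g : G, b0)
    [set z | p (vfield Xi Xi z.1 z.2 - b0) < e / 2].
  apply: (vc [set Y | p (Y - b0) < e / 2]) => /=.
  by rewrite (vfield1 hE Xi_dom1 Xi1); exact: nbhs_sn.
have [q qW1] : exists q : cseminorm E, forall x, q x < 1 -> W1 (exp x).
  have : nbhs (0 : E) (exp @^-1` W1).
    apply: (chart_inv_continuous (cod0 Xi_dom1 Xi1)).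
    by rewrite (exp0 Xi_dom1 Xi1).
  by move=> /gauge.
have [p2 p2W2] := nbhs_gauge nW2.
(* On an interval of length h with M * h small, [mu_mean_value] keeps the translated
   curves in the neighbourhood W1 and, by the choice of q1, in the domain of Xi. *)
pose u := snadd q q1; have [ou _ uo] := G_mu_convex u.
pose M := ou b0 + 1.
have M0 : 0 < M by rewrite /M ltr_wpDl ?sn_ge0.
have half0 : 0 < 2^-1 :> R by rewrite invr_gt0.
have [d1 d10 b1] := bb ou 1 ltr01.
have [d2 d20 b2] := bb p2 2^-1 half0.
pose d := Num.min (Num.min d1 d2) (Num.min tau (4^-1 / M)).
have d0 : 0 < d by rewrite !lt_min d10 d20 tau0 divr_gt0// invr_gt0.
have [dd1 dd2 dtau dM] : [/\ d <= d1, d <= d2, d <= tau & d <= 4^-1 / M].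
  by rewrite !ge_min !lexx !orbT.
apply/near_rightE; exists d => // h h0 hd.
set t := t0 + h.
have tt : t0 < t by rewrite ltrDl.
have ttau : t <= t0 + tau by rewrite lerD2l (le_trans (ltW hd)).
have th : t - t0 = h by rewrite /t addrC addKr.
have Mh : M * h < 2^-1.
  have : M * h < M * d by rewrite ltr_pM2l.
  have : M * d <= 4^-1 by rewrite mulrC -ler_pdivlMr.
  have : (4^-1 : R) <= 2^-1 by rewrite lef_pV2 ?posrE// ler_nat.
  move: (M * h) (M * d) (4^-1 : R) (2^-1 : R) => x y z w; lra.
(* Bounds for b n on the open interval pass to its one-sided limits. *)
have limb (r : cseminorm E) (c d' : R) n X s (F : set_system R) (FF : ProperFilter F) :
    (forall t, t0 < t -> t < t0 + d' -> r (b n t - b0) <= c) ->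
    (\forall k \near F, t0 < s + k < t0 + d') ->
    b n (s + k) @[k --> F] --> X -> r (X - b0) <= c.
  move=> rc Fk bX; have H : b n (s + k) - b0 @[k --> F] --> X - b0.
    by apply: tcvgB => //; exact: cvg_cst.
  apply: (cvg_sn_le H); apply: filterS Fk => k /andP[k1 k2]; exact: rc.
pose g n := (P n t * (P n t0)^-1)%g.
have est : \forall n \near \oo, Xi_le Xi u (g n) (M * h) /\
    p (Xi (g n) - h *: b0) <= e / 2 * h.
  apply: filterS2 b1 b2 => n b1n b2n.
  have [gr gl] := gP n.
  have RdX s : t0 <= s -> s <= t ->
     (s < t -> exists X, [/\ Rd Xi 0^'+ (P n) s X, ou X <= M & p2 (X - b0) < 1]) /\
     (t0 < s -> exists X, [/\ Rd Xi 0^'- (P n) s X, ou X <= M & p2 (X - b0) < 1]).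
    move=> s0 st.
    have lim (F : set_system R) (FF : ProperFilter F) X : (\forall k \near F, t0 < s + k < t) ->
       b n (s + k) @[k --> F] --> X -> ou X <= M /\ p2 (X - b0) < 1.
      move=> Fk bX.
      have Fd d' : d <= d' -> \forall k \near F, t0 < s + k < t0 + d'.
        move=> dd'; apply: filterS Fk => k /andP[-> /= k2]; apply: lt_le_trans k2 _.
        by rewrite lerD2l (le_trans (ltW hd)).
      have o1 := limb ou 1 d1 n X s F FF b1n (Fd _ dd1) bX.
      have o2 := limb p2 2^-1 d2 n X s F FF b2n (Fd _ dd2) bX.
      split; last by apply: le_lt_trans o2 _; rewrite invf_lt1 ?ltr1n.
      by have := sn_le ou X b0; rewrite /M; lra.
    split=> [st'|s0'].
      have [X bX PX] := gr s s0 (lt_le_trans st' ttau).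
      have Fk : \forall k \near (0:R)^'+, t0 < s + k < t.
        apply: filterS (near_right_itv st') => k /andP[k1 ->]; rewrite andbT.
        exact: le_lt_trans s0 k1.
      by have [] := lim _ _ X Fk bX; exists X.
    have [X bX PX] := gl s s0' (le_trans st ttau).
    have Fk : \forall k \near (0:R)^'-, t0 < s + k < t.
      apply: filterS (near_left_itv s0') => k /andP[-> k1] /=.
      exact: lt_le_trans k1 st.
    by have [] := lim _ _ X Fk bX; exists X.
  have bound s : t0 <= s -> s <= t ->
      Xi_le Xi u (P n s * (P n t0)^-1)%g (M * (s - t0)).
    move=> s0 st; apply: (mu_mean_value hE Xi_chart Xi_dom1 Xi1 uo) => //.
    - exact: ltW.
    - have : M * (s - t0) <= M * h by rewrite ler_pM2l// -th lerD2r.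
      have : (2^-1 : R) < 1 by rewrite invf_lt1 ?ltr1n.
      move: (M * _) (M * h) (2^-1 : R) Mh => x y w; lra.
    - move=> r r0 rs; have [H _] := RdX r r0 (le_trans (ltW rs) st).
      by have [X [? ? _]] := H (lt_le_trans rs st); exists X.
    - move=> r r0 rs; have [_ H] := RdX r (ltW r0) (le_trans rs st).
      by have [X [? ? _]] := H r0; exists X.
  have bt := bound t (ltW tt) (lexx _); split; first by rewrite -th.
  have W1s s : t0 <= s -> s <= t -> chart_dom Xi (P n s * (P n t0)^-1)%g /\
      W1 (P n s * (P n t0)^-1)%g.
    move=> s0 st; have [sd su] := bound s s0 st; split=> //.
    rewrite -(chart_mapK sd); apply: qW1.
    have : M * (s - t0) <= M * h by rewrite ler_pM2l// -th lerD2r.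
    have : (2^-1 : R) < 1 by rewrite invf_lt1 ?ltr1n.
    have := sn_ge0 q1 (Xi (P n s * (P n t0)^-1)%g).
    move: su; rewrite /u snaddE.
    move: (M * _) (M * h) (2^-1 : R) Mh => x y w; lra.
  pose c s := Xi (P n s * (P n t0)^-1)%g - (s - t0) *: b0.
  have cder (F : set_system R) (FF : ProperFilter F) s X : F `=>` (0:R)^' ->
     t0 <= s -> s <= t -> Rd Xi F (P n) s X -> p2 (X - b0) < 1 ->
     exists2 Y, h^-1 *: (c (s + h) - c s) @[h --> F] --> Y & p Y <= e / 2.
    move=> F0 s0 st PX pX; have [sd sW] := W1s s s0 st.
    have RX : Rd Xi F (fun s => P n s * (P n t0)^-1)%g s X by apply: Rd_mulr.
    exists (vfield Xi Xi (P n s * (P n t0)^-1)%g X - b0); last first.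
      by apply/ltW; apply: (W12 (_, X)); split=> //=; exact: p2W2.
    have H' : h^-1 *: (Xi (P n (s + h) * (P n t0)^-1)%g -
        Xi (P n s * (P n t0)^-1)%g) - b0 @[h --> F] -->
        vfield Xi Xi (P n s * (P n t0)^-1)%g X - b0.
      apply: tcvgB; last exact: cvg_cst.
      exact: (Rd_chart hE Xi_chart Xi_dom1 Xi1 F0 Xi_chart sd RX).
    apply: cvg_trans H'; apply: near_eq_cvg.
    apply: filterS (F0 _ near_dnbhs0_neq) => k k0.
    rewrite -[b0 in LHS](scalerK k0) -scalerBr; congr (_ *: _).
    rewrite /c opprD opprK addrACA; congr (_ + _).
    by rewrite -!scaleNr -scalerDl; congr (_ *: _); lra.
  have c0 : c t0 = 0 by rewrite /c subrr scale0r subr0 mulgV.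
  suff : p (c t - c t0) <= e / 2 * (t - t0) by rewrite c0 subr0 /c th.
  apply: mean_value; first exact: ltW.
    move=> s s0 st; have [H _] := RdX s s0 (ltW st).
    have [X [PX _ pX]] := H st.
    by apply: (cder _ _ s X) => //; [exact: at_right_dnbhs|exact: ltW].
  move=> s s0 st; have [_ H] := RdX s (ltW s0) st.
  have [X [PX _ pX]] := H s0.
  by apply: (cder _ _ s X) => //; [exact: at_left_dnbhs|exact: ltW].
have gg : g n @[n --> \oo] --> (mu t * (mu t0)^-1)%g.
  apply: cvg_mulG; first by apply: Pmu => //; exact: ltW.
  by apply: cvg_invG; apply: Pmu; rewrite ?lexx// lerDl ltW.
have gd : chart_dom Xi (mu t * (mu t0)^-1)%g.
  apply: (q1P g) => //; apply: filterS est => n [[nd nu] _]; split=> //.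
  move: nu; rewrite /u snaddE; have := sn_ge0 q (Xi (g n)).
  by move: (M * h) (2^-1 : R) Mh => x y; lra.
split=> //.
have lim : Xi (g n) - h *: b0 @[n --> \oo] --> Xi (mu t * (mu t0)^-1)%g - h *: b0.
  by apply: tcvgB; [exact: cvg_chart|exact: cvg_cst].
have est' : \forall n \near \oo, p (Xi (g n) - h *: b0) <= e / 2 * h.
  by apply: filterS est => n [].
have le : p (Xi (mu t * (mu t0)^-1)%g - h *: b0) <= e / 2 * h.
  exact: cvg_sn_le lim est'.
have -> : h^-1 *: Xi (mu t * (mu t0)^-1)%g - b0 =
    h^-1 *: (Xi (mu t * (mu t0)^-1)%g - h *: b0).
  by rewrite scalerBr scalerK// gt_eqF.
rewrite seminormZ normfV gtr0_norm// ltr_pdivrMl//.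
apply: le_lt_trans le _; rewrite mulrC ltr_pM2l//.
by rewrite ltr_pdivrMr// ltr_pMr// ltr1n.
Qed.

End LimitCurve.

Section Integrability.
Context {R : realType} {E : tvsType R} (hE : hausdorff_space E) (G : lieGroup E).
Context (Xi : chart G E) (Xi_chart : smooth_chart (lie_manifold G) Xi)
  (Xi_dom1 : chart_dom Xi 1%g) (Xi1 : Xi 1%g = 0)
  (G_mu_convex : locally_mu_convex Xi).
Implicit Types (eta : R -> G) (b : R -> E).

Local Notation exp := (chart_inv Xi).

Section Reversal.

Lemma cvg_opp_right (T : Type) (f : R -> T) (A : set_system T) :
  f (- h) @[h --> (0:R)^'+] `=>` A <-> f h @[h --> (0:R)^'-] `=>` A.
Proof.
split=> H U AU.
  have /near_rightE[d d0 dU] := H U AU; apply/near_leftE; exists d => // h h0 hd.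
  by have := dU (- h); rewrite /preimage /= opprK oppr_gt0 ltrNl; exact.
have /near_leftE[d d0 dU] := H U AU; apply/near_rightE; exists d => // h h0 hd.
by have := dU (- h); rewrite /preimage /= oppr_lt0 ltrN2; exact.
Qed.

Lemma cvg_opp_left (T : Type) (f : R -> T) (A : set_system T) :
  f (- h) @[h --> (0:R)^'-] `=>` A <-> f h @[h --> (0:R)^'+] `=>` A.
Proof.
rewrite -cvg_opp_right; suff -> : (fun h => f (- - h)) = f by [].
by apply/funext => h; rewrite opprK.
Qed.

Lemma Rd_opp_right eta t X : Rd Xi 0^'+ (fun s => eta (- s)) (- t) X ->
  Rd Xi 0^'- eta t (- X).
Proof.
move=> [ec eX]; split.
  apply/cvg_opp_right; rewrite opprK in ec; apply: cvg_trans ec; apply: near_eq_cvg.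
  by apply: nearW => h; rewrite opprD opprK.
apply/cvg_opp_right; apply: cvg_trans (tcvgN eX); apply: near_eq_cvg.
by apply: nearW => h; rewrite opprD opprK invrN scaleNr.
Qed.

Lemma Rd_opp_left eta t X : Rd Xi 0^'- (fun s => eta (- s)) (- t) X ->
  Rd Xi 0^'+ eta t (- X).
Proof.
move=> [ec eX]; split.
  apply/cvg_opp_left; rewrite opprK in ec; apply: cvg_trans ec; apply: near_eq_cvg.
  by apply: nearW => h; rewrite opprD opprK.
apply/cvg_opp_left; apply: cvg_trans (tcvgN eX); apply: near_eq_cvg.
by apply: nearW => h; rewrite opprD opprK invrN scaleNr.
Qed.

Lemma good_opp eta b x y : good Xi eta b x y ->
  good Xi (fun s => eta (- s)) (fun s => - b (- s)) (- y) (- x).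
Proof.
move=> [gr gl]; split=> t xt ty.
  have [X bX eX] := gl (- t) ltac:(by rewrite ltrNr) ltac:(by rewrite lerNl).
  exists (- X).
    apply/cvg_opp_left; apply: cvg_trans (tcvgN bX); apply: near_eq_cvg.
    by apply: nearW => h; rewrite opprD opprK.
  apply: Rd_opp_left; have -> : (fun s => eta (- - s)) = eta; last by [].
  by apply/funext => s; rewrite opprK.
have [X bX eX] := gr (- t) ltac:(by rewrite lerNr) ltac:(by rewrite ltrNl).
exists (- X).
  apply/cvg_opp_right; apply: cvg_trans (tcvgN bX); apply: near_eq_cvg.
  by apply: nearW => h; rewrite opprD opprK.
apply: Rd_opp_right; have -> : (fun s => eta (- - s)) = eta; last by [].
by apply/funext => s; rewrite opprK.
Qed.

(** Time reversal exchanges the two sides. *)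
Lemma limit_Rd_left (P : nat -> R -> G) (bn : nat -> R -> E) (b0 : E)
    (t0 tau : R) (mu : R -> G) : 0 < tau ->
  (forall n, good Xi (P n) (bn n) (t0 - tau) t0) ->
  (forall (p : cseminorm E) e, 0 < e -> exists2 d, 0 < d &
     \forall n \near \oo, forall t, t0 - d < t -> t < t0 ->
       p (bn n t - b0) <= e) ->
  (forall t, t0 - tau <= t -> t <= t0 -> P n t @[n --> \oo] --> mu t) ->
  Rd Xi 0^'- mu t0 b0.
Proof.
move=> tau0 gP bb Pmu; rewrite -[b0]opprK; apply: Rd_opp_right.
apply: (limit_Rd_right hE Xi_chart Xi_dom1 Xi1 G_mu_convex
  (P := fun n s => P n (- s)) (b := fun n s => - bn n (- s)) (tau := tau)) => //.
- by move=> n; have := good_opp (gP n); rewrite opprB addrC.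
- move=> p e e0; have [d d0 bd] := bb p e e0; exists d => //.
  apply: filterS bd => n bd t t1 t2.
  rewrite -opprD snN; apply: bd; last by rewrite ltrNl.
  by rewrite ltrNr opprB addrC.
- move=> t t1 t2; apply: Pmu; last by rewrite lerNl.
  by rewrite lerNr opprB addrC.
Qed.

End Reversal.

Lemma sdot_sup_le (p : cseminorm E) (f : R -> lie_alg G) (c : R) :
  (sdot_sup Xi p f <= c%:E)%E <-> forall t, t \in `[0, 1] -> p (dXi Xi (f t)) <= c.
Proof.
split=> [fc t t01|fc].
  rewrite -lee_fin; apply: le_trans fc; apply: ereal_sup_ubound.
  by exists t.
by apply: ge_ereal_sup => _ [t t01 <-]; rewrite lee_fin; exact: fc.
Qed.

Lemma cvg_unifP (phi : nat -> R -> lie_alg G) psi : cvg_unif Xi phi psi ->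
  forall (p : cseminorm E) e, 0 < e -> \forall n \near \oo,
    forall t, t \in `[0, 1] -> p (dXi Xi (phi n t) - dXi Xi (psi t)) <= e.
Proof.
move=> cphi p e e0.
have e0' : (0 < e%:E :> \bar R)%E by rewrite lte_fin.
have : \forall n \near \oo, (sdot_sup Xi p (fun t => (phi n t - psi t)%R) < e%:E)%E.
  exact: (cphi p _ (open_ereal_lt' e0')).
apply: filterS => n /ltW/sdot_sup_le pn t t01.
by rewrite -dXiB//; exact: pn.
Qed.

(** A Lipschitz curve on [x,y] extends continuously to the line by its values at
    the end points. *)
Lemma C_curve_C0 k x y (phi : R -> lie_alg G) : x <= y ->
  C_curve Xi k x y phi -> C_curve Xi (Cfin 0) x y phi.
Proof.
move=> xy; case: k => [n| |].
- move=> [J [psi [Jxy Cpsi ppsi]]]; exists J, psi; split=> //.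
  by move=> p; rewrite leqn0 => /eqP ->; exact: Cpsi.
- move=> Lphi.
  pose clamp (t : R) : R := Num.max x (Num.min t y).
  have clampP t : clamp t \in `[x, y].
    rewrite in_itv /= /clamp le_max lexx /= ge_max xy /=.
    by rewrite ge_min lexx orbT.
  have clamp_id t : t \in `[x, y] -> clamp t = t.
    by rewrite in_itv /= => /andP[xt ty]; rewrite /clamp min_l// max_r.
  have clamp_mono (s t : R) : s <= t -> clamp s <= clamp t <= clamp s + (t - s).
    rewrite /clamp !maxEle !minEle => st.
    by case: (leP s y) => ?; case: (leP t y) => ?; case: (leP x s) => ?;
      case: (leP x y) => ?; case: (leP x t) => ?; apply/andP; split; lra.
  have clampL (s t : R) : `|clamp s - clamp t| <= `|s - t|.
    wlog st : s t / s <= t => [hw|].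
      by case: (leP s t) => [/hw//|/ltW/hw]; rewrite distrC [`|t - s|]distrC.
    have /andP[c1 c2] := clamp_mono s t st.
    rewrite distrC [`|s - t|]distrC !ger0_norm ?subr_ge0//.
    by rewrite lerBlDl.
  exists setT, (phi \o clamp); split.
  + by split=> //; exact: openT.
  + apply: (Sm_Ck hE openT).
    apply: Sm0 => t _.
    have dc : dXi Xi ((phi \o clamp) s) @[s --> t] --> dXi Xi ((phi \o clamp) t).
      apply/cvg_snP => p e e0; have [L L0 Lp] := Lphi p.
      have eL0 : 0 < e / (L + 1) by rewrite divr_gt0// ltr_wpDl.
      have nt : \forall s \near t, `|(t : R) - s| < e / (L + 1).
        have : (s : R) @[s --> (t : R)] --> (t : R) by exact: cvg_id.
        by move/cvgrPdist_lt; apply.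
      apply: filterS nt => s ts.
      rewrite -dXiB//.
      apply: le_lt_trans (Lp _ _ (clampP s) (clampP t)) _.
      have H1 : L * `|clamp s - clamp t| <= (L + 1) * `|t - s|.
        rewrite [`|t - s|]distrC.
        by apply: ler_pM; [exact: L0|exact: normr_ge0|rewrite lerDl|exact: clampL].
      apply: le_lt_trans H1 _.
      by rewrite mulrC -ltr_pdivlMr// ltr_wpDl.
    have dc2 : dXi_inv Xi (dXi Xi ((phi \o clamp) s)) @[s --> t] -->
        dXi_inv Xi (dXi Xi ((phi \o clamp) t)).
      apply: (cvg_comp _ (dXi_inv Xi) dc); exact: dXi_inv_continuous.
    have : (phi \o clamp) s @[s --> t] --> (phi \o clamp) t.
      rewrite (dXiK hE Xi_chart Xi_dom1 Xi1) in dc2.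
      apply: cvg_trans dc2; apply: near_eq_cvg; apply: nearW => s.
      by rewrite dXiK.
    by [].
  + by move=> t txy /=; rewrite clamp_id.
- move=> [J [psi [Jxy Cpsi ppsi]]]; exists J, psi; split=> //.
Qed.

End Integrability.

(** * Completeness and confinement imply semiregularity *)

Section Sufficiency.
Context {R : realType} {E : tvsType R} (hE : hausdorff_space E) (G : lieGroup E).
Context (Xi : chart G E) (Xi_chart : smooth_chart (lie_manifold G) Xi)
  (Xi_dom1 : chart_dom Xi 1%g) (Xi1 : Xi 1%g = 0)
  (G_mu_convex : locally_mu_convex Xi).

Local Notation exp := (chart_inv Xi).

(** Product integrals of a tame sequence are as close as their integrands: the
    logarithmic derivative of the quotient is the transformed difference. *)
Lemma tame_estimate (phi : nat -> R -> lie_alg G) (u : cseminorm E) :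
  (forall n, DP0 Xi (phi n)) -> tame Xi phi ->
  exists w : cseminorm E, forall m n (M : R), 0 <= M -> M < 1 ->
    (sdot_sup Xi w (fun t => (phi m t - phi n t)%R) <= M%:E)%E ->
    forall t, t \in `[0, 1] ->
    Xi_le Xi u ((pw_prodint Xi (phi m) t)^-1 * pw_prodint Xi (phi n) t)%g M.
Proof.
move=> Dphi tphi; have [q _ uq] := G_mu_convex u; have [w _ qw] := tphi q.
exists w => m n M M0 M1 /sdot_sup_le wM t; rewrite in_itv /= => /andP[t0 t1].
have [[mr ml] m0] := pw_prodint_good hE Xi_chart Xi_dom1 Xi1 G_mu_convex (Dphi m).
have [[nr nl] n0] := pw_prodint_good hE Xi_chart Xi_dom1 Xi1 G_mu_convex (Dphi n).
set P := pw_prodint Xi (phi m) in mr ml m0 *.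
set Q := pw_prodint Xi (phi n) in nr nl n0 *.
pose eta s := ((P s)^-1 * Q s)%g.
have Ad_le s X Y (F : set_system R) (FF : ProperFilter F) : 0 <= s -> s <= 1 ->
    (\forall h \near F, 0 < s + h < 1) ->
    dXi Xi (phi m (s + h)) @[h --> F] --> X ->
    dXi Xi (phi n (s + h)) @[h --> F] --> Y -> q (AdE Xi (P s)^-1%g (Y - X)) <= M.
  move=> s0 s1 Fs mX nY.
  have s01 : s \in `[0, 1] by rewrite in_itv /= s0.
  have H := qw m s s01 (dXi_inv Xi (Y - X)); rewrite /sdot dXi_Ad// dXi_invK// in H.
  apply: le_trans H _.
  have lim : dXi Xi (phi n (s + h)) - dXi Xi (phi m (s + h)) @[h --> F] --> Y - X.
    exact: tcvgB.
  apply: (cvg_sn_le lim); apply: filterS Fs => h /andP[h0 h1].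
  rewrite snB -dXiB//; apply: wM.
  by rewrite in_itv /= !ltW.
have -> : ((P t)^-1 * Q t = eta t * (eta 0)^-1)%g.
  by rewrite /eta m0 n0 invg1 mulg1 invg1 mulg1.
have [Mt0 Mt1] : 0 <= M * t /\ M * t <= M.
  by split; [exact: mulr_ge0|rewrite ler_piMr].
have [d le] : Xi_le Xi u (eta t * (eta 0)^-1)%g (M * (t - 0)).
  apply: (mu_mean_value hE Xi_chart Xi_dom1 Xi1 uq) => //.
  - by rewrite subr0 (le_lt_trans Mt1).
  - move=> s s0 st; have s1 := lt_le_trans st t1.
    have [X bX PX] := mr s s0 s1; have [Y bY QY] := nr s s0 s1.
    exists (AdE Xi (P s)^-1%g (Y - X)).
      exact: (Rd_quotient hE Xi_chart Xi_dom1 Xi1 (@at_right_dnbhs _ 0)).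
    apply: (Ad_le s X Y _ _ s0 (ltW s1) _ bX bY).
    apply: filterS (near_right_itv s1) => h /andP[h1 ->].
    by rewrite (le_lt_trans s0).
  - move=> s s0 st; have s1 := le_trans st t1.
    have [X bX PX] := ml s s0 s1; have [Y bY QY] := nl s s0 s1.
    exists (AdE Xi (P s)^-1%g (Y - X)).
      exact: (Rd_quotient hE Xi_chart Xi_dom1 Xi1 (@at_left_dnbhs _ 0)).
    apply: (Ad_le s X Y _ _ (ltW s0) s1 _ bX bY).
    apply: filterS (near_left_itv s0) => h /andP[-> h1] /=.
    exact: lt_le_trans h1 s1.
by split=> //; apply: le_trans le _; rewrite subr0.
Qed.

Lemma exp_scale_near (X : E) (t : R) : chart_cod Xi (t *: X) ->
  exists2 e, 0 < e & forall s, `|t - s| < e -> chart_cod Xi (s *: X).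
Proof.
move=> ct; have : s *: X @[s --> (t : R)] --> t *: X.
  by apply: tcvgZ; [exact: cvg_id|exact: cvg_cst].
move=> /(_ _ (open_near (@chart_cod_open _ _ _ Xi) ct)) /nbhs_ballP[e /= e0 ec].
by exists e => // s ts; apply: ec.
Qed.

Lemma Rd_line (a : R) (X : E) (g : G) t : chart_cod Xi ((t - a) *: X) ->
  Rd Xi (0:R)^' (fun s => exp ((s - a) *: X) * g)%g t (omega Xi ((t - a) *: X) X).
Proof.
move=> ct; apply: (Rd_exp hE Xi_chart Xi_dom1 Xi1 (f := fun s => (s - a) *: X)) => //.
apply: cvg_near_cst; apply: filterS near_dnbhs0_neq => h h0.
by rewrite -scalerBl (_ : t + h - a - (t - a) = h) ?scalerK//; lra.
Qed.

Lemma omega_line_continuous (a : R) (X : E) t : chart_cod Xi ((t - a) *: X) ->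
  {for t, continuous (fun s => omega Xi ((s - a) *: X) X)}.
Proof.
move=> ct; have oc := Smat_cont (Smat_omega hE Xi_chart Xi_dom1 0 X ct).
apply: (@continuous_comp _ _ _ (fun s : R => ((s - a) *: X, X))
  (fun z : E * E => omega Xi z.1 z.2)); last exact: oc.
apply: cont_pair; last exact: cvg_cst.
apply: tcvgZ; last exact: cvg_cst.
by apply: cvgB; [exact: cvg_id|exact: cvg_cst].
Qed.

(** A curve on [0,1] with continuous one-sided logarithmic derivatives is
    continued by exponentials of lines to a C^1 curve on an open interval. *)
Lemma Dset_of_Rd (phi : R -> lie_alg G) (mu : R -> G) :
  C_curve Xi (Cfin 0) 0 1 phi ->
  (forall t, 0 <= t -> t < 1 -> Rd Xi 0^'+ mu t (dXi Xi (phi t))) ->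
  (forall t, 0 < t -> t <= 1 -> Rd Xi 0^'- mu t (dXi Xi (phi t))) ->
  Dset 0 1 phi.
Proof.
move=> [J0 [psi [[oJ0 _ J01] Cpsi ppsi]]] mr ml.
pose a0 := dXi Xi (phi 0); pose a1 := dXi Xi (phi 1).
have c0 := cod0 Xi_dom1 Xi1.
have [e0 e00 ce0] := @exp_scale_near a0 0 ltac:(by rewrite scale0r).
have [e1 e10 ce1] := @exp_scale_near a1 0 ltac:(by rewrite scale0r).
pose J : set R := [set t | - e0 < t /\ t < 1 + e1].
have JI : interval_nbhs 0 1 J.
  split.
  - have -> : J = [set t | - e0 < t] `&` [set t | t < 1 + e1] by [].
    by apply: openI; [exact: open_gt|exact: open_lt].
  - move=> x y [x1 x2] [y1 y2] z /andP[xz zy]; split.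
      exact: lt_le_trans xz.
    exact: le_lt_trans y2.
  - move=> t; rewrite /= in_itv /= => /andP[t0 t1]; split; lra.
have cJ0 t : J t -> t <= 0 -> chart_cod Xi ((t - 0) *: a0).
  move=> [j0 j1] t0; rewrite subr0; apply: ce0.
  by rewrite sub0r normrN ler0_norm// ltrNl.
have cJ1 t : J t -> 1 <= t -> chart_cod Xi ((t - 1) *: a1).
  move=> [j0 j1] t1; apply: ce1.
  by rewrite sub0r normrN ger0_norm ?subr_ge0// ltrBlDl.
pose L t := (exp ((t - 0) *: a0)%R * mu 0%R)%g.
pose Q t := (exp ((t - 1) *: a1)%R * mu 1%R)%g.
pose nu := patch_at 0 L (patch_at 1 mu Q).
pose b := patch_at 0 (fun t => omega Xi ((t - 0) *: a0) a0)
  (patch_at 1 (dXi Xi \o psi) (fun t => omega Xi ((t - 1) *: a1) a1)).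
have L0 : L 0 = mu 0 by rewrite /L subrr scale0r exp0// mul1g.
have Q1 : Q 1 = mu 1 by rewrite /Q subrr scale0r exp0// mul1g.
have lt01 : (0 : R) < 1 by exact: ltr01.
have om0 : omega Xi ((0 - 0) *: a0) a0 = a0 by rewrite subrr scale0r omega0.
have om1 : omega Xi ((1 - 1) *: a1) a1 = a1 by rewrite subrr scale0r omega0.
have b01 t : 0 <= t -> t <= 1 -> b t = dXi Xi (phi t).
  move=> t0 t1; have t01 : t \in `[0, 1] by rewrite in_itv /= t0.
  rewrite /b patch_at_ge//; move: t1; rewrite le_eqVlt => /predU1P[e|t1].
    by rewrite patch_at_ge ?e// om1.
  by rewrite patch_at_lt//= ppsi.
have bLt t : t < 0 -> b t = omega Xi ((t - 0) *: a0) a0 by move=> t0; rewrite /b patch_at_lt.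
have bGt t : 1 < t -> b t = omega Xi ((t - 1) *: a1) a1.
  by move=> t1; rewrite /b patch_at_ge ?(ltW (lt_trans lt01 t1))// patch_at_ge// ltW.
have nub t : J t -> Rd Xi (0:R)^' nu t (b t).
  move=> Jt; apply: Rd_sides.
    apply: Rd_patch_right => [t0|t0].
      rewrite bLt//; apply: Rd_at_right; apply: Rd_line.
      by apply: cJ0 => //; exact: ltW.
    apply: Rd_patch_right => [t1|t1].
      by rewrite b01//; [exact: mr|exact: ltW].
    have -> : b t = omega Xi ((t - 1) *: a1) a1.
      move: t1; rewrite le_eqVlt => /predU1P[<-|]; last exact: bGt.
      by rewrite b01// om1.
    by apply: Rd_at_right; apply: Rd_line; exact: cJ1.
  apply: Rd_patch_left => [|t0|t0]; first by rewrite patch_at_lt.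
    have -> : b t = omega Xi ((t - 0) *: a0) a0.
      move: t0; rewrite le_eqVlt => /predU1P[->|]; last exact: bLt.
      by rewrite b01// om0.
    by apply: Rd_at_left; apply: Rd_line; exact: cJ0.
  apply: Rd_patch_left => [//|t1|t1].
    by rewrite b01//; [exact: ml|exact: ltW].
  rewrite bGt//; apply: Rd_at_left; apply: Rd_line; apply: cJ1 => //; exact: ltW.
have psic t : 0 <= t -> t <= 1 -> {for t, continuous (dXi Xi \o psi)}.
  move=> t0 t1; have t01 : t \in `[0, 1] by rewrite in_itv /= t0.
  have pc : {for t, continuous (psi : R^o -> E)}.
    by apply: (Ckp_cont (Ck_Ckp Cpsi)); exact: J01.
  apply: (@continuous_comp R E E psi (dXi Xi) t pc).
  exact: (dXi_continuous hE Xi_chart Xi_dom1).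
have bc t : J t -> {for t, continuous b}.
  move=> Jt; apply: patch_at_continuous => [|t0|t0].
  - rewrite patch_at_lt//= om0 -ppsi//; by rewrite in_itv /= lexx ler01.
  - by apply: omega_line_continuous; exact: cJ0.
  apply: patch_at_continuous => [|t1|t1].
  - rewrite /= om1 -ppsi//; by rewrite in_itv /= lexx ler01.
  - exact: psic.
  - by apply: omega_line_continuous; exact: cJ1.
have Cnu := C1_curve_Rd hE Xi_chart Xi_dom1 Xi1 JI nub bc.
exists nu => // t t01.
have Jt : J t by have [_ _ J01'] := JI; exact: J01'.
rewrite -(dXiK hE Xi_chart Xi_dom1 Xi1 (phi t)).
rewrite -(dXiK hE Xi_chart Xi_dom1 Xi1 (deltar nu t)).
have e := Rd_unique hE (nub t Jt) (Rd_C1_curve hE Xi_chart Xi_dom1 Xi1 Cnu t01).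
by rewrite -e b01//; move: t01; rewrite in_itv /= => /andP[].
Qed.

(** The pointwise limit of the product integrals has the uniform limit psi as
    its one-sided logarithmic derivatives, and psi is continuous. *)
Lemma Dset_limit (phi : nat -> R -> lie_alg G) (psi : R -> lie_alg G)
    (mu : R -> G) : (forall n, DP0 Xi (phi n)) -> cvg_unif Xi phi psi ->
  C_curve Xi (Cfin 0) 0 1 psi ->
  (forall t, t \in `[0, 1] -> pw_prodint Xi (phi n) t @[n --> \oo] --> mu t) ->
  Dset 0 1 psi.
Proof.
move=> Dphi cphi Cpsi Pmu; apply: (Dset_of_Rd (mu := mu)) => //.
- move=> t t0 t1.
  apply: (limit_Rd_right hE Xi_chart Xi_dom1 Xi1 G_mu_convex
    (P := fun n => pw_prodint Xi (phi n)) (b := fun n => dXi Xi \o phi n)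
    (tau := 1 - t)).
  + by rewrite subr_gt0.
  + move=> n; have [gn _] := pw_prodint_good hE Xi_chart Xi_dom1 Xi1 G_mu_convex (Dphi n).
    by apply: good_sub gn; rewrite ?t0// subrKC.
  + move=> p e e0; have e2 : 0 < e / 2 by rewrite divr_gt0.
    have [cr _] := C_curve0_cvg hE Xi_chart Xi_dom1 t Cpsi.
    have H : \forall h \near (0:R)^'+, p (dXi Xi (psi (t + h)) - dXi Xi (psi t)) < e / 2.
      by have /cvg_snP := cr t0 t1; apply.
    have H' : \forall h \near (0:R)^'+, t < t + h < 1 /\
        p (dXi Xi (psi (t + h)) - dXi Xi (psi t)) < e / 2.
      exact: filterI (near_right_itv t1) H.
    have [d d0 dp] := (near_rightE _).1 H'.
    exists d => //; apply: filterS (cvg_unifP hE Xi_chart Xi_dom1 cphi p e2) => n pn s ts sd.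
    have [/andP[_ s1]] := dp (s - t) ltac:(by rewrite subr_gt0) ltac:(by rewrite ltrBlDl).
    rewrite subrKC in s1 *; move=> p1.
    have p2 := pn s ltac:(by rewrite in_itv /= !ltW// (le_lt_trans t0)).
    have := sn_trg p (dXi Xi (phi n s)) (dXi Xi (psi s)) (dXi Xi (psi t)).
    rewrite /=; lra.
  + move=> s ts s1; apply: Pmu; rewrite in_itv /= (le_trans t0 ts).
    by move: s1; rewrite subrKC.
- move=> t t0 t1.
  apply: (limit_Rd_left hE Xi_chart Xi_dom1 Xi1 G_mu_convex
    (P := fun n => pw_prodint Xi (phi n)) (bn := fun n => dXi Xi \o phi n)
    (tau := t)).
  + by [].
  + move=> n; have [gn _] := pw_prodint_good hE Xi_chart Xi_dom1 Xi1 G_mu_convex (Dphi n).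
    by apply: good_sub gn; rewrite ?subrr.
  + move=> p e e0; have e2 : 0 < e / 2 by rewrite divr_gt0.
    have [_ cl] := C_curve0_cvg hE Xi_chart Xi_dom1 t Cpsi.
    have H : \forall h \near (0:R)^'-, p (dXi Xi (psi (t + h)) - dXi Xi (psi t)) < e / 2.
      by have /cvg_snP := cl t0 t1; apply.
    have H' : \forall h \near (0:R)^'-, 0 < t + h < t /\
        p (dXi Xi (psi (t + h)) - dXi Xi (psi t)) < e / 2.
      exact: filterI (near_left_itv t0) H.
    have [d d0 dp] := (near_leftE _).1 H'.
    exists d => //; apply: filterS (cvg_unifP hE Xi_chart Xi_dom1 cphi p e2) => n pn s ts sd.
    have [/andP[s0 _]] := dp (s - t) ltac:(by rewrite subr_lt0) ltac:(by rewrite ltrBrDl).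
    rewrite subrKC in s0 *; move=> p1.
    have p2 := pn s ltac:(by rewrite in_itv /= (ltW s0) (le_trans (ltW sd))).
    have := sn_trg p (dXi Xi (phi n s)) (dXi Xi (psi s)) (dXi Xi (psi t)).
    rewrite /=; lra.
  + move=> s ts s1; apply: Pmu; rewrite in_itv /= (le_trans s1 t1) andbT.
    by move: ts; rewrite subrr.
Qed.

Lemma semiregular_of_limits k :
  (forall psi, C_curve Xi k 0 1 psi -> exists phi : nat -> R -> lie_alg G,
    [/\ forall n, DP0 Xi (phi n), cvg_unif Xi phi psi &
      forall t, t \in `[0, 1] -> exists g : G,
        pw_prodint Xi (phi n) t @[n --> \oo] --> g]) ->
  semiregular Xi k.
Proof.
move=> H; apply/seteqP; split=> psi; first by case.
move=> Cpsi; split=> //; have [phi [Dphi cphi lim]] := H psi Cpsi.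
pose mu t := xget 1%g [set g : G | pw_prodint Xi (phi n) t @[n --> \oo] --> g].
apply: (Dset_limit (mu := mu) Dphi cphi).
  exact: (C_curve_C0 hE Xi_chart Xi_dom1 Xi1 ler01 Cpsi).
move=> t /lim[g gt]; rewrite /mu; case: xgetP => [//|/(_ g)].
by move=> /(_ gt).
Qed.

Lemma null_double_seqP (lam : nat -> nat -> R) e : null_double_seq lam -> 0 < e ->
  exists N, forall m n, (N <= m)%N -> (N <= n)%N -> lam m n < e.
Proof.
move=> [_ lam0] e0.
have [[A B] [/= [N _ NA] [M _ MB]] AB] : filter_prod \oo \oo
    [set mn : nat * nat | lam mn.1 mn.2 < e].
  have ne : nbhs (0 : R) [set r : R | r < e] by exact: lt_nbhsl.
  exact: lam0 ne.
exists (maxn N M) => m n; rewrite !geq_max => /andP[Nm _] /andP[_ Mn].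
by apply: (AB (m, n)); split; [exact: NA|exact: MB].
Qed.

(** By [tame_estimate], the product integrals up to a fixed time form a
    Mackey-Cauchy sequence with the same rate lam as the integrands. *)
Lemma semiregular_mackey k : k <> Cfin 0 -> mackey_complete Xi -> confined Xi k ->
  semiregular Xi k.
Proof.
move=> kN0 Gm Gk; apply: semiregular_of_limits => psi Cpsi.
have [phi [Dphi tphi [c [l [lam [c0 lam0l cphi]]]] upsi]] : m_integrable Xi psi.
  by have := Gk psi Cpsi; case: (k) kN0 => [[|n]| |] // [].
exists phi; split=> // t t01; apply: Gm; have [lam0 _] := lam0l.
have /choice[w wP] := fun u => @tame_estimate phi u Dphi tphi.
have small u : exists N, forall m n, (N <= m)%N -> (N <= n)%N ->
    c (w u) * lam m n < 1.
  have c1 : 0 < (c (w u) + 1)^-1 by rewrite invr_gt0 ltr_wpDl.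
  have [N NP] := null_double_seqP lam0l c1; exists N => m n Nm Nn.
  apply: (@le_lt_trans _ _ (c (w u) * (c (w u) + 1)^-1)).
    by rewrite ler_wpM2l// ltW// NP.
  by rewrite ltr_pdivrMr ?mul1r ?ltrDl// ltr_wpDl.
have [N NP] := choice small.
exists (fun u => c (w u)), (fun u => maxn (N u) (l (w u))), lam; split=> //.
move=> u m n; rewrite !geq_max => /andP[m1 m2] /andP[n1 n2].
apply: (wP u m n _ _ _ _ t t01); [|exact: NP|exact: cphi].
by apply: mulr_ge0.
Qed.

Lemma semiregular_sequential : sequentially_complete Xi ->
  confined Xi (Cfin 0) -> semiregular Xi (Cfin 0).
Proof.
move=> Gs Gk; apply: semiregular_of_limits => psi Cpsi.
have [phi [Dphi tphi cphi upsi]] := Gk psi Cpsi.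
exists phi; split=> // t t01; apply: Gs => u e e0.
have [w wP] := @tame_estimate phi u Dphi tphi.
have half0 : 0 < 2^-1 :> R by rewrite invr_gt0.
have half1 : 2^-1 < 1 :> R by rewrite invf_lt1 ?ltr1n.
have e'0 : 0 < Num.min e 2^-1 by rewrite lt_min e0 half0.
have e'1 : Num.min e 2^-1 < 1 by rewrite gt_min half1 orbT.
have [N NP] := cphi w _ e'0; exists N => m n Nm Nn.
have [d le] := wP m n _ (ltW e'0) e'1 (NP m n Nm Nn) t t01.
by split=> //; apply: le_trans le _; rewrite ge_min lexx.
Qed.

End Sufficiency.

(** * Semiregularity implies confinement *)

Section Confinement.
Context {R : realType} {E : tvsType R} (hE : hausdorff_space E) (G : lieGroup E).
Context (Xi : chart G E) (Xi_chart : smooth_chart (lie_manifold G) Xi)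
  (Xi_dom1 : chart_dom Xi 1%g) (Xi1 : Xi 1%g = 0)
  (G_mu_convex : locally_mu_convex Xi).

(** Joint continuity at (g,0), and homogeneity in X. *)
Lemma AdE_bound_near (g : G) (v : cseminorm E) : exists2 q : cseminorm E,
  True & \forall g' \near g, forall X, v (AdE Xi g' X) <= q X.
Proof.
have ac := AdE_continuous hE Xi_chart Xi_dom1 Xi1 (g := g) (X := 0).
have [[W1 W2] [/= nW1 nW2] W12] : nbhs (g, 0 : E) [set z | v (AdE Xi z.1 z.2) < 1].
  have := ac [set Y | v Y < 1]; rewrite /= AdE0//; apply.
  by have := nbhs_sn v (0 : E) ltr01; apply: filterS => Y; rewrite subr0.
have [q qW2] := gauge nW2; exists q => //.
apply: filterS nW1 => g' W1g' X; apply/ler_addgt0Pr => e e0.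
have a0 : 0 < q X + e by rewrite ltr_wpDl ?sn_ge0.
have qX : q ((q X + e)^-1 *: X) < 1.
  rewrite seminormZ normfV gtr0_norm// mulrC ltr_pdivrMr// mul1r.
  by rewrite ltrDl.
have /= := W12 (g', (q X + e)^-1 *: X) (conj W1g' (qW2 _ qX)).
rewrite AdEZ// seminormZ normfV gtr0_norm// mulrC ltr_pdivrMr// mul1r.
exact: ltW.
Qed.

(** Compactness of [0,1]: the sum of the seminorms that serve two adjacent
    intervals serves their union. *)
Lemma AdE_bound_curve (P : R -> G) b (v : cseminorm E) : good Xi P b 0 1 ->
  exists q : cseminorm E, forall t, 0 <= t -> t <= 1 -> forall X,
    v (AdE Xi (P t)^-1%g X) <= q X.
Proof.
move=> [gr gl].
pose B s t := exists q : cseminorm E, forall r, s <= r -> r <= t -> forall X,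
  v (AdE Xi (P r)^-1%g X) <= q X.
have Bnear t : exists2 q : cseminorm E, True &
    \forall g \near P t, forall X, v (AdE Xi g^-1%g X) <= q X.
  have [q _ qn] := AdE_bound_near (P t)^-1%g v; exists q => //.
  exact: (@invG_continuous _ _ G (P t) _ qn).
suff : B 0 1 by [].
apply: creeping => //.
- have [q _ qn] := Bnear 0; exists q => r r0 r1 X.
  have -> : r = 0 by apply/eqP; rewrite eq_le r0 r1.
  exact: (nbhs_singleton qn).
- move=> s t u st tu _ _ [q qP] [q' qP']; exists (snadd q q') => r sr ru X.
  rewrite snaddE; case: (leP r t) => rt.
    by apply: le_trans (qP r sr rt X) _; rewrite lerDl sn_ge0.
  by apply: le_trans (qP' r (ltW rt) ru X) _; rewrite lerDr sn_ge0.
- move=> t t0 t1; have [q _ qn] := Bnear t; have [X _ [Pc _]] := gr t t0 t1.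
  have Pn : \forall h \near (0:R)^'+, forall X, v (AdE Xi (P (t + h))^-1%g X) <= q X.
    exact: (Pc _ qn).
  have [d d0 dP] := (near_rightE _).1 Pn.
  apply/near_rightE; exists d => // h h0 hd; exists q => r tr rh Y.
  move: tr; rewrite le_eqVlt => /predU1P[<-|tr]; first exact: (nbhs_singleton qn).
  have := dP (r - t); rewrite subrKC; apply; first by rewrite subr_gt0.
  by rewrite ltrBlDl (le_lt_trans rh)// ltrD2l.
- move=> t t0 t1; have [q _ qn] := Bnear t; have [X _ [Pc _]] := gl t t0 t1.
  have Pn : \forall h \near (0:R)^'-, forall X, v (AdE Xi (P (t + h))^-1%g X) <= q X.
    exact: (Pc _ qn).
  have [d d0 dP] := (near_leftE _).1 Pn.
  apply/near_leftE; exists d => // h h0 hd; exists q => r tr rh Y.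
  move: rh; rewrite le_eqVlt => /predU1P[->|rh]; first exact: (nbhs_singleton qn).
  have := dP (r - t); rewrite subrKC; apply; first by rewrite subr_lt0.
  by rewrite ltrBrDl (lt_le_trans _ tr)// ltrD2l.
Qed.

(** The constant sequence converges to its value and consists of integrable curves;
    it is tame because the adjoint action is bounded along the product integral. *)
Lemma semiregular_confined k : k <> Cfin 0 -> semiregular Xi k -> confined Xi k.
Proof.
move=> kN0 sk psi Cpsi; suff : m_integrable Xi psi.
  by case: (k) kN0 => [[|n]| |].
have [Dpsi _] : Dk Xi k 0 1 psi by rewrite sk.
have C0 := C_curve_C0 hE Xi_chart Xi_dom1 Xi1 ler01 Cpsi.
have DP : DP0 Xi psi.
  exists 1%N, (fun i => i%:R), (fun=> psi); split=> // p.
  by rewrite ltnS leqn0 => /eqP ->; split=> //; exact: ltr01.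
have sup0 (p : cseminorm E) : sdot_sup Xi p (fun t => (psi t - psi t)%R) = 0%E.
  apply/eqP; rewrite eq_le; apply/andP; split.
    by apply/sdot_sup_le => t _; rewrite dXiB// subrr sn0.
  apply: ereal_sup_ubound; exists 0; first by rewrite /= in_itv /= lexx ler01.
  by rewrite /sdot dXiB// subrr sn0.
exists (fun=> psi); split=> //.
- move=> v.
  have [gP _] := pw_prodint_good hE Xi_chart Xi_dom1 Xi1 G_mu_convex DP.
  have [q qP] := AdE_bound_curve v gP; exists (snadd v q).
    by move=> x; rewrite snaddE lerDl sn_ge0.
  move=> _ t; rewrite in_itv /= => /andP[t0 t1] X.
  rewrite /sdot dXi_Ad//; apply: le_trans (qP t t0 t1 _) _.
  by rewrite /= /snadd_fun lerDr sn_ge0.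
- exists (fun=> 0), (fun=> 0%N), (fun _ _ => 0); split=> //.
    by split=> //; exact: cvg_cst.
  by move=> p m n _ _; rewrite sup0 mul0r.
- move=> p; apply: cvg_near_cst; apply: nearW => n; exact: sup0.
Qed.

End Confinement.

(** * A smooth transition function *)

Section Bump.
Context {R : realType}.

(** The derivatives of exp(-1/t) are combinations of these functions. *)
Definition flat (n : nat) (t : R) : R :=
  if 0 < t then t^-1 ^+ n * expR (- t^-1) else 0.

Lemma flat_le0 n t : t <= 0 -> flat n t = 0.
Proof. by rewrite /flat ltNge => ->. Qed.

Lemma flat_ge0 n t : 0 <= flat n t.
Proof.
rewrite /flat; case: ltP => // t0.
by rewrite mulr_ge0 ?expR_ge0// exprn_ge0// invr_ge0 ltW.
Qed.

(** From expR x >= x^(n+1) / (n+1)! for x = 1/t. *)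
Lemma flat_le n t : 0 <= t -> flat n t <= n.+1`!%:R * t.
Proof.
rewrite le_eqVlt => /predU1P[<-|t0]; first by rewrite flat_le0// mulr0.
rewrite /flat t0 expRN -[t in X in _ <= X]invrK.
have x0 : 0 < t^-1 by rewrite invr_gt0.
move: (t^-1) x0 => x x0.
have := expR_ge1Dxn n (ltW x0) => ex.
have f0 : 0 < n.+1`!%:R :> R by rewrite ltr0n fact_gt0.
rewrite ler_pdivrMr ?expR_gt0// mulrAC ler_pdivlMr//.
apply: (@le_trans _ _ (n.+1`!%:R * (x ^+ n.+1 / n.+1`!%:R))).
  by rewrite mulrCA divff ?gt_eqF// mulr1 exprSr.
by rewrite ler_wpM2l ?ltW//; lra.
Qed.

Lemma flat0_gt0 t : 0 < t -> 0 < flat 0 t.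
Proof. by move=> t0; rewrite /flat t0 expr0 mul1r expR_gt0. Qed.

Lemma flat0_mono s t : s <= t -> flat 0 s <= flat 0 t.
Proof.
move=> st; case: (leP s 0) => s0; first by rewrite flat_le0// flat_ge0.
have t0 := lt_le_trans s0 st.
by rewrite /flat s0 t0 !expr0 !mul1r ler_expR lerN2 lef_pV2.
Qed.

Lemma is_derive_quot (f : R -> R) (t d : R) : is_derive t 1 f d ->
  h^-1 *: (f (t + h) - f t : R^o) @[h --> (0:R)^'] --> (d : R^o).
Proof.
move=> [fd <-]; have := fd; rewrite /derivable => /cvg_ex[l fl].
have e : 'D_1 f t = l by apply: cvg_lim.
rewrite e; apply: cvg_trans fl; apply: near_eq_cvg; apply: nearW => h /=.
by rewrite [_ *: 1]mulr1 [h + t]addrC.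
Qed.

Lemma flat_derivative n t :
  h^-1 *: (flat n (t + h) - flat n t : R^o) @[h --> (0:R)^'] -->
    (flat n.+2 t - n%:R * flat n.+1 t : R^o).
Proof.
have cvt : t + h @[h --> (0:R)^'] --> t by exact: cvg_shift.
have [t0|t0|t0] := ltgtP t 0.
- rewrite !flat_le0 ?mulr0 ?subr0 ?ltW//.
  apply: cvg_near_cst.
  have n0 : \forall h \near (0:R)^', t + h < 0 by move/cvgr_lt : cvt; apply.
  by apply: filterS n0 => h /ltW h0; rewrite flat_le0// subrr scaler0.
- pose g (t : R) : R := t^-1.
  have gd : is_derive t 1 g (- t^-1 ^+ 2).
    have tN0 : t != 0 by rewrite gt_eqF.
    apply: DeriveDef; first exact: (derivableV (f := id)).
    by rewrite (deriveV (f := id))// derive_id [_ *: 1]mulr1 exprVn.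
  have ed : is_derive t 1 (expR \o (- g)) (expR (- t^-1) * - - t^-1 ^+ 2).
    exact: is_derive1_comp.
  have fd := is_deriveM (is_deriveX n gd) ed.
  have H := is_derive_quot fd.
  have nF : \forall h \near (0:R)^', 0 < t + h by move/cvgr_gt : cvt; apply.
  have -> : flat n.+2 t - n%:R * flat n.+1 t =
      (g ^+ n) t *: (expR (- t^-1) * - - t^-1 ^+ 2) +
      (expR \o - g) t *: ((n%:R * g t ^+ n.-1) *: - t^-1 ^+ 2).
    rewrite /flat t0 !exprfctE /= /g /GRing.scale /=.
    case: (n) => [|m]; first by rewrite /=; ring.
    by rewrite /= !exprS; ring.
  apply: cvg_trans H; apply: near_eq_cvg; apply: filterS nF => h h0.
  by rewrite /flat t0 h0 /= !exprfctE.
rewrite t0 !(flat_le0 _ (lexx 0)) mulr0 subrr.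
apply: near_dnbhs_sides.
  have c0 : n.+2`!%:R * h @[h --> (0:R)^'+] --> (0 : R).
    have idr : h @[h --> (0:R)^'+] --> (0 : R).
      by move=> U U0; apply: at_right_dnbhs; exact: nbhs_dnbhs.
    by rewrite -[X in _ --> X](mulr0 n.+2`!%:R); apply: cvgMr.
  have c00 : (0 : R) @[h --> (0:R)^'+] --> (0 : R) by exact: cvg_cst.
  apply: (squeeze_cvgr _ c00 c0).
  have n0 : \forall h \near (0:R)^'+, 0 < h by exact: nbhs_right_gt.
  apply: filterS n0 => h h0; rewrite add0r subr0.
  have -> : h^-1 *: (flat n h : R^o) = flat n.+1 h.
    by rewrite /flat h0 exprS -mulrA.
  by rewrite flat_ge0 flat_le ?ltW.
apply: cvg_near_cst; apply: filterS (nbhs_left_lt 0) => h h0.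
by rewrite add0r (flat_le0 _ (ltW h0)) subr0 scaler0.
Qed.

Lemma quot_continuous (F : tvsType R) (f : R -> F) t (d : F) :
  h^-1 *: (f (t + h) - f t) @[h --> (0:R)^'] --> d -> {for t, continuous f}.
Proof.
move=> fd.
have fc : f (t + h) @[h --> (0:R)^'] --> f t.
  have H : f t + h *: (h^-1 *: (f (t + h) - f t)) @[h --> (0:R)^'] --> f t + 0 *: d.
    apply: tcvgD; first exact: cvg_cst.
    by apply: tcvgZ => //; exact: nbhs_dnbhs.
  rewrite scale0r addr0 in H; apply: cvg_trans H; apply: near_eq_cvg.
  apply: filterS near_dnbhs0_neq => h h0.
  by rewrite scalerA divff// scale1r subrKC.
suff : f s @[s --> t] --> f t by [].
have : f (t + h) @[h --> (0:R)] --> f t.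
  move=> U Ut; have := fc U Ut; rewrite /nbhs /= /dnbhs /within /=.
  apply: filterS => h Hh; case: (pselect (h = 0)) => [->|/eqP h0].
    by rewrite /= addr0; exact: nbhs_singleton.
  exact: Hh.
move=> m0; have st : s - t @[s --> t] --> (0 : R).
  by rewrite -(subrr t); apply: cvgB; [exact: cvg_id|exact: cvg_cst].
apply: cvg_trans (cvg_comp _ _ st m0); apply: near_eq_cvg.
by apply: nearW => s; rewrite /= subrKC.
Qed.

(** The differential of a curve in the direction v is v times its derivative, so
    that a chain of successive derivatives consists of smooth curves. *)
Lemma Sm_curve (F : tvsType R) k (f f' : R -> F) :
  (forall t, h^-1 *: (f (t + h) - f t) @[h --> (0:R)^'] --> f' t) ->
  @Sm R k R^o F setT f' -> @Sm R k.+1 R^o F setT f.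
Proof.
move=> ff' Sf'; split; first by move=> t _; exact: quot_continuous (ff' t).
exists (fun z => (z.2 : R^o) *: f' z.1); split.
  move=> t v _; have := has_dderivZ (a := v) ((has_dderiv_R _ _ _).2 (ff' t)).
  by rewrite [_ *: (1 : R^o)]mulr1.
have oT : open ([set: R^o] `*` [set: R^o]) by apply: open_setXT; exact: openT.
apply: (Sm_scale oT); first exact: Sm_snd.
apply: (Sm_comp oT openT _ (@Sm_fst _ _ _ _ _) Sf') => //.
Qed.

Lemma Sm_flat k n : @Sm R k R^o R^o setT (flat n).
Proof.
elim: k n => [|k IH] n.
  by apply: Sm0 => t _; exact: quot_continuous (@flat_derivative n t).
apply: (Sm_curve (@flat_derivative n)).
have oT : open [set: R^o] by exact: openT.
apply: (Sm_add oT (IH n.+2)).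
apply: (@Sm_congr _ _ _ _ _ (fun t => (- n%:R : R^o) *: (flat n.+1 t : R^o))) => //.
  by move=> t _; rewrite /GRing.scale /= mulNr.
by apply: (Sm_scale oT) => //; exact: Sm_cst.
Qed.

(** With a := flat 0 (1/2): for s >= 3/4 the argument a - flat 0 (s - 1/4) of the
    outer function is nonpositive, and for s <= 1/4 it equals a. *)
Definition rho (s : R) : R :=
  1 - (flat 0 (flat 0 2^-1))^-1 * flat 0 (flat 0 2^-1 - flat 0 (s - 4^-1)).

Let c0 : 0 < flat 0 (flat 0 2^-1).
Proof. by apply: flat0_gt0; apply: flat0_gt0; rewrite invr_gt0. Qed.

Lemma Sm_rho k : @Sm R k R^o R^o setT rho.
Proof.
have oT : open [set: R^o] by exact: openT.
pose c : R := flat 0 2^-1.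
have S1 : @Sm R k R^o R^o setT (fun s => s - 4^-1).
  by apply: (Sm_add oT (@Sm_id _ _ _ _)); exact: Sm_cst.
have S2 := Sm_comp oT oT (fun _ _ => I) S1 (Sm_flat k 0).
have neg (f : R -> R) : @Sm R k R^o R^o setT f -> @Sm R k R^o R^o setT (fun s => - f s).
  move=> Sf; apply: (@Sm_congr _ _ _ _ _ (fun s => (-1 : R^o) *: (f s : R^o))) => //.
    by move=> t _; rewrite scaleN1r.
  by apply: (Sm_scale oT) => //; exact: Sm_cst.
have S3 : @Sm R k R^o R^o setT (fun s => c - flat 0 (s - 4^-1)).
  by apply: (Sm_add oT); [exact: Sm_cst|exact: neg S2].
have S4 := Sm_comp oT oT (fun _ _ => I) S3 (Sm_flat k 0).
apply: (Sm_add oT); first exact: Sm_cst.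
apply: neg.
exact: (Sm_scale oT (@Sm_cst _ k _ _ _ ((flat 0 c)^-1 : R^o)) S4).
Qed.

Lemma rho0 s : s <= 4^-1 -> rho s = 0.
Proof.
move=> s0; rewrite /rho (@flat_le0 _ (s - 4^-1)) ?subr_le0// subr0.
by rewrite mulVf ?subrr// gt_eqF.
Qed.

Lemma rho1 s : 3 * 4^-1 <= s -> rho s = 1.
Proof.
move=> s1; rewrite /rho (@flat_le0 _ (_ - _)) ?mulr0 ?subr0//.
by rewrite subr_le0; apply: flat0_mono; lra.
Qed.

Lemma rho_ge0 s : 0 <= rho s.
Proof.
rewrite /rho subr_ge0 ler_pdivrMl// mulr1; apply: flat0_mono.
by rewrite gerBl flat_ge0.
Qed.

Lemma rho_le1 s : rho s <= 1.
Proof. by rewrite /rho gerBl mulr_ge0 ?flat_ge0// invr_ge0 ltW. Qed.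

End Bump.

(** * Exponentials of bumped lines *)

Section UniformBound.
Context {R : realType} {E F : tvsType R} (hF : hausdorff_space F).

(** A C^1 map g(s,X) that vanishes for X = 0 is dominated by a seminorm of X,
    uniformly for s in a compact interval.  Near each s this is the mean value
    inequality along t |-> g(s,tX), whose derivative is small, hence bounded by a
    seminorm of X by homogeneity; compactness of [0,1] does the rest. *)
Lemma uniform_bound (V : set E) (g : R^o * E -> F) : open V -> V 0 ->
  Sm 1 (setT `*` V) g -> (forall s, g (s, 0) = 0) ->
  forall p : cseminorm F, exists q : cseminorm E, forall s : R, 0 <= s -> s <= 1 ->
    forall X, q X <= 1 -> V X /\ p (g (s, X)) <= q X.
Proof.
move=> oV V0 Sg g0 p.
have oU : open ([set: R^o] `*` V) by apply: open_setX => //; exact: openT.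
have [dg Sdg] := Sm_dderiv hF oU Sg.
pose B s t := exists q : cseminorm E, forall r, s <= r -> r <= t ->
  forall X, q X <= 1 -> V X /\ p (g (r, X)) <= q X.
have loc (s0 : R) : exists2 q : cseminorm E, True & \forall r \near s0,
    forall X, q X <= 1 -> V X /\ p (g (r, X)) <= q X.
  have dc : {for ((s0 : R^o, 0 : E), (0 : R^o, 0 : E)),
      continuous (fun z => dderiv g z.1 z.2)}.
    by apply: (Sm_cont Sdg).
  have d0 : dderiv g (s0 : R^o, 0 : E) (0 : R^o, 0 : E) = 0.
    apply: (dderivE hF); apply: cvg_near_cst; apply: nearW => h.
    by rewrite scaler0 addr0 subrr scaler0.
  have : nbhs ((s0 : R^o, 0 : E), (0 : R^o, 0 : E))
      [set z | p (dderiv g z.1 z.2) < 1].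
    apply: (dc [set Y | p Y < 1]); rewrite /= d0.
    by have := nbhs_sn p (0 : F) ltr01; apply: filterS => Y; rewrite subr0.
  move=> [[A A'] [/= [[A1 A2] [/= nA1 nA2] A12] [[B1 B2] [/= nB1 nB2] B12]] AA'].
  have nV : nbhs (0 : E) V by exact: open_nbhs_nbhs.
  have [q qP] := gauge (filterI (filterI nA2 nB2) nV).
  have dbound r X Y : A1 r -> q X < 1 -> p (dderiv g (r, X) (0 : R^o, Y)) <= q Y.
    move=> A1r qX; have [[A2X _] VX] := qP X qX.
    apply/ler_addgt0Pr => e e0.
    have a0 : 0 < q Y + e by rewrite ltr_wpDl ?sn_ge0.
    have qY : q ((q Y + e)^-1 *: Y) < 1.
      rewrite seminormZ normfV gtr0_norm// mulrC ltr_pdivrMr// mul1r.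
      by rewrite ltrDl.
    have [[_ B2Y] _] := qP _ qY.
    have := AA' ((r, X), (0 : R^o, (q Y + e)^-1 *: Y)); rewrite /=.
    have -> : (0 : R^o, (q Y + e)^-1 *: Y) = (q Y + e)^-1 *: (0 : R^o, Y).
      by congr pair; rewrite /= scaler0.
    rewrite (dderivZ hF _ _ oU Sg); last by [].
    rewrite seminormZ normfV gtr0_norm// mulrC ltr_pdivrMr// mul1r => H.
    apply/ltW/H; split; first by apply: A12; split.
    apply: B12; split => /=; last exact: B2Y.
    by rewrite scaler0; exact: nbhs_singleton nB1.
  have q2 : 0 <= 2 :> R by [].
  exists (snscale q q2) => //; apply: filterS nA1 => r A1r X /= qX.
  have q0 := sn_ge0 q X.
  have qX1 : q X < 1 by lra.
  split; first by have [] := qP X qX1.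
  have := @mean_value _ _ p (fun t => g (r, t *: X)) 0 1 (q X) ler01.
  rewrite scale1r scale0r g0 !subr0 mulr1 => mv.
  have {mv}mv : p (g (r, X)) <= q X; last by lra.
  have der t : 0 <= t -> t <= 1 -> exists2 Y,
      h^-1 *: (g (r, (t + h) *: X) - g (r, t *: X)) @[h --> (0:R)^'] --> Y & p Y <= q X.
    move=> t0 t1; have qtX : q (t *: X) < 1.
      rewrite seminormZ ger0_norm//; apply: le_lt_trans qX1.
      by rewrite ler_piMl.
    exists (dderiv g (r, t *: X) (0 : R^o, X)); last exact: dbound.
    have [_ VtX] := qP _ qtX.
    have H := dg (r, t *: X) (0 : R^o, X) (conj I VtX).
    apply: cvg_trans H; apply: near_eq_cvg; apply: nearW => h.
    congr (_ *: (g _ - _)); congr pair; rewrite /= ?scaler0 ?addr0//.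
    by rewrite scalerDl.
  apply: mv => t t0 t1.
    have [Y HY pY] := der t t0 (ltW t1); exists Y => //.
    by apply: cvg_trans HY; apply: cvg_app; exact: at_right_dnbhs.
  have [Y HY pY] := der t (ltW t0) t1; exists Y => //.
  by apply: cvg_trans HY; apply: cvg_app; exact: at_left_dnbhs.
suff : B 0 1 by [].
have shr t : t + h @[h --> (0:R)^'+] --> t by exact: cvg_shift (@at_right_dnbhs _ 0).
have shl t : t + h @[h --> (0:R)^'-] --> t by exact: cvg_shift (@at_left_dnbhs _ 0).
apply: creeping => //.
- have [q _ qn] := loc 0; exists q => r r0 r1.
  have -> : r = 0 by apply/eqP; rewrite eq_le r0 r1.
  exact: (nbhs_singleton qn).
- move=> s t u st tu _ _ [q qP] [q' qP']; exists (snadd q q') => r sr ru X.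
  rewrite snaddE => qq; have := sn_ge0 q X; have := sn_ge0 q' X => h1 h2.
  case: (leP r t) => rt.
    by have [VX pX] := qP r sr rt X ltac:(lra); split=> //; lra.
  by have [VX pX] := qP' r (ltW rt) ru X ltac:(lra); split=> //; lra.
- move=> t t0 t1; have [q _ qn] := loc t.
  have [d d0 dP] := (near_rightE _).1 (shr t _ qn).
  apply/near_rightE; exists d => // h h0 hd; exists q => r tr rh.
  move: tr; rewrite le_eqVlt => /predU1P[<-|tr]; first exact: (nbhs_singleton qn).
  have := dP (r - t); rewrite /= subrKC; apply; first by rewrite subr_gt0.
  by rewrite ltrBlDl (le_lt_trans rh)// ltrD2l.
- move=> t t0 t1; have [q _ qn] := loc t.
  have [d d0 dP] := (near_leftE _).1 (shl t _ qn).
  apply/near_leftE; exists d => // h h0 hd; exists q => r tr rh.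
  move: rh; rewrite le_eqVlt => /predU1P[->|rh]; first exact: (nbhs_singleton qn).
  have := dP (r - t); rewrite /= subrKC; apply; first by rewrite subr_lt0.
  by rewrite ltrBrDl (lt_le_trans _ tr)// ltrD2l.
Qed.

End UniformBound.

Section BumpedLine.
Context {R : realType} {E : tvsType R} (hE : hausdorff_space E) (G : lieGroup E).
Context (Xi : chart G E) (Xi_chart : smooth_chart (lie_manifold G) Xi)
  (Xi_dom1 : chart_dom Xi 1%g) (Xi1 : Xi 1%g = 0)
  (Xi_convex : convex_set (chart_cod Xi)).

Lemma hausR : hausdorff_space (R^o : tvsType R).
Proof. exact: (@norm_hausdorff R R^o). Qed.

Definition drho (s : R) : R := @dderiv R R^o R^o rho s 1.

(** [Om 0 (s,X)] is the logarithmic derivative of s |-> exp(rho(s)X) and [Om i] its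
    i-th derivative in s. *)
Fixpoint Om (i : nat) : R^o * E -> E :=
  if i is i'.+1 then fun z => dderiv (Om i') z (1, 0)
  else fun z => drho z.1 *: omega Xi (rho z.1 *: z.2) z.2.

Lemma scale_cod (t : R) X : 0 <= t -> t <= 1 -> chart_cod Xi X ->
  chart_cod Xi (t *: X).
Proof.
move=> t0 t1 cX; have /convexP cC := Xi_convex.
have := cC X 0 t cX (cod0 Xi_dom1 Xi1) t0 t1.
by rewrite scaler0 addr0.
Qed.

Lemma Smat_pair k (F H K : tvsType R) (f : F -> H) (g : F -> K) x :
  Smat k f x -> Smat k g x -> Smat k (fun y => (f y, g y)) x.
Proof.
move=> [U [oU Ux Sf]] [V [oV Vx Sg]]; exists (U `&` V); split=> //.
  exact: openI.
by apply: Sm_pair; [apply: Sm_sub Sf => y []|apply: Sm_sub Sg => y []].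
Qed.

Lemma Smat_scale k (F H : tvsType R) (a : F -> R^o) (f : F -> H) x :
  Smat k a x -> Smat k f x -> Smat k (fun y => a y *: f y) x.
Proof.
move=> Sa Sf; apply: (@Smat_comp _ k _ _ _ (fun y => (a y, f y))
  (fun z : R^o * H => z.1 *: z.2)); first exact: Smat_pair.
by exists setT; split=> //; [exact: openT|exact: Sm_scale_aux].
Qed.

Lemma Smat_rho k (s : R^o) : Smat k (rho : R^o -> R^o) s.
Proof. by exists setT; split=> //; [exact: openT|exact: Sm_rho]. Qed.

Lemma Smat_drho k (s : R^o) : Smat k (drho : R^o -> R^o) s.
Proof.
apply: (@Smat_comp _ k _ _ _ (fun s : R^o => (s, 1 : R^o))
  (fun z : R^o * R^o => @dderiv R R^o R^o rho z.1 z.2)).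
  apply: Smat_pair; first exact: Smat_id.
  by exists setT; split=> //; [exact: openT|exact: Sm_cst].
by apply: (Smat_dderiv hausR); exact: Smat_rho.
Qed.

Let oU : open ([set: R^o] `*` chart_cod Xi).
Proof. by apply: open_setX; [exact: openT|exact: chart_cod_open]. Qed.

Lemma Sm_Om i k : Sm k ([set: R^o] `*` chart_cod Xi) (Om i).
Proof.
elim: i k => [|i IH] k.
  apply: (Sm_local hE) => -[s X] [_ /= cX].
  apply: Smat_scale.
    exact: (@Smat_comp _ k _ _ _ fst (drho : R^o -> R^o) (s, X)
      (@Smat_fst _ k _ _ _) (Smat_drho k s)).
  apply: (@Smat_comp _ k _ _ _ (fun z : R^o * E => (rho z.1 *: z.2, z.2))
    (fun z : E * E => omega Xi z.1 z.2)).
    apply: Smat_pair; last exact: Smat_snd.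
    apply: Smat_scale; last exact: Smat_snd.
    exact: (@Smat_comp _ k _ _ _ fst (rho : R^o -> R^o) (s, X)
      (@Smat_fst _ k _ _ _) (Smat_rho k s)).
  apply: (Smat_omega hE Xi_chart Xi_dom1).
  by apply: scale_cod; [exact: rho_ge0|exact: rho_le1|].
have [_ SO] := Sm_dderiv hE oU (IH k.+1).
apply: (Sm_comp (f := fun z : R^o * E => (z, (1 : R^o, 0 : E))) oU (open_setXT oU) _ _ SO).
  by move=> z Uz; split.
by apply: Sm_pair; [exact: Sm_id|exact: Sm_cst].
Qed.

Lemma Om_derivative i (s : R) X : chart_cod Xi X ->
  h^-1 *: (Om i (s + h, X) - Om i (s, X)) @[h --> (0:R)^'] --> Om i.+1 (s, X).
Proof.
move=> cX; have [dO _] := Sm_dderiv hE oU (Sm_Om i 1).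
have H := dO (s, X) (1 : R^o, 0 : E) (conj I cX).
apply: cvg_trans H; apply: near_eq_cvg; apply: nearW => h.
congr (_ *: (Om i _ - _)); congr pair; rewrite /= ?scaler0 ?addr0//.
by rewrite [_ *: (1 : R^o)]mulr1.
Qed.

Lemma Om_X0 i s : Om i (s, 0) = 0.
Proof.
elim: i s => [|i IH] s.
  by rewrite /= scaler0 -[X in omega _ _ X](scale0r (0 : E)) omegaZ//
    ?scale0r ?scaler0//; exact: cod0.
apply: (cvg_unique hE (@Om_derivative i s 0 (cod0 Xi_dom1 Xi1))).
by apply: cvg_near_cst; apply: nearW => h; rewrite !IH subrr scaler0.
Qed.

(** Each derivative vanishes where the preceding one is locally constant. *)
Lemma Om_flat i (O : set R) s X : open O -> O s -> chart_cod Xi X ->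
  (forall r, O r -> drho r = 0) -> Om i (s, X) = 0.
Proof.
move=> oO + cX O0; elim: i s => [|i IH] s Os.
  by rewrite /= O0// scale0r.
apply: (cvg_unique hE (@Om_derivative i s X cX)).
apply: cvg_near_cst.
have sh : s + h @[h --> (0:R)^'] --> s by exact: cvg_shift.
have nO : \forall h \near (0:R)^', O (s + h).
  by apply: sh; exact: open_nbhs_nbhs.
by apply: filterS nO => h Oh; rewrite !IH// subrr scaler0.
Qed.

Lemma drho_flat (O : set R) c : open O -> (forall r, O r -> rho r = c) ->
  forall r, O r -> drho r = 0.
Proof.
move=> oO Oc r Or; apply: (dderivE hausR).
apply: (@has_dderiv_congr _ _ _ (fun=> c)); last exact: has_dderiv_cst.
have : nbhs r O by exact: open_nbhs_nbhs.
by apply: filterS => x /Oc.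
Qed.

Lemma Om_left i s X : s <= 0 -> chart_cod Xi X -> Om i (s, X) = 0.
Proof.
move=> s0 cX; have o : open [set r : R | r < 4^-1] by exact: open_lt.
apply: (Om_flat i o) => //=.
  by rewrite (le_lt_trans s0)// invr_gt0.
by apply: (drho_flat (c := 0) o) => r /ltW; exact: rho0.
Qed.

Lemma Om_right i s X : 1 <= s -> chart_cod Xi X -> Om i (s, X) = 0.
Proof.
move=> s0 cX; have o : open [set r : R | 3 * 4^-1 < r] by exact: open_gt.
apply: (Om_flat i o) => //=; first by lra.
by apply: (drho_flat (c := 1) o) => r /ltW; exact: rho1.
Qed.

Lemma Om_bound i (p : cseminorm E) : exists q : cseminorm E,
  forall s : R, 0 <= s -> s <= 1 -> forall X, q X <= 1 ->
    chart_cod Xi X /\ p (Om i (s, X)) <= q X.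
Proof.
apply: (uniform_bound hE) => //; [exact: chart_cod_open|exact: cod0|exact: Sm_Om|].
exact: Om_X0.
Qed.

Lemma Rd_bumped (X : E) (g : G) (r t1 t : R) : chart_cod Xi X ->
  Rd Xi (0:R)^' (fun s => chart_inv Xi (rho (r * (s - t1)) *: X) * g)%g t
    (r *: Om 0 (r * (t - t1), X)).
Proof.
move=> cX; have crX s : chart_cod Xi (rho s *: X).
  by apply: scale_cod; [exact: rho_ge0|exact: rho_le1|].
have -> : r *: Om 0 (r * (t - t1), X) =
    omega Xi (rho (r * (t - t1)) *: X) ((r * drho (r * (t - t1))) *: X).
  by rewrite omegaZ// scalerA.
apply: (Rd_exp hE Xi_chart Xi_dom1 Xi1 (f := fun s => rho (r * (s - t1)) *: X)) => //.
have H : @has_dderiv R R^o R^o rho (r * (t - t1)) (r *: (1 : R^o))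
    (r *: (drho (r * (t - t1)) : R^o)).
  by apply: has_dderivZ; apply: (Smat_has_dderiv hausR); exact: Smat_rho.
have H2 : (h^-1 *: (rho (r * (t - t1) + h *: (r *: (1 : R^o))) - rho (r * (t - t1)))) *: X
    @[h --> (0:R)^'] --> (r * drho (r * (t - t1))) *: X.
  by apply: tcvgZ; [exact: H|exact: cvg_cst].
apply: cvg_trans H2; apply: near_eq_cvg; apply: nearW => h /=.
have -> : r * (t + h - t1) = r * (t - t1) + h *: (r *: (1 : R^o)).
  by rewrite /GRing.scale /=; ring.
rewrite -scalerBl; symmetry; exact: scalerA.
Qed.

End BumpedLine.

(** * The smooth sum of the bumps *)

Section BumpSeries.
Context {R : realType} {E : tvsType R} (hE : hausdorff_space E) (G : lieGroup E).
Context (Xi : chart G E) (Xi_chart : smooth_chart (lie_manifold G) Xi)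
  (Xi_dom1 : chart_dom Xi 1%g) (Xi1 : Xi 1%g = 0)
  (Xi_convex : convex_set (chart_cod Xi)).
Context (X : nat -> E) (cX : forall j, chart_cod Xi (X j)).

(** The j-th bump is supported in the interval from [node j] to [node j.+1], of
    length [(rate j)^-1]; these intervals fill [0,1[. *)
Definition rate (j : nat) : R := 2 ^+ j.+1.
Definition node (j : nat) : R := 1 - (2 ^+ j)^-1.

Let two_gt0 n : 0 < 2 ^+ n :> R. Proof. by rewrite exprn_gt0. Qed.

Lemma rate_gt0 j : 0 < rate j. Proof. exact: two_gt0. Qed.

Lemma node_diff j : node j.+1 - node j = (rate j)^-1.
Proof.
rewrite /node /rate exprS invfM.
have : (2^-1 : R) * 2 = 1 by rewrite mulVf.
by move: ((2 ^+ j)^-1) => y; lra.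
Qed.

Lemma node_ltS j : node j < node j.+1.
Proof. by rewrite -subr_gt0 node_diff invr_gt0 rate_gt0. Qed.

Lemma node_le j k : (j <= k)%N -> node j <= node k.
Proof.
elim: k => [|k IH]; first by rewrite leqn0 => /eqP ->.
rewrite leq_eqVlt => /predU1P[->//|/IH jk].
by apply: le_trans jk (ltW (node_ltS k)).
Qed.

Lemma node0 : node 0 = 0. Proof. by rewrite /node expr0 invr1 subrr. Qed.

Lemma node_ge0 j : 0 <= node j. Proof. by rewrite -node0 node_le. Qed.

Lemma node_lt1 j : node j < 1.
Proof. by rewrite /node ltrBlDr ltrDl invr_gt0. Qed.

Lemma nat_lt_two (n : nat) : n%:R < 2 ^+ n :> R.
Proof. by rewrite -natrX ltr_nat ltn_expl. Qed.

Lemma node_exists t : t < 1 -> exists n, t < node n.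
Proof.
move=> t1; have t10 : 0 < 1 - t by rewrite subr_gt0.
exists (Num.truncn (1 - t)^-1).+1; set n := _.+1.
have H : (1 - t)^-1 < 2 ^+ n.
  by apply: lt_trans (nat_lt_two n); exact: truncnS_gt.
by rewrite /node ltrBrDr -ltrBrDl -[1 - t]invrK ltf_pV2 ?posrE// invr_gt0.
Qed.

Lemma node_cvg : node @ \oo --> (1 : R).
Proof.
apply/cvgrPdist_lt => e e0; have [N HN] := @node_exists (1 - e) ltac:(lra).
exists N => // n /= Nn; have := node_le Nn; have := node_lt1 n => h1 h2.
by rewrite gtr0_norm ?subr_gt0//; lra.
Qed.

(** The i-th derivative of the logarithmic derivative of the curve
    t |-> exp(rho(rate j (t - node j)) X_j), by the chain rule for an affine change
    of time. *)
Definition bump_term (i j : nat) (t : R) : E :=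
  rate j ^+ i.+1 *: Om Xi i (rate j * (t - node j), X j).

Lemma bump_term_left i j t : t <= node j -> bump_term i j t = 0.
Proof.
move=> tj; rewrite /bump_term (Om_left hE Xi_chart Xi_dom1 Xi1 Xi_convex) ?scaler0//.
by rewrite mulr_ge0_le0 ?subr_le0// ltW// rate_gt0.
Qed.

Lemma bump_term_right i j t : node j.+1 <= t -> bump_term i j t = 0.
Proof.
move=> tj; rewrite /bump_term (Om_right hE Xi_chart Xi_dom1 Xi1 Xi_convex) ?scaler0//.
by rewrite -ler_pdivrMl ?rate_gt0// mulr1 -node_diff lerD2r.
Qed.

Definition bump_sum (i n : nat) (t : R) : E := \sum_(j < n) bump_term i j t.

Lemma bump_sumE i n m t : t <= node n -> (n <= m)%N ->
  bump_sum i m t = bump_sum i n t.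
Proof.
move=> tn; elim: m => [|m IH]; first by rewrite leqn0 => /eqP ->.
rewrite leq_eqVlt ltnS => /predU1P[->//|nm].
rewrite -IH// /bump_sum big_ord_recr /= bump_term_left ?addr0//.
by apply: le_trans tn _; exact: node_le.
Qed.

(** The i-th derivative of the sum of all bumps, extended by 0; on the left of
    [node n] it is the sum of the first n terms. *)
Definition bumps (i : nat) (t : R) : E :=
  if t < 1 then bump_sum i (xget 0%N [set n | t < node n]) t else 0.

Lemma bumpsE i n t : t < node n -> bumps i t = bump_sum i n t.
Proof.
move=> tn; rewrite /bumps (lt_trans tn (node_lt1 n)).
case: xgetP => [m _ /= tm|/(_ n)//].
case: (leqP n m) => nm; first exact: bump_sumE (ltW tn) nm.
by rewrite [RHS](@bump_sumE i m) ?ltW// ltnW.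
Qed.

Lemma bumps_ge1 i t : 1 <= t -> bumps i t = 0.
Proof. by rewrite /bumps ltNge => ->. Qed.

Lemma bumps_piece i j t : node j <= t -> t <= node j.+1 ->
  bumps i t = bump_term i j t.
Proof.
move=> jt tj; have tj2 : t < node j.+2 by exact: le_lt_trans tj (node_ltS _).
rewrite (bumpsE i tj2) (bump_sumE i tj (leqnSn _)) /bump_sum big_ord_recr /=.
rewrite big1 ?add0r// => l _; apply: bump_term_right.
by apply: le_trans jt; exact: node_le.
Qed.

Lemma cvg_quot_affine (f : R -> E) (r t1 t : R) d :
  h^-1 *: (f (r * (t - t1) + h) - f (r * (t - t1))) @[h --> (0:R)^'] --> d ->
  h^-1 *: (f (r * (t + h - t1)) - f (r * (t - t1))) @[h --> (0:R)^'] --> r *: d.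
Proof.
move=> /(has_dderiv_R f _ _).2 fd; have H := has_dderivZ (a := r) fd.
apply: cvg_trans H; apply: near_eq_cvg; apply: nearW => h.
congr (_ *: (f _ - _)); rewrite [r *: (1 : R^o)]mulr1.
by rewrite /GRing.scale /=; ring.
Qed.

Lemma bump_term_derivative i j t :
  h^-1 *: (bump_term i j (t + h) - bump_term i j t) @[h --> (0:R)^'] -->
    bump_term i.+1 j t.
Proof.
have H := Om_derivative hE Xi_chart Xi_dom1 Xi1 Xi_convex (i := i)
  (s := rate j * (t - node j)) (cX j).
have {}H := cvg_quot_affine (f := fun s => Om Xi i (s, X j)) H.
have H2 : rate j ^+ i.+1 *: (h^-1 *: (Om Xi i (rate j * (t + h - node j), X j) -
    Om Xi i (rate j * (t - node j), X j))) @[h --> (0:R)^'] -->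
    rate j ^+ i.+1 *: (rate j *: Om Xi i.+1 (rate j * (t - node j), X j)).
  by apply: tcvgZ; [exact: cvg_cst|exact: H].
rewrite /bump_term [rate j ^+ i.+2]exprSr -scalerA.
apply: cvg_trans H2; apply: near_eq_cvg; apply: nearW => h.
by rewrite -scalerBr !scalerA mulrC.
Qed.

(** Faster decrease, in every seminorm, than any power of the lengths 2^-(j+1) of
    the intervals. *)
Definition fast_decreasing : Prop := forall p : cseminorm E,
  exists (c : R) (l : nat), 0 <= c /\
  forall j : nat, (l <= j)%N -> p (X j) <= c * (2 ^+ (j.+1 * j.+1))^-1.

Context (X_fast : fast_decreasing).

(** The bumps and their derivatives vanish to second order at the end point,
    as the [X j] decrease faster than the powers of [rate j] that the i-th
    derivative brings in. *)
Lemma bumps_near1 i (p : cseminorm E) : exists c d : R, [/\ 0 <= c, 0 < d &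
  forall t, 1 - d < t -> t < 1 -> p (bumps i t) <= c * (1 - t) ^+ 2].
Proof.
have [q qP] := Om_bound hE Xi_chart Xi_dom1 Xi1 Xi_convex i p.
have [c [l [c0 cl]]] := X_fast q.
pose J := (maxn l (maxn (Num.truncn c).+1 i.+2)).
exists c, (2 ^+ J)^-1; split=> //; move=> t tJ t1; have tJ' : node J < t by exact: tJ.
have [n tn nmin] := ex_minnP (node_exists t1).
case: n tn nmin => [|j] tn nmin.
  by move: tn; rewrite node0 ltNge (ltW (le_lt_trans (node_ge0 J) tJ')).
have jt : node j <= t by rewrite leNgt; apply/negP => /nmin; rewrite ltnn.
have Jj : (J <= j)%N.
  rewrite leqNgt; apply/negP => jJ; have := node_le jJ.
  by rewrite leNgt (lt_trans tJ' tn).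
have [lj cj ij] : [/\ (l <= j)%N, (Num.truncn c < j)%N & (i.+2 <= j)%N].
  by move: Jj; rewrite !geq_max => /and3P[].
rewrite (bumps_piece i jt (ltW tn)) /bump_term.
set s := rate j * (t - node j); have r0 := rate_gt0 j.
have s0 : 0 <= s by rewrite mulr_ge0 ?subr_ge0// ltW.
have s1 : s <= 1 by rewrite -ler_pdivlMl// mulr1 -node_diff lerD2r ltW.
have aE : (2 ^+ (j.+1 * j.+1) : R) = rate j ^+ j.+1 by rewrite exprM.
have r1 : 1 <= rate j by rewrite exprn_ege1// ler1n.
have qX := cl j lj; rewrite aE in qX.
(* j is large enough for [X j] to lie in the unit ball of q and for the exponent
   j + 1 to absorb i + 1 factors [rate j], with two to spare. *)
have cle : c <= rate j ^+ j.+1.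
  apply/ltW; apply: lt_le_trans (truncnS_gt c) _.
  apply/ltW; apply: lt_le_trans (nat_lt_two _) _.
  rewrite -aE; apply: ler_weXn2l; first by rewrite ler1n.
  by rewrite (leq_trans cj)// (leq_trans (leqnSn j))// leq_pmulr.
have rp : 0 < rate j ^+ j.+1 by rewrite exprn_gt0.
have qX1 : q (X j) <= 1.
  by apply: le_trans qX _; rewrite ler_pdivrMr// mul1r.
have [_ pq] := qP s s0 s1 (X j) qX1.
rewrite seminormZ gtr0_norm ?exprn_gt0//.
have H1 : rate j ^+ i.+1 * p (Om Xi i (s, X j)) <=
    rate j ^+ i.+1 * (c * (rate j ^+ j.+1)^-1).
  by rewrite ler_pM2l ?exprn_gt0//; exact: le_trans pq qX.
apply: (le_trans H1); rewrite mulrCA ler_wpM2l//.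
have H2 : (rate j)^-1 <= 1 - t by move: tn; rewrite /node -/(rate j); lra.
apply: (@le_trans _ _ ((rate j)^-1 ^+ 2)); last first.
  by apply: lerXn2r => //; rewrite nnegrE ?invr_ge0 ?subr_ge0 ltW.
rewrite exprVn ler_pdivrMr// mulrC ler_pdivlMr ?exprn_gt0//.
rewrite -exprD; apply: ler_weXn2l => //.
by rewrite addn2.
Qed.

End BumpSeries.

Section BumpCurve.
Context {R : realType} {E : tvsType R} (hE : hausdorff_space E) (G : lieGroup E).
Context (Xi : chart G E) (Xi_chart : smooth_chart (lie_manifold G) Xi)
  (Xi_dom1 : chart_dom Xi 1%g) (Xi1 : Xi 1%g = 0)
  (Xi_convex : convex_set (chart_cod Xi)).
Context (X : nat -> E) (cX : forall j, chart_cod Xi (X j)).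
Context (X_fast : fast_decreasing X).

Local Notation bumps := (bumps Xi X).

Lemma bump_sum_derivative i n t :
  h^-1 *: (bump_sum Xi X i n (t + h) - bump_sum Xi X i n t) @[h --> (0:R)^'] -->
    bump_sum Xi X i.+1 n t.
Proof.
elim: n => [|n IH].
  rewrite /bump_sum; apply: cvg_near_cst; apply: nearW => h.
  by rewrite !big_ord0 subrr scaler0.
have H := bump_term_derivative hE Xi_chart Xi_dom1 Xi1 Xi_convex cX (i := i) (j := n) (t := t).
have {IH}H : h^-1 *: (bump_sum Xi X i n (t + h) - bump_sum Xi X i n t) +
    h^-1 *: (bump_term Xi X i n (t + h) - bump_term Xi X i n t) @[h --> (0:R)^'] -->
    bump_sum Xi X i.+1 n t + bump_term Xi X i.+1 n t by apply: tcvgD.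
rewrite /bump_sum [X in _ --> X]big_ord_recr /=.
apply: cvg_trans H; apply: near_eq_cvg; apply: nearW => h.
by rewrite !big_ord_recr /= -scalerDr addrACA opprD.
Qed.

(** On the left of 1 the sum is locally finite.  At 1 the difference quotient for
    h < 0 is at most c |h| by [bumps_near1]. *)
Lemma bumps_derivative i t :
  h^-1 *: (bumps i (t + h) - bumps i t) @[h --> (0:R)^'] --> bumps i.+1 t.
Proof.
have bE := bumpsE hE Xi_chart Xi_dom1 Xi1 Xi_convex cX.
have tsh : t + h @[h --> (0:R)^'] --> (t : R) by exact: cvg_shift.
have [t1|t1] := ltP t 1.
  have [n tn] := node_exists t1.
  rewrite (bE i _ _ tn) (bE i.+1 _ _ tn).
  apply: cvg_trans (@bump_sum_derivative i n t); apply: near_eq_cvg.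
  have nt : \forall h \near (0:R)^', t + h < node n.
    have nn : nbhs t [set s : R | s < node n] by exact: lt_nbhsl.
    exact: tsh nn.
  by apply: filterS nt => h hn; rewrite !(bE _ n).
rewrite (bumps_ge1 Xi X i t1) (bumps_ge1 Xi X i.+1 t1).
move: t1; rewrite le_eqVlt => /predU1P[<-|t1]; last first.
  apply: cvg_near_cst; have nt : \forall h \near (0:R)^', 1 < t + h.
    have nn : nbhs t [set s : R | 1 < s] by exact: lt_nbhsr.
    exact: tsh nn.
  by apply: filterS nt => h hn; rewrite !bumps_ge1 ?subrr ?scaler0 ?ltW.
apply/cvg_snP => p e e0.
have [c [d [c0 d0 cd]]] := bumps_near1 hE Xi_chart Xi_dom1 Xi1 Xi_convex cX X_fast i p.
apply: near_dnbhs0E.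
  apply/near_rightE; exists 1 => // h h0 _.
  by rewrite bumps_ge1 ?lerDl ?ltW// !subr0 scaler0 sn0.
apply/near_leftE; exists (Num.min d (e / (c + 1))).
  by rewrite lt_min d0 divr_gt0// ltr_wpDl.
move=> h h0; rewrite ltrNl lt_min => /andP[hd he].
rewrite !subr0 seminormZ normfV ltr0_norm//.
have := cd (1 + h) ltac:(lra) ltac:(lra); rewrite opprD addNKr => H.
rewrite mulrC ltr_pdivrMr ?oppr_gt0//; apply: le_lt_trans H _.
rewrite expr2 mulrA ltr_pM2r ?oppr_gt0//.
move: he; rewrite ltr_pdivlMr ?ltr_wpDl//; nra.
Qed.

Lemma Sm_bumps i k : @Sm R k R^o E setT (bumps i).
Proof.
elim: k i => [|k IH] i; last exact: Sm_curve (@bumps_derivative i) (IH i.+1).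
by apply: Sm0 => t _; exact: quot_continuous (@bumps_derivative i t).
Qed.

Definition bump_curve (t : R) : lie_alg G := dXi_inv Xi (bumps 0 t).

Lemma dXi_bump_curve t : dXi Xi (bump_curve t) = bumps 0 t.
Proof. exact: dXi_invK. Qed.

Lemma Sm_bump_curve k : @Sm R k R^o E setT bump_curve.
Proof.
have oT (F : tvsType R) : open [set: F] by exact: openT.
apply: (Sm_comp (V := setT) (g := dXi_inv Xi : E -> E) (oT R^o) (oT E)) => //.
  exact: Sm_bumps.
apply: Sm_linear; last exact: dXi_inv_continuous.
move=> a x y; apply: (can_inj (dXiK hE Xi_chart Xi_dom1 Xi1)).
have := dXiD hE Xi_chart Xi_dom1 (a *: dXi_inv Xi x) (dXi_inv Xi y).
have := dXiZ hE Xi_chart Xi_dom1 a (dXi_inv Xi x).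
move=> eZ eD; rewrite [RHS]eD eZ.
by rewrite !(dXi_invK hE Xi_chart Xi_dom1 Xi1).
Qed.

Lemma bump_curve_lip (p : cseminorm E) : exists2 L : R, 0 <= L &
  forall t t', t \in `[0, 1] -> t' \in `[0, 1] ->
    p (bumps 0 t - bumps 0 t') <= L * `|t - t'|.
Proof.
have pc : continuous (p \o bumps 1 : R -> R).
  move=> t; apply: (@continuous_comp _ _ _ (bumps 1) p).
    exact: quot_continuous (@bumps_derivative 1 t).
  exact: seminorm_continuous.
have [c _ cmax] := EVT_max (@ler01 R) (continuous_subspaceT pc).
exists (p (bumps 1 c)); first exact: sn_ge0.
have main t t' : t \in `[0, 1] -> t' \in `[0, 1] -> t <= t' ->
    p (bumps 0 t' - bumps 0 t) <= p (bumps 1 c) * `|t' - t|.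
  rewrite !in_itv /= => /andP[t0 t1] /andP[t'0 t'1] tt'.
  rewrite ger0_norm ?subr_ge0//; apply: mean_value => // s ts st.
    exists (bumps 1 s).
      apply: cvg_trans (@bumps_derivative 0 s); apply: cvg_app.
      exact: at_right_dnbhs.
    by apply: cmax; rewrite in_itv /=; lra.
  exists (bumps 1 s).
    apply: cvg_trans (@bumps_derivative 0 s); apply: cvg_app.
    exact: at_left_dnbhs.
  by apply: cmax; rewrite in_itv /=; lra.
move=> t t' ht ht'; have [tt'|/ltW tt'] := leP t t'; last exact: main.
by rewrite -snN opprB distrC; exact: main.
Qed.

(** The curve is smooth on the whole line; it is Lipschitz on [0,1] because its
    derivative is bounded there. *)
Lemma bump_curve_C k : C_curve Xi k 0 1 bump_curve.
Proof.
have TI : interval_nbhs 0 1 [set: R].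
  by split=> //; exact: openT.
have oT : open [set: R^o] by exact: openT.
case: k => [n| |].
- by exists setT, bump_curve; split=> //; exact: (Sm_Ck hE oT (Sm_bump_curve n)).
- move=> p; have [L L0 Lp] := bump_curve_lip p; exists L => // t t' ht ht'.
  rewrite /sdot (dXiB hE Xi_chart Xi_dom1) !dXi_bump_curve; exact: Lp.
- by exists setT, bump_curve; split=> // n; exact: (Sm_Ck hE oT (Sm_bump_curve n)).
Qed.

End BumpCurve.

(** * Semiregularity implies Mackey completeness *)

Section MackeyCompleteness.
Context {R : realType} {E : tvsType R} (hE : hausdorff_space E) (G : lieGroup E).
Context (Xi : chart G E) (Xi_chart : smooth_chart (lie_manifold G) Xi)
  (Xi_dom1 : chart_dom Xi 1%g) (Xi1 : Xi 1%g = 0)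
  (Xi_convex : convex_set (chart_cod Xi))
  (G_mu_convex : locally_mu_convex Xi).

Local Notation exp := (chart_inv Xi).

Section FastSequences.
Context (X : nat -> E) (cX : forall j, chart_cod Xi (X j)).
Context (X_fast : fast_decreasing X).

(** The exponential of the bumped line connects g to exp(X_j) g. *)
Lemma good_bump (g : G) j :
  good Xi (fun s => exp (rho (rate j * (s - node j)) *: X j) * g)%g
    (bumps Xi X 0) (node j) (node j.+1).
Proof.
set Q := fun s => _; have QR t : Rd Xi (0:R)^' Q t (bump_term Xi X 0 j t).
  rewrite /bump_term expr1; exact: Rd_bumped.
have bc t : bump_term Xi X 0 j (t + h) @[h --> (0:R)^'] --> bump_term Xi X 0 j t.
  have c : {for t, continuous (bump_term Xi X 0 j)}.
    exact: quot_continuous (@bump_term_derivative _ _ hE _ _ Xi_chart Xi_dom1 Xi1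
      Xi_convex _ cX 0 j t).
  have sh : t + h @[h --> (0:R)^'] --> (t : R) by exact: cvg_shift.
  exact: (cvg_comp _ _ sh c).
apply: (@good_congr _ _ _ _ Q _ (bump_term Xi X 0 j)) => //.
  move=> t /andP[t1 t2].
  by rewrite (bumps_piece hE Xi_chart Xi_dom1 Xi1 Xi_convex cX 0 (ltW t1) (ltW t2)).
split=> t _ _; exists (bump_term Xi X 0 j t).
- by apply: cvg_trans (bc t); apply: cvg_app; exact: at_right_dnbhs.
- exact: Rd_at_right.
- by apply: cvg_trans (bc t); apply: cvg_app; exact: at_left_dnbhs.
- exact: Rd_at_left.
Qed.

(** The curve with logarithmic derivative [bump_curve] passes through the
    sequence, up to a fixed right factor, and is continuous at the end point. *)
Lemma fast_products_converge k (h : nat -> G) : semiregular Xi k ->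
  (forall j, h j.+1 = exp (X j) * h j)%g -> exists x : G, h @ \oo --> x.
Proof.
move=> sk hS.
have CB := bump_curve_C hE Xi_chart Xi_dom1 Xi1 Xi_convex cX X_fast.
have [mu Cmu muE] : Dset 0 1 (bump_curve Xi X).
  by have : Dk Xi k 0 1 (bump_curve Xi X) by [rewrite sk; exact: CB]; case.
have gmu : good Xi mu (bumps Xi X 0) 0 1.
  apply: (good_congr (eta := mu) (b := dXi Xi \o bump_curve Xi X)) => //.
    by move=> t _; rewrite /= dXi_bump_curve.
  exact: good_C1_curve Cmu muE (CB _).
have hE' j : ((mu (node j))^-1 * h j = (mu (node 0))^-1 * h 0%N)%g.
  elim: j => // j <-.
  have gj : good Xi mu (bumps Xi X 0) (node j) (node j.+1).
    apply: good_sub gmu; first exact: node_ge0.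
    exact/ltW/node_lt1.
  have := good_unique hE Xi_chart Xi_dom1 Xi1 G_mu_convex (ltW (node_ltS j))
    gj (good_bump (h j) j).
  rewrite /= subrr mulr0 node_diff divff ?gt_eqF ?rate_gt0//.
  rewrite rho1; last by lra.
  by rewrite rho0 ?invr_ge0// scale0r exp0// mul1g scale1r hS.
have mu1 : mu t @[t --> (1 : R)] --> mu 1.
  have [J [_ _ J01] [mc _]] := Cmu.
  by apply: mc; apply: J01; rewrite /= in_itv /= ler01 lexx.
have H : (mu (node n) * ((mu (node 0))^-1 * h 0%N))%g @[n --> \oo] -->
    (mu 1%R * ((mu (node 0))^-1 * h 0%N))%g.
  apply: cvg_mulG; last exact: cvg_cst.
  exact: (cvg_comp _ _ (@node_cvg R) mu1).
exists (mu 1%R * ((mu (node 0))^-1 * h 0%N))%g.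
apply: cvg_trans H; apply: near_eq_cvg; apply: nearW => n.
by rewrite -(hE' n) mulgA mulgV mul1g.
Qed.

End FastSequences.

(** For a fixed late member g(s(j)) of the subsequence, all later g(m) are products
    g(s(j)) w with w close to the unit. *)
Lemma cauchy_subseq_cvg (g : nat -> G) (s : nat -> nat) (x : G) :
  cauchy_seq Xi g -> (forall j, (j <= s j)%N) -> g (s j) @[j --> \oo] --> x ->
  g @ \oo --> x.
Proof.
move=> gC sj gx U Ux.
have [[V W] [/= nV nW] VW] : nbhs (x, 1%g : G) [set z | U (z.1 * z.2)%g].
  by apply: mulG_continuous; rewrite /= mulg1.
have [p pW] : exists p : cseminorm E, forall Y, p Y < 1 -> W (exp Y).
  apply: gauge; apply: chart_inv_continuous; first exact: cod0.
  by rewrite exp0.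
have half : 0 < 2^-1 :> R by rewrite invr_gt0.
have [N NP] := gC p 2^-1 half.
have nN : \forall j \near \oo, (N <= j)%N by exists N.
have [j [Nj Vj]] := filter_ex (filterI nN (gx _ nV)).
exists N => // m /= Nm; have [dm pm] := NP (s j) m (leq_trans Nj (sj j)) Nm.
have -> : g m = (g (s j) * ((g (s j))^-1 * g m))%g by rewrite mulgA mulgV mul1g.
apply: (VW (g (s j), (g (s j))^-1 * g m)%g); split => //=.
rewrite -(chart_mapK dm).
by apply: pW; apply: le_lt_trans pm _; lra.
Qed.

(** Consecutive quotients of a subsequence of a Mackey-Cauchy sequence decrease
    as fast as required, the factor lam being the same for all seminorms. *)
Lemma semiregular_mackey_complete k : semiregular Xi k -> mackey_complete Xi.
Proof.
move=> sk g [c [l [lam [c0 lam0 gP]]]].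
have [lam_ge0 _] := lam0.
have gC : cauchy_seq Xi g.
  move=> p e e0.
  have e1 : 0 < e / (c p + 1) by rewrite divr_gt0// ltr_wpDl.
  have [N NP] := null_double_seqP lam0 e1.
  exists (maxn N (l p)) => m n; rewrite !geq_max => /andP[Nm lm] /andP[Nn ln].
  have [d le] := gP p m n lm ln; split=> //; apply: le_trans le _.
  have := NP m n Nm Nn; rewrite ltr_pdivlMr ?ltr_wpDl//.
  by have := c0 p; have := lam_ge0 m n; nra.
have e_gt0 j : 0 < (2 ^+ (j.+1 * j.+1))^-1 :> R by rewrite invr_gt0 exprn_gt0.
have [N NP] := choice (fun j => null_double_seqP lam0 (e_gt0 j)).
pose s j := (\sum_(i < j.+1) N i + (j + l snzero))%N.
have sN j : (N j <= s j)%N by rewrite /s big_ord_recr /= addnAC leq_addl.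
have sS j : (s j <= s j.+1)%N.
  rewrite /s (big_ord_recr j.+1) /= -addnA leq_add2l.
  by rewrite (leq_trans _ (leq_addl _ _))// leq_add2r.
have sj j : (j <= s j)%N by rewrite /s addnCA leq_addr.
have sl j : (l snzero <= s j)%N by rewrite /s addnA leq_addl.
pose a j := ((g (s j.+1))^-1 * g (s j))%g.
have da j : chart_dom Xi (a j) by have [] := gP snzero _ _ (sl j.+1) (sl j).
have [x hx] : exists x : G, (g (s j))^-1%g @[j --> \oo] --> x.
  apply: (@fast_products_converge (Xi \o a)) sk _.
  - by move=> j; exact: chart_mapP.
  - move=> p; exists (c p), (l p); split=> // j lj.
    have lsj := leq_trans lj (sj j).
    have [_ le] := gP p _ _ (leq_trans lsj (sS j)) lsj.
    apply: le_trans le _; apply: ler_wpM2l => //; apply/ltW/NP => //.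
    exact: leq_trans (sN j) (sS j).
  - by move=> j; rewrite /= chart_mapK// mulgK.
exists x^-1%g; apply: cauchy_subseq_cvg gC sj _.
have := cvg_invG hx.
by under eq_fun do rewrite invgK.
Qed.

End MackeyCompleteness.

(** * The characterization of semiregularity *)

Theorem mainTheorem3 (R : realType) (E : tvsType R) (hE : hausdorff_space E)
    (G : lieGroup E) (Xi : chart G E)
    (Xi_chart : smooth_chart (lie_manifold G) Xi)
    (Xi_dom1 : chart_dom Xi 1%g) (Xi1 : Xi 1%g = 0)
    (Xi_convex : convex_set (chart_cod Xi))
    (G_mu_convex : locally_mu_convex Xi) :
  (forall k : regularity, k <> Cfin 0 ->
     (semiregular Xi k <-> mackey_complete Xi /\ confined Xi k)) /\
  (sequentially_complete Xi /\ confined Xi (Cfin 0) ->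
     semiregular Xi (Cfin 0)).
Proof.
split=> [k kN0|[sc cf]]; last by apply: semiregular_sequential.
split=> [sk|[mc ck]]; last exact: semiregular_mackey kN0 mc ck.
split; last exact: semiregular_confined kN0 sk.
exact: semiregular_mackey_complete sk.
Qed.
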